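(* Let $C=\{(z,t)\in\mathbb H : z\in D,\ f(z)\le t\le g(z)\}$, where $D\subseteq\mathbb R^2$ is a convex compact set with nonempty interior and $f,-g:D\to\mathbb R$ are convex functions. If $C$ is a convex isoperimetric set in the Heisenberg group with perimeter $\mathcal P(C)$ and volume $\mathcal V(C)$, then $f$ satisfies in distributional sense the partial differential equation $$\mathrm{div}\left(\frac{\nabla f(z)+2z^\perp}{|\nabla f(z)+2z^\perp|}\right)=H\quad\text{in }\mathrm{int}(D)\setminus\Sigma(f),\qquad H=\frac{3\mathcal P(C)}{4\mathcal V(C)} .$$
   Context: The Heisenberg group $\mathbb H$ is $\mathbb R^3=\mathbb C\times\mathbb R$ with group law $(z,t)(z',t')=(z+z',t+t'+2\,\mathrm{Im}(z\bar z'))$, where for $z=x+iy$, $z'=x'+iy'$, $\mathrm{Im}(z\bar z')=yx'-xy'$. Let $X=\partial_x+2y\,\partial_t$, $Y=\partial_y-2x\,\partial_t$; $\mathcal V(A)=\mathcal L^3(A)$; $\mathcal P(A)=\sup\{\int_A (X\varphi_1+Y\varphi_2)\,d\mathcal L^3 : \varphi_1,\varphi_2\in C^1_c(\mathbb R^3),\ \varphi_1^2+\varphi_2^2\le 1\}$. A measurable set $A$ with $0<\mathcal V(A)<\infty$ is isoperimetric if it minimizes $\mathcal P(A)^{4/3}/\mathcal V(A)$ among all such sets. Convexity is the usual one in $\mathbb R^3$. For $z=(x,y)$, $z^\perp=(-y,x)$. For $p=(z,t)$ the horizontal plane at $p$ is $\mathrm H_p=\{(z',t') : t'=t+2\,\mathrm{Im}(z\bar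 z')\}$. A plane $\pi$ through $p\in\partial C$ is a supporting plane for $C$ at $p$ if $\pi\cap\overline C\subseteq\partial C$. $\Sigma(f)$ is the set of $z\in D$ such that $\mathrm H_p$ with $p=(z,f(z))$ is a supporting plane for $C$. *)

(* Defs.v *)
From HB Require Import structures.
From mathcomp Require Import all_boot all_order all_algebra.
From mathcomp Require Import all_classical all_reals all_analysis.

Set Implicit Arguments.
Unset Strict Implicit.
Unset Printing Implicit Defensive.

Import Order.TTheory GRing.Theory Num.Theory.
Import numFieldNormedType.Exports.

Local Open Scope classical_set_scope.
Local Open Scope ring_scope.

(* The plane is [R * R] and the Heisenberg group is [R * R * R], so that a point
   is [(z, t)] with [z = (x, y)].  Both carry the product topology; the library
   norm on a product is the max norm, hence the Euclidean [enorm] below. *)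

(* The library product of Lebesgue measures lives on the product of the Borel
   sigma-algebras; [leb2] and [leb3] are its completions, whose measurable sets
   are the Lebesgue measurable ones. *)
Section lebesgue.
Variable R : realType.
Local Open Scope ereal_scope.
Local Open Scope measure_scope.
Let mu := @lebesgue_measure R.

Definition borel_leb2 := mu \x mu.
HB.instance Definition _ := Measure.on borel_leb2.

Definition borel_leb3 := (mu \x mu) \x mu.
HB.instance Definition _ := Measure.on borel_leb3.

Definition lebesgue_measurable (A : set (R * R * R)) : Prop :=
  borel_leb3^*.-cara.-measurable A.

Definition leb2 := @completed_measure_extension _ _ _ borel_leb2.
HB.instance Definition _ := Measure.on leb2.

Definition leb3 := @completed_measure_extension _ _ _ borel_leb3.
HB.instance Definition _ := Measure.on leb3.

End lebesgue.
Arguments leb2 {R}.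
Arguments leb3 {R}.

Section differentiability.
Variables (R : realType) (V : normedModType R).

(* On a finite-dimensional space this is the usual class C^k: the directional
   derivatives in all directions are linear combinations of the partial ones. *)
Fixpoint class_C (k : nat) (f : V -> R) : Prop :=
  if k is k'.+1 then
    (forall p, differentiable f p) /\ (forall v, class_C k' ('D_v f))
  else continuous f.

Definition tsupport (f : V -> R) : set V := closure [set p | f p != 0].

Definition C1c (f : V -> R) : Prop := class_C 1 f /\ compact (tsupport f).

Definition test_function (U : set V) (f : V -> R) : Prop :=
  [/\ forall k, class_C k f, compact (tsupport f) & tsupport f `<=` U].

End differentiability.

Section plane.
Variable R : realType.
Implicit Types (z w : R * R) (U : set (R * R)).

Definition dot z w : R := z.1 * w.1 + z.2 * w.2.

Definition enorm z : R := Num.sqrt (dot z z).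

Definition perp z : R * R := (- z.2, z.1).

(* Im (z * conj w) for z, w read as complex numbers. *)
Definition im_mul_conj z w : R := z.2 * w.1 - z.1 * w.2.

Definition gradient (f : R * R -> R) z : R * R :=
  ('D_((1, 0) : R * R) f z, 'D_((0, 1) : R * R) f z).

(* Planar version of the library's one-dimensional [locally_integrable]. *)
Definition locally_integrable2 U (F : R * R -> R) : Prop :=
  [/\ measurable_fun (U : set (caratheodory_type (@borel_leb2 R)^*%mu)) F,
      open U &
      forall K, K `<=` U -> compact K ->
        (\int[leb2]_(z in K) `|F z|%:E < +oo)%E].

(* div F = h in the sense of distributions on the open set U; F and h only
   matter up to Lebesgue null sets. *)
Definition distributional_div U (F : R * R -> R * R) (h : R * R -> R) : Prop :=
  [/\ locally_integrable2 U (fun z => (F z).1),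
      locally_integrable2 U (fun z => (F z).2),
      locally_integrable2 U h &
      forall phi, test_function U phi ->
        (- (\int[leb2]_(z in U) (dot (F z) (gradient phi z))%:E) =
         \int[leb2]_(z in U) (h z * phi z)%:E)%E].

End plane.

Section heisenberg.
Variable R : realType.
Implicit Types (p : R * R * R) (A C : set (R * R * R)) (phi : R * R * R -> R).

Definition field_X phi p : R :=
  'D_((1, 0, 0) : R * R * R) phi p
  + 2 * p.1.2 * 'D_((0, 0, 1) : R * R * R) phi p.

Definition field_Y phi p : R :=
  'D_((0, 1, 0) : R * R * R) phi p
  - 2 * p.1.1 * 'D_((0, 0, 1) : R * R * R) phi p.

Definition volume A : \bar R := leb3 A.

Definition perimeter A : \bar R :=
  ereal_sup [set s | exists phi1 phi2,
    [/\ C1c phi1, C1c phi2,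
        forall p, phi1 p ^+ 2 + phi2 p ^+ 2 <= 1 &
        s = (\int[leb3]_(p in A) (field_X phi1 p + field_Y phi2 p)%:E)%E]].

Definition isoperimetric_ratio A : \bar R :=
  (poweR (perimeter A) (4 / 3) / volume A)%E.

Definition admissible A : Prop :=
  lebesgue_measurable A /\ (0 < volume A < +oo)%E.

Definition isoperimetric A : Prop :=
  admissible A /\
  forall B, admissible B -> (isoperimetric_ratio A <= isoperimetric_ratio B)%E.

Definition horizontal_plane p : set (R * R * R) :=
  [set q | q.2 = p.2 + 2 * im_mul_conj p.1 q.1].

Definition boundary A : set (R * R * R) := closure A `\` interior A.

(* [pi] is meant to be a plane; it is only used with horizontal planes. *)
Definition supporting_plane C p (pi : set (R * R * R)) : Prop :=
  [/\ boundary C p, pi p & pi `&` closure C `<=` boundary C].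

Definition Sigma C (D : set (R * R)) (f : R * R -> R) : set (R * R) :=
  [set z | D z /\ supporting_plane C (z, f z) (horizontal_plane (z, f z))].

Definition region (D : set (R * R)) (f g : R * R -> R) : set (R * R * R) :=
  [set p | D p.1 /\ f p.1 <= p.2 <= g p.1].

End heisenberg.

(* Main.v *)
Require Import Defs.
(* Put v = grad f + 2 z^perp.  Outside Sigma(f) one has f < g, and v does not
   vanish where f is differentiable, that is almost everywhere.  For a test
   function phi, replacing f by f + eps phi changes the volume of C into
   V(C) - eps int phi, and its perimeter is at most
     P(C) + int (|v + eps grad phi| - |v|).
   Indeed, near the graph of f the flux of a horizontal field (psi_1, psi_2) is
   int psi . v, so an almost optimal competitor for P(C) is obtained from any
   field admissible for the perturbed set by switching it, with a cut-off, to a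
   smooth approximation of v/|v| near the graph; comparing both fluxes gives the
   bound.  The isoperimetric inequality for eps of both signs, divided by eps,
   then yields int (v/|v|) . grad phi = - 3 P(C) / (4 V(C)) int phi. *)
From HB Require Import structures.
From mathcomp Require Import all_boot all_order all_algebra.
From mathcomp Require Import all_classical all_reals all_analysis.
From mathcomp Require Import measurable_realfun.
From mathcomp Require Import lra ring.

Set Implicit Arguments.
Unset Strict Implicit.
Unset Printing Implicit Defensive.

Import Order.TTheory GRing.Theory Num.Theory.
Import numFieldNormedType.Exports.
Local Open Scope classical_set_scope.
Local Open Scope ring_scope.

(** * Lebesgue measure on the plane and in space *)

(** The vector v(z) vanishes only if the tangent plane of the graph at z is horizontal. Outside
    [Sigma] some point of the graph lies strictly below that plane, which the subgradient inequality
    forbids for a tangent plane. Hence v(z) is nonzero there, and |v + eps grad phi| can be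
    differentiated at eps = 0.

    The obstacle is that f is only convex. Its partial derivatives exist off a null set because each
    line parallel to an axis meets only countably many kinks. The flux identity comes from
    translating the set, slicing it vertically and using dominated convergence. Since v/|v| may be
    discontinuous, the almost optimal field is built from difference quotients of f.

    The perturbed sets need not be convex: isoperimetric sets minimize among all measurable sets.
    Before perimeters can be compared, P(C) must be finite; otherwise a cube would have a smaller
    ratio. The inequality is used in the form of P^4 / V^3, which makes it polynomial in eps; the
    constant 3/4 is the ratio of these exponents. *)

Definition nbhs_basis (T : topologicalType) (I : Type) (B : I -> set T) :=
  forall x A, nbhs x A -> exists i, B i x /\ B i `<=` A.

Lemma nbhs_basis_prod (T1 T2 : topologicalType) (I1 I2 : Type)
    (B1 : I1 -> set T1) (B2 : I2 -> set T2) :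
  nbhs_basis B1 -> nbhs_basis B2 ->
  nbhs_basis (fun i : I1 * I2 => B1 i.1 `*` B2 i.2).
Proof.
move=> b1 b2 [x y] A [[U V] [/= Ux Vy] UVA].
have [i [ix iU]] := b1 _ _ Ux; have [j [jy jV]] := b2 _ _ Vy.
by exists (i, j); split => // -[a b] [/= /iU Ua /jV Vb]; apply: UVA.
Qed.

Lemma nbhs_basis_real (R : realType) :
  nbhs_basis (fun i : rat * rat => ball (ratr i.1 : R) (ratr i.2)).
Proof.
move=> x A /= Ax.
have oA : open A^° by exact: open_interior.
have [|c [r [/= xB BA]]] := @open_subball_rat R _ x oA.
  by rewrite inE; exact: Ax.
exists (c, r); split; first by move: xB; rewrite inE.
by move=> y /BA; exact: interior_subset.
Qed.

(** One family serves all points. With a countable index the union is countable, which puts the open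
    sets of the product topology into the product sigma-algebra. *)
Lemma open_bigcup_basis (T : topologicalType) (I : Type) (B : I -> set T) O :
  nbhs_basis B -> open O -> O = \bigcup_i (if `[< B i `<=` O >] then B i else set0).
Proof.
move=> bB oO; apply/seteqP; split => [x Ox|x [i _]].
  have [i [ix iO]] := bB x O (open_nbhs_nbhs (conj oO Ox)).
  by exists i => //; rewrite asboolT.
by case: asboolP => // BO /BO.
Qed.

Lemma open_measurable2 (R : realType) (O : set (R * R)) : open O -> measurable O.
Proof.
move/(open_bigcup_basis (nbhs_basis_prod (@nbhs_basis_real R) (@nbhs_basis_real R))) ->.
apply: countable_bigcupT_measurable; first exact: countableP.
move=> i; case: ifP => // _.
by apply: measurableX; apply: open_measurable; exact: ball_open.
Qed.

Lemma open_measurable3 (R : realType) (O : set (R * R * R)) : open O -> measurable O.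
Proof.
move/(open_bigcup_basis (nbhs_basis_prod (nbhs_basis_prod
  (@nbhs_basis_real R) (@nbhs_basis_real R)) (@nbhs_basis_real R))) ->.
apply: countable_bigcupT_measurable; first exact: countableP.
move=> i; case: ifP => // _.
by apply: measurableX; [apply: measurableX|]; apply: open_measurable;
  exact: ball_open.
Qed.

Lemma continuous_measurable_fun2 (R : realType) (U : set (R * R)) (f : R * R -> R) :
  open U -> (forall z, U z -> {for z, continuous f}) -> measurable_fun U f.
Proof.
move=> oU cf; apply: (measurability _ (RGenOpens.measurableE R)).
move=> _ [_ [a [b ->] <-]]; apply: open_measurable2.
rewrite openE => z [Uz fz]; rewrite /interior; near=> w; split.
  by near: w; exact: open_nbhs_nbhs.
by near: w; apply: (cf _ Uz); apply: open_nbhs_nbhs; split => //; exact: interval_open.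
Unshelve. all: by end_near. Qed.

Lemma continuous_measurable_fun3 (R : realType) (U : set (R * R * R)) (f : R * R * R -> R) :
  open U -> (forall z, U z -> {for z, continuous f}) -> measurable_fun U f.
Proof.
move=> oU cf; apply: (measurability _ (RGenOpens.measurableE R)).
move=> _ [_ [a [b ->] <-]]; apply: open_measurable3.
rewrite openE => z [Uz fz]; rewrite /interior; near=> w; split.
  by near: w; exact: open_nbhs_nbhs.
by near: w; apply: (cf _ Uz); apply: open_nbhs_nbhs; split => //; exact: interval_open.
Unshelve. all: by end_near. Qed.

(** * Integrals against a measure and against its completion *)

Section completed.
Context d (T : measurableType d) (R : realType) (mu : {measure set T -> \bar R}).
Let cT := caratheodory_type (mu^*)%mu.
Let cmu : {measure set cT -> \bar R} := @completed_measure_extension _ _ _ mu.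

Lemma measurable_caratheodory (A : set T) : measurable A -> measurable (A : set cT).
Proof. by move=> mA; exact: caratheodory_measurable_mu_ext. Qed.

Lemma measurable_fun_caratheodory d' (T' : measurableType d') (A : set T) (f : T -> T') :
  measurable A -> measurable_fun A f -> measurable_fun (A : set cT) (f : cT -> T').
Proof.
by move=> mA mf _ Y mY; apply: measurable_caratheodory; exact: mf.
Qed.

Lemma completedE (A : set T) : measurable A -> cmu A = mu A.
Proof. exact: measurable_mu_extE. Qed.

(** The identity from the completed space to the original one is measurable, and it pushes the
    completed measure forward to [mu] on measurable sets. *)
Lemma ge0_integral_completed (A : set T) (f : T -> \bar R) :
  measurable A -> measurable_fun A f -> (forall x, A x -> (0 <= f x)%E) ->
  (\int[cmu]_(x in (A : set cT)) f x = \int[mu]_(x in A) f x)%E.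
Proof.
move=> mA mf f0.
have mid : measurable_fun setT (idfun : cT -> T).
  by apply: measurable_fun_caratheodory => //; exact: measurable_id.
transitivity (\int[pushforward cmu (idfun : cT -> T)]_(x in A) f x)%E.
  rewrite (ge0_integral_pushforward mid) //.
  by move=> x; rewrite inE; exact: f0.
apply: eq_measure_integral => B mB _.
exact: completedE.
Qed.

Lemma integral_completed (A : set T) (f : T -> \bar R) :
  measurable A -> measurable_fun A f ->
  (\int[cmu]_(x in (A : set cT)) f x = \int[mu]_(x in A) f x)%E.
Proof.
move=> mA mf; rewrite [LHS]integralE [RHS]integralE.
congr (_ - _)%E; apply: ge0_integral_completed => //.
- exact: measurable_funepos.
- exact: measurable_funeneg.
Qed.
End completed.

Section product_invariance.
Context d1 d2 (T1 : measurableType d1) (T2 : measurableType d2) (R : realType).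
Variable m1 : {sigma_finite_measure set T1 -> \bar R}.
Variable m2 : {sigma_finite_measure set T2 -> \bar R}.
Variables (t1 : T1 -> T1) (t2 : T2 -> T2).
Hypothesis mt1 : measurable_fun setT t1.
Hypothesis mt2 : measurable_fun setT t2.
Hypothesis it1 : forall A, measurable A -> m1 (t1 @^-1` A) = m1 A.
Hypothesis it2 : forall A, measurable A -> m2 (t2 @^-1` A) = m2 A.
Let t (p : T1 * T2) := (t1 p.1, t2 p.2).

Lemma measurable_fun_map_pair : measurable_fun setT t.
Proof.
apply: measurable_fun_pair.
- exact: (measurableT_comp mt1 measurable_fst).
- exact: (measurableT_comp mt2 measurable_snd).
Qed.

(** The image of the product measure under the map takes the same values on rectangles, so
    uniqueness of the product measure identifies the two. *)
Lemma product_measure_invariant (A : set (T1 * T2)) : measurable A ->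
  (m1 \x m2)%E (t @^-1` A) = (m1 \x m2)%E A.
Proof.
move=> mA; apply/esym.
have mt := measurable_fun_map_pair.
rewrite (@product_measure_unique _ _ _ _ _ m1 m2 (pushforward (m1 \x m2)%E t)) //.
move=> B C mB mC; rewrite /pushforward.
transitivity ((m1 \x m2)%E ((t1 @^-1` B) `*` (t2 @^-1` C))); first by [].
have m1B : measurable (t1 @^-1` B) by have := mt1 measurableT mB; rewrite setTI.
have m2C : measurable (t2 @^-1` C) by have := mt2 measurableT mC; rewrite setTI.
by rewrite product_measure1E //; congr (_ * _)%E; [exact: it1|exact: it2].
Qed.
End product_invariance.

Lemma lebesgue_measure_translation (R : realType) (a : R) (A : set R) :
  measurable A -> lebesgue_measure ((fun x => x + a) @^-1` A) = lebesgue_measure A.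
Proof.
move=> mA.
have mt : measurable_fun setT ((fun x => x + a) : R -> measurableTypeR R).
  by apply: continuous_measurable_fun => x; apply: cvgD; [exact: cvg_id|exact: cvg_cst].
change (pushforward lebesgue_measure ((fun x => x + a) : _ -> measurableTypeR R) A =
  lebesgue_measure A).
apply/esym/lebesgue_measure_unique => //= X [[b c] _ <-]; rewrite /pushforward /=.
have -> : (fun x => x + a) @^-1` [set` `]b, c]] = [set` `]b - a, c - a]].
  by apply/seteqP; split => x /=; rewrite !in_itv /= ltrBlDr lerBrDr.
rewrite !lebesgue_measure_itv /= !lte_fin ltrD2r.
by case: ifP => // _; rewrite -!EFinB; congr (_%:E); ring.
Qed.

Notation plane R := (measurableTypeR R * measurableTypeR R)%type.
Notation space R := (measurableTypeR R * measurableTypeR R * measurableTypeR R)%type.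

Section borel_lebesgue.
Variable R : realType.
Local Open Scope ereal_scope.

(** Turned into an instance below, so that product uniqueness and Fubini apply with the plane as
    first factor of space. *)
Lemma borel_leb2_sigma_finite : sigma_finite setT (@borel_leb2 R).
Proof.
have /sigma_finiteP[F [TF ndF Foo]] := sigma_finiteT (@lebesgue_measure R).
exists (fun n => F n `*` F n).
  rewrite -setXTT [in LHS]TF predeqE => -[x y]; split.
    move=> [/= [n _ Fnx] [k _ Gky]]; exists (maxn n k) => //; split.
    - by move: x Fnx; exact/subsetPset/ndF/leq_maxl.
    - by move: y Gky; exact/subsetPset/ndF/leq_maxr.
  by move=> [n _ []/= ? ?]; split; exists n.
move=> k; have [? ?] := Foo k.
split; first exact: measurableX.
by rewrite [ltLHS]product_measure1E// lte_mul_pinfty// ge0_fin_numE.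
Qed.

HB.instance Definition _ := @Measure_isSigmaFinite.Build _ _ _ (@borel_leb2 R)
  borel_leb2_sigma_finite.

Lemma borel_leb2_translation (a : R * R) (A : set (R * R)) :
  measurable A -> borel_leb2 ((fun z => z + a)%R @^-1` A) = borel_leb2 A.
Proof.
have mt (b : R) : measurable_fun setT ((fun x : R => x + b)%R : measurableTypeR R -> measurableTypeR R).
  by apply: continuous_measurable_fun => x; apply: cvgD; [exact: cvg_id|exact: cvg_cst].
move=> mA; exact: (@product_measure_invariant _ _ (measurableTypeR R) (measurableTypeR R) R
  lebesgue_measure lebesgue_measure _ _ (mt a.1) (mt a.2)
  (@lebesgue_measure_translation R _) (@lebesgue_measure_translation R _) _ mA).
Qed.

Lemma borel_leb3_translation (a : R * R * R) (A : set (R * R * R)) :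
  measurable A -> borel_leb3 ((fun z => z + a)%R @^-1` A) = borel_leb3 A.
Proof.
have mt (b : R) : measurable_fun setT ((fun x : R => x + b)%R : measurableTypeR R -> measurableTypeR R).
  by apply: continuous_measurable_fun => x; apply: cvgD; [exact: cvg_id|exact: cvg_cst].
move=> mA; exact: (@product_measure_invariant _ _ (measurableTypeR R * measurableTypeR R)%type
   (measurableTypeR R) R (@borel_leb2 R) lebesgue_measure _ _
   (measurable_fun_map_pair (mt a.1.1) (mt a.1.2)) (mt a.2)
  (@borel_leb2_translation a.1) (@lebesgue_measure_translation R _) _ mA).
Qed.

Lemma integral3_translation (a : R * R * R) (f : space R -> \bar R) :
  measurable_fun setT f ->
  \int[@borel_leb3 R]_p f (p + a)%R = \int[@borel_leb3 R]_p f p.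
Proof.
have mt : measurable_fun setT ((fun p : R * R * R => p + a)%R : space R -> space R).
  have mt (b : R) : measurable_fun setT ((fun x : R => x + b)%R : measurableTypeR R -> measurableTypeR R).
    by apply: continuous_measurable_fun => x; apply: cvgD; [exact: cvg_id|exact: cvg_cst].
  exact: (measurable_fun_map_pair (measurable_fun_map_pair (mt a.1.1) (mt a.1.2)) (mt a.2)).
have H0 (g : space R -> \bar R) : measurable_fun setT g -> (forall p, 0 <= g p) ->
    \int[@borel_leb3 R]_p g (p + a)%R = \int[@borel_leb3 R]_p g p.
  move=> mg g0.
  transitivity (\int[pushforward (@borel_leb3 R) ((fun p : R * R * R => p + a)%R : space R -> space R)]_p g p).
    by apply/esym; have := ge0_integral_pushforward mt (@borel_leb3 R) measurableT mg; apply => x _.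
  by apply: eq_measure_integral => B mB _; exact: borel_leb3_translation.
move=> mf; rewrite [LHS]integralE [RHS]integralE; congr (_ - _)%E.
- rewrite -(H0 _ (measurable_funepos mf) (fun p => funepos_ge0 f p)).
  by apply: eq_integral => x _; rewrite !funeposE.
- rewrite -(H0 _ (measurable_funeneg mf) (fun p => funeneg_ge0 f p)).
  by apply: eq_integral => x _; rewrite !funenegE.
Qed.

Lemma integral3_fubini (f : space R -> \bar R) :
  (@borel_leb3 R).-integrable setT f ->
  \int[@borel_leb3 R]_p f p = \int[@borel_leb2 R]_z \int[@lebesgue_measure R]_t f (z, t).
Proof.
by move=> fi; rewrite -(@integral12_prod_meas1 _ _ (plane R)
  (measurableTypeR R) R (@borel_leb2 R) (@lebesgue_measure R) f fi).
Qed.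
End borel_lebesgue.

(** * Functions of class C^1 and cut-offs *)

Section calculus.
Context {R : realType} {V : normedModType R}.
Implicit Types (f g : V -> R).

Lemma C1_derivable f p v : class_C 1 f -> derivable f p v.
Proof. by move=> [df _]; exact: diff_derivable. Qed.

Lemma C1_continuous f : class_C 1 f -> continuous f.
Proof. by move=> [df _] p; exact: differentiable_continuous. Qed.

Lemma C1_cst (a : R) : class_C 1 (cst a : V -> R).
Proof.
split=> [p|v]; first exact: differentiable_cst.
rewrite (_ : 'D_v (cst a) = cst 0); first exact: cst_continuous.
by apply/funext => p; rewrite derive_cst.
Qed.

Lemma C1_add f g : class_C 1 f -> class_C 1 g -> class_C 1 (fun p => f p + g p).
Proof.
move=> Cf Cg; have [df cf] := Cf; have [dg cg] := Cg.
split=> [p|v]; first exact: differentiableD.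
rewrite (_ : 'D_v _ = fun p => 'D_v f p + 'D_v g p).
  by move=> p; apply: cvgD; [exact: cf|exact: cg].
by apply/funext => p; rewrite -deriveD //; exact: C1_derivable.
Qed.

Lemma C1_mul f g : class_C 1 f -> class_C 1 g -> class_C 1 (fun p => f p * g p).
Proof.
move=> Cf Cg; have [df cf] := Cf; have [dg cg] := Cg.
split=> [p|v]; first exact: differentiableM.
rewrite (_ : 'D_v _ = fun p => f p * 'D_v g p + g p * 'D_v f p).
  by move=> p; apply: cvgD; apply: cvgM; [exact: C1_continuous|exact: cg|
    exact: C1_continuous|exact: cf].
by apply/funext => p; rewrite [LHS]deriveM //; exact: C1_derivable.
Qed.

Lemma C1_opp f : class_C 1 f -> class_C 1 (fun p => - f p).
Proof.
move=> Cf; rewrite (_ : (fun p => - f p) = fun p => cst (-1) p * f p).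
  by apply: C1_mul => //; exact: C1_cst.
by apply/funext => p /=; rewrite mulN1r.
Qed.

Lemma C1_sub f g : class_C 1 f -> class_C 1 g -> class_C 1 (fun p => f p - g p).
Proof. by move=> Cf Cg; apply: C1_add => //; exact: C1_opp. Qed.

Lemma C1_sum (I : Type) (s : seq I) (F : I -> V -> R) :
  (forall i, class_C 1 (F i)) -> class_C 1 (fun p => \sum_(i <- s) F i p).
Proof.
move=> CF; elim: s => [|i s IH].
  rewrite (_ : (fun _ => _) = cst 0); first exact: C1_cst.
  by apply/funext => p; rewrite big_nil.
rewrite (_ : (fun _ => _) = fun p => F i p + \sum_(i <- s) F i p).
  exact: C1_add.
by apply/funext => p; rewrite big_cons.
Qed.

Lemma C1_comp (s ds : R -> R) f : (forall x : R, is_derive x (1 : R) s (ds x)) ->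
  continuous ds -> class_C 1 f -> class_C 1 (fun p => s (f p)).
Proof.
move=> Ds cds Cf; have [df cf] := Cf.
have dsd x : differentiable s x by apply/derivable1_diffP; case: (Ds x).
split=> [p|v]; first exact: (differentiable_comp (df p) (dsd (f p))).
rewrite (_ : 'D_v _ = fun p => 'D_v f p * ds (f p)).
  move=> p; apply: cvgM; first exact: cf.
  by apply: continuous_comp; [exact: C1_continuous|exact: cds].
apply/funext => p; rewrite (deriveE _ (differentiable_comp (df p) (dsd (f p)))).
rewrite diff_comp //= deriv1E; last by case: (Ds (f p)).
by rewrite -(deriveE _ (df p)) derive1E (@derive_val _ _ _ _ _ _ _ (Ds (f p))).
Qed.

Lemma C1_linear (f : {linear V -> R}) : continuous f -> class_C 1 f.
Proof.
move=> cf; have df p : differentiable f p by exact: linear_differentiable.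
split=> // v; rewrite (_ : 'D_v f = cst (f v)); first exact: cst_continuous.
by apply/funext => p; rewrite (deriveE _ (df p)) diff_lin.
Qed.
End calculus.

(** A global quadratic bound on the remainder lets the piecewise quadratic [step] be differentiated
    at its break points without separate one-sided limits. *)
Lemma derive_quadratic (R : realType) (s : R -> R) (x d C : R) :
  (forall h, `|s (x + h) - s x - d * h| <= C * h ^+ 2) -> is_derive x (1 : R) s d.
Proof.
move=> H.
have L : h^-1 *: (s (h *: (1:R) + x) - s x) @[h --> 0^'] --> d.
  apply/cvgrPdist_le => e e0; near=> h.
  have h0 : h != 0 by near: h; exact: nbhs_dnbhs_neq.
  have hC : `|h| <= e / (`|C| + 1).
    near: h; apply: (@dnbhs0_le _ R); by rewrite divr_gt0 // ltr_wpDl.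
  have -> : d - h^-1 *: (s (h *: (1:R) + x) - s x) = - (h^-1 * (s (x + h) - s x - d * h)).
    by rewrite /GRing.scale /= mulr1 (addrC h); field.
  rewrite normrN normrM normfV ler_pdivrMl ?normr_gt0 //.
  apply: (le_trans (H h)).
  rewrite -real_normK ?num_real // expr2 mulrA mulrC ler_wpM2l //.
  apply: (@le_trans _ _ ((`|C| + 1) * `|h|)).
    by rewrite ler_wpM2r // (le_trans (ler_norm C)) // lerDl.
  by rewrite mulrC -ler_pdivlMr // ltr_wpDl.
by apply: DeriveDef; [apply/cvg_ex; exists d|exact: cvg_lim].
Unshelve. all: by end_near. Qed.

Section smooth_step.
Context {R : realType}.
Implicit Types (x h : R).

Definition pos2 x : R := Num.max x 0 ^+ 2.

Lemma pos2_taylor x h : 0 <= pos2 (x + h) - pos2 x - 2 * Num.max x 0 * h <= h ^+ 2.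
Proof. by rewrite /pos2; case: (leP x 0) => ?; case: (leP (x + h) 0) => ?; apply/andP; split; nra. Qed.

(** The C^1 quadratic spline rising from 0 to 1 on [0, 1]: its second derivative is 4 on the first
    half and -4 on the second. C^1 is all that fields competing for the perimeter need. *)
Definition step x : R := 2 * pos2 x - 4 * pos2 (x - 1 / 2) + 2 * pos2 (x - 1).

Definition dstep x : R :=
  4 * Num.max x 0 - 8 * Num.max (x - 1 / 2) 0 + 4 * Num.max (x - 1) 0.

Lemma is_derive_step x : is_derive (x : R) (1 : R) step (dstep x).
Proof.
(* 8 = 2 + 4 + 2 is the sum of the absolute coefficients in [step]. *)
apply: (@derive_quadratic _ _ _ _ 8) => h; rewrite /step /dstep.
have /andP[a1 a2] := pos2_taylor x h.
have /andP[b1 b2] := pos2_taylor (x - 1 / 2) h.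
have /andP[c1 c2] := pos2_taylor (x - 1) h.
rewrite (addrAC x h) (addrAC x h (- (1))) ler_norml; apply/andP; split; nra.
Qed.

Lemma continuous_dstep : continuous dstep.
Proof.
have cm (f : R -> R) : continuous f -> continuous (fun x : R => Num.max (f x) 0).
  by move=> cf x; apply: (@continuous_max _ _ f (cst 0)); [exact: cf|exact: cst_continuous].
have cs (c : R) : continuous (fun x : R => x - c).
  by move=> x; apply: cvgB; [exact: cvg_id|exact: cvg_cst].
move=> x; rewrite /dstep; apply: cvgD; [apply: cvgB|]; apply: cvgM; try exact: cvg_cst.
- by apply: (cm id) => ?; exact: cvg_id.
- exact: (cm _ (cs _)).
- exact: (cm _ (cs _)).
Qed.

Lemma step_le0 x : x <= 0 -> step x = 0.
Proof.
move=> x0; rewrite /step /pos2 !max_r; lra.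
Qed.

Lemma step_ge1 x : 1 <= x -> step x = 1.
Proof.
move=> x0; rewrite /step /pos2 !max_l; lra.
Qed.

Lemma step_itv x : 0 <= step x <= 1.
Proof.
rewrite /step /pos2; case: (leP x 0) => ?; case: (leP (x - 1 / 2) 0) => ?;
  case: (leP (x - 1) 0) => ?; apply/andP; split; nra.
Qed.

Lemma step_homo x y : x <= y -> step x <= step y.
Proof.
move=> xy; rewrite /step /pos2.
case: (leP x 0) => ?; case: (leP (x - 1 / 2) 0) => ?;
  case: (leP (x - 1) 0) => ?; case: (leP y 0) => ?; case: (leP (y - 1 / 2) 0) => ?;
  case: (leP (y - 1) 0) => ?; nra.
Qed.

Lemma C1_step (V : normedModType R) (f : V -> R) :
  class_C 1 f -> class_C 1 (fun p => step (f p)).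
Proof. by apply: C1_comp; [exact: is_derive_step|exact: continuous_dstep]. Qed.
End smooth_step.

Section coordinates.
Context {R : realType}.
Lemma cont_fst {U W : topologicalType} : continuous (@fst U W).
Proof. by move=> [x y]; exact: cvg_fst. Qed.
Lemma cont_snd {U W : topologicalType} : continuous (@snd U W).
Proof. by move=> [x y]; exact: cvg_snd. Qed.

Lemma C1_x : class_C 1 (fun p : R * R * R => p.1.1).
Proof.
apply: (@C1_linear _ _ (fst \o fst : {linear (R * R * R)%type -> R^o})).
by move=> p; apply: continuous_comp; exact: cont_fst.
Qed.
Lemma C1_y : class_C 1 (fun p : R * R * R => p.1.2).
Proof.
apply: (@C1_linear _ _ (snd \o fst : {linear (R * R * R)%type -> R^o})).
by move=> p; apply: continuous_comp; [exact: cont_fst|exact: cont_snd].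
Qed.
Lemma C1_t : class_C 1 (fun p : R * R * R => p.2).
Proof.
apply: (@C1_linear _ _ (snd : {linear (R * R * R)%type -> R^o})).
exact: cont_snd.
Qed.
End coordinates.

HB.instance Definition _ (T1 T2 : ptopologicalType) := Topological.on (T1 * T2)%type.

(** * Cut-off functions around a compact set *)

Section cutoff.
Context {R : realType}.
Local Notation E3 := (R * R * R)%type.
Implicit Types (p q : E3) (O K : set E3) (chi : E3 -> R).

Definition hat (x : R) : R := step (2 + x) * step (2 - x).

Lemma hat_eq1 x : `|x| <= 1 -> hat x = 1.
Proof.
by rewrite ler_norml => /andP[? ?]; rewrite /hat !step_ge1 ?mulr1 //; lra.
Qed.

Lemma hat_eq0 x : 2 <= `|x| -> hat x = 0.
Proof.
rewrite lter_normr /hat => /orP[] ?.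
  by rewrite (step_le0 (_ : 2 - x <= 0)) ?mulr0 //; lra.
by rewrite (step_le0 (_ : 2 + x <= 0)) ?mul0r //; lra.
Qed.

Lemma hat_itv x : 0 <= hat x <= 1.
Proof.
rewrite /hat; have /andP[? ?] := step_itv (2 + x); have /andP[? ?] := step_itv (2 - x).
by rewrite mulr_ge0 //= mulr_ile1.
Qed.

Lemma C1_hat (V : normedModType R) (f : V -> R) (a r : R) :
  class_C 1 f -> class_C 1 (fun v => hat ((f v - a) / r)).
Proof.
move=> Cf; have C : class_C 1 (fun v => (f v - a) / r).
  by apply: (C1_mul (C1_sub Cf (C1_cst a)) (C1_cst r^-1)).
by apply: C1_mul; apply: C1_step; [apply: (C1_add (C1_cst 2) C)|
  apply: (C1_sub (C1_cst 2) C)].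
Qed.

Definition box p (r : R) : set E3 :=
  (`[p.1.1 - r, p.1.1 + r] `*` `[p.1.2 - r, p.1.2 + r]) `*` `[p.2 - r, p.2 + r].

Lemma boxP p r q : box p r q <->
  [/\ `|q.1.1 - p.1.1| <= r, `|q.1.2 - p.1.2| <= r & `|q.2 - p.2| <= r].
Proof.
rewrite /box /= !in_itv /= -!ler_distlC !(distrC _ (_ q.1)) (distrC _ q.2).
by split=> [[[]]|[]].
Qed.

Lemma compact_box p r : compact (box p r).
Proof. by do 2 (apply: compact_setX; last exact: segment_compact); exact: segment_compact. Qed.

Lemma ballP3 p r q : ball p r q <->
  [/\ `|q.1.1 - p.1.1| < r, `|q.1.2 - p.1.2| < r & `|q.2 - p.2| < r].
Proof.
rewrite (distrC q.1.1) (distrC q.1.2) (distrC q.2).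
by split=> [[[]]|[]].
Qed.

Lemma ball_box p r : ball p r `<=` box p r.
Proof. by move=> q /ballP3[? ? ?]; apply/boxP; split; exact: ltW. Qed.

Lemma box_ball p r s : r < s -> box p r `<=` ball p s.
Proof. by move=> rs q /boxP[? ? ?]; apply/ballP3; split; exact: le_lt_trans rs. Qed.

Definition bump p r q : R :=
  hat ((q.1.1 - p.1.1) / r) * hat ((q.1.2 - p.1.2) / r) * hat ((q.2 - p.2) / r).

Lemma C1_bump p r : class_C 1 (bump p r).
Proof.
apply: C1_mul; first apply: C1_mul.
- exact: (C1_hat _ _ C1_x).
- exact: (C1_hat _ _ C1_y).
- exact: (C1_hat _ _ C1_t).
Qed.

Lemma bump_itv p r q : 0 <= bump p r q <= 1.
Proof.
have H (a b : R) : 0 <= a <= 1 -> 0 <= b <= 1 -> 0 <= a * b <= 1.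
  by move=> /andP[? ?] /andP[? ?]; apply/andP; split; nra.
by apply: (H); [apply: (H)|]; exact: hat_itv.
Qed.

Lemma bump_eq1 p r q : 0 < r -> box p r q -> bump p r q = 1.
Proof.
move=> r0 /boxP[? ? ?]; rewrite /bump !hat_eq1 ?mulr1 //;
  by rewrite normrM normfV (gtr0_norm r0) ler_pdivrMr // mul1r.
Qed.

Lemma bump_neq0 p r q : 0 < r -> bump p r q != 0 -> box p (2 * r) q.
Proof.
move=> r0 /eqP b0.
have H x y : 2 * r < `|x - y| -> hat ((x - y) / r) = 0.
  by move=> h; apply: hat_eq0; rewrite normrM normfV (gtr0_norm r0) ler_pdivlMr // ltW.
apply/boxP; split; rewrite leNgt; apply/negP => /H h; apply: b0;
  by rewrite /bump h ?mulr0 ?mul0r.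
Qed.

Lemma tsupport_sub chi K : closed K -> (forall q, chi q != 0 -> K q) -> tsupport chi `<=` K.
Proof. by move=> cK H; rewrite /tsupport (closure_id K).1 //; exact: closure_subset. Qed.

Lemma compact_tsupport chi K : compact K -> (forall q, chi q != 0 -> K q) -> compact (tsupport chi).
Proof.
move=> cK H; apply: (subclosed_compact _ cK); first exact: closed_closure.
by apply: tsupport_sub => //; apply: compact_closed => //; exact: norm_hausdorff.
Qed.

Lemma notin_tsupport (V : normedModType R) (f : V -> R) x : ~ tsupport f x -> f x = 0.
Proof. by move=> H; apply: contrapT => /eqP fx; apply: H; apply: subset_closure. Qed.

Lemma near_notin_tsupport (V : normedModType R) (f : V -> R) x :
  ~ tsupport f x -> \forall y \near x, f y = 0.
Proof.
move=> H; have : open (~` tsupport f) by exact/closed_openC/closed_closure.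
rewrite openE => /(_ _ H); apply: filterS => y; exact: notin_tsupport.
Qed.

Definition cutoff_in O chi :=
  [/\ class_C 1 chi, forall q, 0 <= chi q <= 1, compact (tsupport chi)
    & tsupport chi `<=` O].

(** The combination is 1 - (1 - chi)(1 - chi'): it stays in [0, 1] and equals 1 wherever one of the
    two does. *)
Lemma cutoff_join O chi chi' : cutoff_in O chi -> cutoff_in O chi' ->
  cutoff_in O (fun q => chi q + chi' q - chi q * chi' q).
Proof.
move=> [C1 i1 c1 s1] [C2 i2 c2 s2].
have H q : chi q + chi' q - chi q * chi' q != 0 -> (tsupport chi `|` tsupport chi') q.
  have [/eqP ->|n _] := boolP (chi q == 0); last by left; exact: subset_closure.
  by rewrite add0r mul0r subr0; right; exact: subset_closure.
have cU : compact (tsupport chi `|` tsupport chi') by exact: compactU.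
split.
- by apply: C1_sub; [exact: C1_add|exact: C1_mul].
- by move=> q; have /andP[? ?] := i1 q; have /andP[? ?] := i2 q; apply/andP; split; nra.
- exact: (compact_tsupport cU).
- apply: (subset_trans (tsupport_sub _ H)); last by move=> q [/s1|/s2].
  by apply: compact_closed => //; exact: norm_hausdorff.
Qed.

(** Finitely many bumps cover [K] and are joined one by one. The value 1 is reached near every point
    of [K], not only on it, so that 1 - chi has zero derivatives on [K]; fields cut off by 1 - chi
    then do not feel a change of the set inside [K]. *)
Lemma smooth_urysohn O K : open O -> compact K -> K `<=` O ->
  exists2 chi, cutoff_in O chi & forall p, K p -> \forall q \near p, chi q = 1.
Proof.
move=> oO cK KO.
have /choice[r Hr] : forall p, exists r : R, 0 < r /\ (K p -> box p (2 * r) `<=` O).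
  move=> p; have [Kp|nKp] := pselect (K p); last by exists 1; split.
  have /nbhs_ballP[e /= e0 eO] : nbhs p O by exact: (open_nbhs_nbhs (conj oO (KO _ Kp))).
  (* A bump of radius r is supported in the box of radius 2 r, here 2 e / 3 < e. *)
  exists (e / 3); split; first by rewrite divr_gt0.
  by move=> _; apply: (subset_trans (box_ball _) eO); lra.
have : cover_compact K by rewrite -(@compact_cover (R * R * R)%type).
move=> /(_ _ K (fun p => ball p (r p))) [||D DK KD].
- by move=> p _; exact: ball_open.
- by move=> p Kp; exists p => //; apply: ballxx; case: (Hr p).
suff [chi Cchi H] : exists2 chi, cutoff_in O chi &
    forall p, p \in (finmap.enum_fset D) -> forall q, ball p (r p) q -> chi q = 1.
  exists chi => // q /KD[p pD pq].
  have : open (ball p (r p)) by exact: ball_open.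
  by rewrite openE => /(_ _ pq); apply: filterS => q'; exact: H.
have : forall p, p \in (finmap.enum_fset D) -> K p by move=> p /DK; rewrite inE.
elim: (finmap.enum_fset D) => [|p s IH] sK.
  exists (cst 0) => //; split; first exact: C1_cst.
  - by move=> q; rewrite lexx ler01.
  - by apply: (@compact_tsupport _ set0); [exact: compact0|move=> q /=; rewrite eqxx].
  - apply: (@subset_trans _ set0) => //.
    by apply: tsupport_sub; [exact: closed0|move=> q /=; rewrite eqxx].
have [r0 rO] := Hr p; have Kp : K p by apply: sK; rewrite inE eqxx.
have [|chi Cchi H] := IH; first by move=> q qs; apply: sK; rewrite inE qs orbT.
have Cb : cutoff_in O (bump p (r p)).
  split; [exact: C1_bump|exact: bump_itv| |].
  - exact: (compact_tsupport (@compact_box p (2 * r p)) (fun q => @bump_neq0 p (r p) q r0)).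
  - apply: (@subset_trans _ (box p (2 * r p))); last exact: rO.
    apply: tsupport_sub; last by move=> q; exact: bump_neq0.
    by apply: compact_closed; [exact: norm_hausdorff|exact: compact_box].
exists (fun q => bump p (r p) q + chi q - bump p (r p) q * chi q); first exact: cutoff_join.
move=> p'; rewrite inE => /orP[/eqP ->|p's] q pq.
  by rewrite (bump_eq1 r0 (ball_box pq)); ring.
by rewrite (H _ p's _ pq); ring.
Qed.
End cutoff.

(** * Convex functions of two variables *)

Section convex_basics.
Context {R : realType} {V : normedModType R}.
Implicit Types (D : set V) (f : V -> R).

Lemma convex_set_seg D x y s : convex_set D -> D x -> D y -> 0 <= s <= 1 ->
  D (x + s *: (y - x)).
Proof.
move=> cD Dx Dy /andP[s0 s1].
have := cD y x (Itv01 s0 s1); rewrite !inE => /(_ Dy Dx).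
rewrite /conv /= /unstable.onem; congr (D _).
by rewrite scalerBl scalerBr scale1r addrC addrAC addrA.
Qed.

Lemma convex_function_seg D f x y s : convex_function D f -> D x -> D y -> 0 <= s <= 1 ->
  f (x + s *: (y - x)) <= f x + s * (f y - f x).
Proof.
move=> cf Dx Dy /andP[s0 s1].
have := cf (Itv01 s0 s1) y x; rewrite !inE => /(_ Dy Dx).
rewrite convRE /= /unstable.onem => h.
have -> : x + s *: (y - x) = s *: y + (1 - s) *: x.
  by rewrite scalerBl scalerBr scale1r [LHS]addrC addrAC addrA.
by apply: (le_trans h); lra.
Qed.
End convex_basics.

Section convex_plane.
Context {R : realType}.
Local Notation E2 := (R * R)%type.
Variables (D : set E2) (f : E2 -> R).
Hypothesis cf : convex_function D f.

Lemma ballP2 (p q : E2) (r : R) : ball p r q <-> `|q.1 - p.1| < r /\ `|q.2 - p.2| < r.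
Proof. by rewrite (distrC q.1) (distrC q.2). Qed.

Lemma near_ball2 (z : E2) (r : R) : 0 < r -> \forall w \near z, ball z r w.
Proof. by move=> r0; apply/nbhs_ballP; exists r. Qed.

Lemma convex_interval_bound (x y : E2) s : D x -> D y -> 0 <= s <= 1 ->
  f (x + s *: (y - x)) <= Num.max (f x) (f y).
Proof.
move=> Dx Dy s01; apply: (le_trans (convex_function_seg cf Dx Dy s01)).
by case/andP: s01 => ? ?; rewrite le_max; have [?|?] := leP (f x) (f y);
  apply/orP; [right|left]; nra.
Qed.

(** On a square the function is bounded above by its corner values, by convexity along vertical and
    horizontal segments. Reflection in the centre turns this into a lower bound, since 2 f(z) <= f(z
    + a) + f(z - a). *)
Lemma convex_locally_bounded z : interior D z ->
  exists r M : R, [/\ 0 < r, ball z r `<=` D & forall w, ball z r w -> `|f w| <= M].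
Proof.
move=> /nbhs_ballP[e /= e0 eD].
pose r := e / 2; have r0 : 0 < r by rewrite divr_gt0.
have inD (a b : R) : `|a| <= r -> `|b| <= r -> D (z.1 + a, z.2 + b).
  move=> ha hb; apply/eD/ballP2; rewrite /= !(addrC z.1) !(addrC z.2) !addrK.
  by rewrite /r in ha hb; split; lra.
have nr : `|r| <= r by rewrite ger0_norm // ltW.
have nNr : `|- r| <= r by rewrite normrN.
pose F (a b : R) := f (z.1 + a, z.2 + b).
pose M0 := `|F r r| + `|F r (- r)| + `|F (- r) r| + `|F (- r) (- r)|.
have edge (a b : R) : `|a| <= r -> `|b| <= r -> 
    F a b <= Num.max (F a (- r)) (F a r) /\ F a b <= Num.max (F (- r) b) (F r b).
  move=> ha hb; have hs (c : R) : `|c| <= r -> 0 <= (c + r) / (r + r) <= 1.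
    rewrite ler_norml => /andP[? ?].
    by rewrite divr_ge0 ?ler_pdivrMr ?mul1r; [lra|lra|lra|lra].
  have e2 (c : R) : (c + r) / (r + r) * (r - - r) = c + r.
    by field; rewrite ?mulf_neq0 //; apply/eqP; lra.
  split.
  - have := convex_interval_bound (inD _ _ ha nNr) (inD _ _ ha nr) (hs _ hb).
    congr (_ <= _); congr (f _); congr (_, _) => /=.
      by rewrite subrr /GRing.scale /= mulr0 addr0.
    by rewrite /GRing.scale /= opprD addrACA subrr add0r e2; ring.
  - have := convex_interval_bound (inD _ _ nNr hb) (inD _ _ nr hb) (hs _ ha).
    congr (_ <= _); congr (f _); congr (_, _) => /=.
      by rewrite /GRing.scale /= opprD addrACA subrr add0r e2; ring.
    by rewrite subrr /GRing.scale /= mulr0 addr0.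
have Fub (a b : R) : `|a| <= r -> `|b| <= r -> F a b <= M0.
  move=> ha hb; have [+ _] := edge a b ha hb.
  have [_ +] := edge a r ha nr; have [_ +] := edge a (- r) ha nNr.
  have := ler_norm (F r r); have := ler_norm (F r (- r)).
  have := ler_norm (F (- r) r); have := ler_norm (F (- r) (- r)).
  have := normr_ge0 (F r r); have := normr_ge0 (F r (- r)).
  have := normr_ge0 (F (- r) r); have := normr_ge0 (F (- r) (- r)).
  by rewrite /M0 !le_max => ? ? ? ? ? ? ? ? /orP[?|?] /orP[?|?] /orP[?|?]; lra.
have Dr w : ball z r w -> exists a b : R, [/\ w = (z.1 + a, z.2 + b), `|a| <= r & `|b| <= r].
  move=> /ballP2[h1 h2]; exists (w.1 - z.1), (w.2 - z.2); split; try exact: ltW.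
  by rewrite !subrKC -surjective_pairing.
exists r, (M0 + 2 * `|f z|); split=> // w /Dr[a [b [-> ha hb]]]; first exact: inD.
rewrite -/(F a b).
have h1 := Fub _ _ ha hb.
have h2 : F (- a) (- b) <= M0 by apply: Fub; rewrite normrN.
have h3 : 2 * f z <= F a b + F (- a) (- b).
  have ha' : `|- a| <= r by rewrite normrN.
  have hb' : `|- b| <= r by rewrite normrN.
  have hh : 0 <= (1 / 2 : R) <= 1 by apply/andP; split; lra.
  have := convex_function_seg cf (inD _ _ ha hb) (inD _ _ ha' hb') hh.
  have -> : (z.1 + a, z.2 + b) + (1 / 2) *: ((z.1 - a, z.2 - b) - (z.1 + a, z.2 + b)) = z.
    rewrite [RHS]surjective_pairing; congr (_, _); rewrite /= /GRing.scale /=; by field.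
  by rewrite /F => h; lra.
have := ler_norm (f z); have := ler_norm (- f z); rewrite normrN => ? ?.
by rewrite ler_norml; apply/andP; split; lra.
Qed.

(** Prolong the segment from [w] to [w'] by a length [r] beyond [w'], up to [u]. By convexity the
    slope from [w] to [w'] is at most that from [w] to [u], which is at most the oscillation 2 M
    divided by r. *)
Lemma convex_locally_lipschitz z : interior D z ->
  exists r L : R, [/\ 0 < r, 0 <= L, ball z r `<=` D &
    forall w w', ball z r w -> ball z r w' -> `|f w' - f w| <= L * `|w' - w|].
Proof.
move=> /convex_locally_bounded[e [M [e0 eD eM]]].
pose r := e / 2; have r0 : 0 < r by rewrite divr_gt0.
have M0 : 0 <= M by apply: le_trans (eM z (ballxx _ e0)).
exists r, (2 * M / r); split=> //.
- by rewrite divr_ge0 ?mulr_ge0 // ltW.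
- by apply: (subset_trans _ eD); apply: le_ball; rewrite /r; lra.
suff H w w' : ball z r w -> ball z r w' -> f w' - f w <= 2 * M / r * `|w' - w|.
  move=> w w' hw hw'; rewrite ler_norml H // andbT lerNl opprB distrC; exact: H.
move=> hw hw'; have [->|ww'] := eqVneq w' w; first by rewrite !subrr normr0 mulr0.
pose d := `|w' - w|; have d0 : 0 < d by rewrite normr_gt0 subr_eq0.
pose u := w' + (r / d) *: (w' - w).
have hu : ball z e u.
  rewrite -ball_normE /= /u opprD addrA; apply: (le_lt_trans (ler_normB _ _)).
  rewrite normrZ (gtr0_norm (divr_gt0 r0 d0)) -/d divfK ?gt_eqF //.
  by move: hw'; rewrite -ball_normE /= /r => ?; lra.
have be v : ball z r v -> ball z e v by apply: le_ball; rewrite /r; lra.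
have s01 : 0 <= d / (d + r) <= 1.
  by rewrite divr_ge0 ?ler_pdivrMr ?mul1r; lra.
have := convex_function_seg cf (eD _ (be _ hw)) (eD _ hu) s01.
have -> : w + (d / (d + r)) *: (u - w) = w'.
  have -> : u - w = (1 + r / d) *: (w' - w) by rewrite /u addrAC scalerDl scale1r.
  rewrite scalerA.
  have -> : d / (d + r) * (1 + r / d) = 1.
    by field; rewrite ?gt_eqF ?addr_gt0.
  by rewrite scale1r subrKC.
move=> h; have := eM _ (be _ hw); have := eM _ hu; rewrite !ler_norml.
move=> /andP[? ?] /andP[? ?]; apply: (le_trans (_ : _ <= d / (d + r) * (f u - f w))); first lra.
apply: (@le_trans _ _ (d / (d + r) * (2 * M))).
  by apply: ler_wpM2l; [case/andP: s01|lra].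
rewrite -/d mulrC -[leRHS]mulrA ler_wpM2l //; first lra.
rewrite mulrC ler_wpM2r ?(ltW d0) //.
by rewrite lef_pV2 ?posrE ?addr_gt0 // lerDr ltW.
Qed.

Lemma convex_continuous z : interior D z -> {for z, continuous f}.
Proof.
move=> /convex_locally_lipschitz[r [L [r0 L0 _ H]]].
apply/cvgrPdist_le => e e0; near=> w.
have hw : ball z r w by near: w; exact: near_ball2.
rewrite distrC; apply: (le_trans (H _ _ (ballxx _ r0) hw)).
have : ball z (e / (L + 1)) w by near: w; apply: near_ball2; rewrite divr_gt0 // ltr_wpDl.
rewrite -ball_normE /= distrC ltr_pdivlMr; last by rewrite ltr_wpDl.
move=> ?; have := normr_ge0 (w - z); nra.
Unshelve. all: by end_near. Qed.

Lemma convex_compact_lipschitz K : compact K -> K `<=` interior D ->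
  exists d L : R, [/\ 0 < d, 0 <= L & forall z w, K z -> `|w - z| < d ->
    interior D w /\ `|f w - f z| <= L * `|w - z|].
Proof.
move=> /compact_near_coveringP cK KD.
(* The single integer [n] controls both the radius 1/(n+1) and the Lipschitz constant n, so one
   compactness argument makes both uniform on [K]. *)
have [] := cK nat \oo (fun n z => forall w, `|w - z| < n.+1%:R^-1 ->
    interior D w /\ `|f w - f z| <= n%:R * `|w - z|).
  move=> z Kz; have [r [L [r0 L0 rD rL]]] := convex_locally_lipschitz (KD _ Kz).
  have r20 : 0 < r / 2 by rewrite divr_gt0.
  near=> x n => w /= wx.
  have hx : ball z (r / 2) x by near: x; exact: near_ball2.
  have hn : n.+1%:R^-1 < r / 2 :> R by near: n; exact: near_infty_natSinv_lt (PosNum r20).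
  have hw : ball z r w.
    move: hx; rewrite -!ball_normE /= => hx.
    have -> : z - w = (z - x) - (w - x) by rewrite opprB addrA subrK.
    by apply: (le_lt_trans (ler_normB _ _)); rewrite (splitr r) ltrD // (lt_trans wx).
  split.
    have : open (ball z r) by exact: ball_open.
    by rewrite openE => /(_ _ hw); apply: filterS.
  have hx' : ball z r x by apply: le_ball hx; lra.
  apply: (le_trans (rL _ _ hx' hw)); apply: ler_wpM2r => //.
  near: n; exact: nbhs_infty_ger.
move=> n _ H; have {}H := H n (leqnn n).
exists n.+1%:R^-1, n%:R; split=> //.
  by move=> z w Kz; exact: H.
Unshelve. all: by end_near. Qed.
End convex_plane.

Section directional_derivative.
Context {R : realType} {V : normedModType R}.
Implicit Types (f : V -> R) (z e : V).

Lemma derivable_approx f z e : derivable f z e -> forall eps : R, 0 < eps ->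
  exists2 d : R, 0 < d &
    forall h, `|h| < d -> `|f (z + h *: e) - f z - h * 'D_e f z| <= eps * `|h|.
Proof.
move=> df eps eps0.
have /cvgrPdist_le /(_ _ eps0) : h^-1 *: ((f \o shift z) (h *: e) - f z) @[h --> 0^'] --> 'D_e f z.
  by have := df; rewrite /derivable => /cvgP.
move=> /nbhs_ballP[d /= d0 H]; exists d => // h hd.
have [->|h0] := eqVneq h 0.
  by rewrite scale0r addr0 subrr sub0r mul0r oppr0 normr0 mulr0.
have := H h; rewrite /ball /= sub0r normrN => /(_ hd h0).
rewrite /shift /= (addrC _ z) => hh.
have -> : f (z + h *: e) - f z - h * 'D_e f z =
    - h * ('D_e f z - h^-1 * (f (z + h *: e) - f z)) by field.
by rewrite normrM normrN mulrC ler_wpM2r.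
Qed.

Lemma approx_derivable f z e (D : R) : (forall eps : R, 0 < eps ->
  exists2 d : R, 0 < d &
    forall h, 0 < `|h| < d -> `|f (z + h *: e) - f z - h * D| <= eps * `|h|) ->
  is_derive z e f D.
Proof.
move=> H.
have L : h^-1 *: ((f \o shift z) (h *: e) - f z) @[h --> 0^'] --> D.
  apply/cvgrPdist_le => eps eps0; have [d d0 {}H] := H _ eps0.
  near=> h.
  have h0 : h != 0 by near: h; exact: nbhs_dnbhs_neq.
  have hd : `|h| < d by near: h; exact: (@dnbhs0_lt _ R).
  rewrite /shift /= (addrC _ z) /GRing.scale /=.
  have -> : D - h^-1 * (f (z + h *: e) - f z) = - (h^-1 * (f (z + h *: e) - f z - h * D)).
    by field.
  rewrite normrN normrM normfV ler_pdivrMl ?normr_gt0 // [leRHS]mulrC.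
  by apply: H; rewrite normr_gt0 h0.
by apply: DeriveDef; [apply/cvg_ex; exists D|exact: cvg_lim].
Unshelve. all: by end_near. Qed.

Lemma derive_seq_cvg f z e (u : nat -> R) : derivable f z e ->
  u @ \oo --> (0 : R) -> (forall n, u n != 0) ->
  (u n)^-1 * (f (z + u n *: e) - f z) @[n --> \oo] --> 'D_e f z.
Proof.
move=> df u0 un0; apply/cvgrPdist_le => eps eps0.
have [d d0 H] := derivable_approx df eps0.
near=> n.
have hd : `|u n| < d by near: n; exact: (cvgr0_norm_lt _ u0).
have -> : 'D_e f z - (u n)^-1 * (f (z + u n *: e) - f z) =
    - ((u n)^-1 * (f (z + u n *: e) - f z - u n * 'D_e f z)) by field.
by rewrite normrN normrM normfV ler_pdivrMl ?normr_gt0 // [leRHS]mulrC H.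
Unshelve. all: by end_near. Qed.

(** A divergent difference quotient has the default limit [point]. So ['D_e f] is constant where f
    is not derivable, which settles its measurability there. *)
Lemma derive_not_derivable f z e : ~ derivable f z e -> 'D_e f z = point.
Proof. by move=> nd; rewrite /derive dvgP. Qed.

End directional_derivative.

(** * Kinks of a convex function along a line *)

Section convex_partial.
Context {R : realType}.
Local Notation E2 := (R * R)%type.
Variables (D : set E2) (f : E2 -> R).
Hypothesis cD : convex_set D.
Hypothesis cf : convex_function D f.
Variable e : E2.

Let addKl (z w : E2) : z + w - z = w.
Proof. by rewrite addrC addKr. Qed.

Let addBB (z w : E2) : z + w - (z - w) = w + w.
Proof. by rewrite opprB addrC addrA subrK. Qed.

(** A negative [h] gives the left slope (f(z) - f(z - |h| e)) / |h|, so left and right slopes are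
    values of one function. *)
Definition slope (z : E2) (h : R) : R := h^-1 * (f (z + h *: e) - f z).

Lemma slope_mono z h h' : 0 < h <= h' -> D z -> D (z + h' *: e) ->
  slope z h <= slope z h'.
Proof.
move=> /andP[h0 hh'] Dz Dz'; have h'0 : 0 < h' by exact: lt_le_trans hh'.
have s01 : 0 <= h / h' <= 1 by rewrite divr_ge0 ?ler_pdivrMr ?mul1r // ltW.
have := convex_function_seg cf Dz Dz' s01.
rewrite addKl scalerA divfK ?gt_eqF // => H.
rewrite /slope ler_pdivrMl // mulrA -mulrA; lra.
Qed.

Lemma slopeN_mono z h h' : 0 < h <= h' -> D z -> D (z - h' *: e) ->
  slope z (- h') <= slope z (- h).
Proof.
move=> /andP[h0 hh'] Dz Dz'; have h'0 : 0 < h' by exact: lt_le_trans hh'.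
have s01 : 0 <= h / h' <= 1 by rewrite divr_ge0 ?ler_pdivrMr ?mul1r // ltW.
have := convex_function_seg cf Dz Dz' s01.
rewrite addKl scalerN scalerA divfK ?gt_eqF // => H.
rewrite /slope !invrN !mulNr lerN2 !scaleNr ler_pdivrMl // mulrA -mulrA; lra.
Qed.

Lemma slope_sym z h : 0 < h -> D (z - h *: e) -> D (z + h *: e) ->
  slope z (- h) <= slope z h.
Proof.
move=> h0 D1 D2; have s01 : 0 <= (1 / 2 : R) <= 1 by apply/andP; split; lra.
have := convex_function_seg cf D1 D2 s01.
have -> : z - h *: e + (1 / 2) *: (z + h *: e - (z - h *: e)) = z.
  rewrite addBB -scalerDl scalerA (_ : 1 / 2 * (h + h) = h) ?subrK //.
  by field.
move=> H; rewrite /slope invrN mulNr scaleNr -subr_ge0 opprK -mulrDr.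
by rewrite mulr_ge0 ?invr_ge0 ?(ltW h0) //; lra.
Qed.

(** Shrinking both steps to their minimum brings the two slopes closer together, and at equal steps
    the comparison is midpoint convexity. *)
Lemma slope_cross z h h' : D z -> 0 < h -> 0 < h' -> D (z - h *: e) -> D (z + h' *: e) ->
  slope z (- h) <= slope z h'.
Proof.
move=> Dz h0 h'0 D1 D2; pose m := Num.min h h'.
have m0 : 0 < m by rewrite lt_min h0.
have seg k k' s : 0 < k <= k' -> D (z + (s * k') *: e) -> D (z + (s * k) *: e).
  move=> /andP[k0 kk'] Dk; have k'0 : 0 < k' by exact: lt_le_trans kk'.
  have s01 : 0 <= k / k' <= 1 by rewrite divr_ge0 ?ler_pdivrMr ?mul1r // ltW.
  have := convex_set_seg cD Dz Dk s01.
  rewrite addKl scalerA; congr (D (z + _ *: e)); field.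
  by rewrite gt_eqF.
have mh : 0 < m <= h by rewrite m0 ge_min lexx.
have mh' : 0 < m <= h' by rewrite m0 ge_min lexx orbT.
apply: (le_trans (slopeN_mono mh Dz D1)); apply: (le_trans _ (slope_mono mh' Dz D2)).
apply: slope_sym => //.
- by have := seg _ _ (-1) mh; rewrite !mulN1r !scaleNr; apply.
- by have := seg _ _ 1 mh'; rewrite !mul1r; apply.
Qed.

(* By convexity, [f] is derivable at [z] along [e] iff some symmetric pair of
   slopes has arbitrarily small gap; this condition is open in [z]. *)
Definition small_gap (z : E2) (eps h : R) :=
  [/\ D^° (z + h *: e), D^° (z - h *: e) & slope z h - slope z (- h) < eps].

(** The derivative is the supremum [d] of the left slopes: left slopes lie below [d], right slopes
    above it. A gap below eps at step h confines all slopes of shorter step to within eps of [d], by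
    monotonicity. *)
Lemma small_gap_derivable z : D^° z ->
  (forall eps, 0 < eps -> exists2 h, 0 < h & small_gap z eps h) -> derivable f z e.
Proof.
move=> Dz H; have Dz' := interior_subset Dz.
have [h0 h00 [/interior_subset i1 /interior_subset i2 _]] := H 1 ltr01.
pose S := [set slope z (- h) | h in [set h | 0 < h /\ D (z - h *: e)]].
have S0 : S !=set0 by exists (slope z (- h0)); exists h0.
have Sub h : 0 < h -> D (z + h *: e) -> ubound S (slope z h).
  by move=> hp Dh _ [k [k0 Dk] <-]; exact: slope_cross.
have hS : has_sup S by split=> //; exists (slope z h0); exact: Sub.
pose d := sup S.
have dle h : 0 < h -> D (z + h *: e) -> d <= slope z h.
  by move=> hp Dh; apply: ge_sup => //; exact: Sub.
have dge h : 0 < h -> D (z - h *: e) -> slope z (- h) <= d.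
  by move=> hp Dh; apply: ub_le_sup; [case: hS|exists h].
suff : is_derive z e f d by case.
apply: approx_derivable => eps eps0.
have [h hp [/interior_subset k1 /interior_subset k2 gap]] := H _ eps0.
exists h => // k /andP[k0 kh].
have := dle _ hp k1; have := dge _ hp k2 => g1 g2.
have seg s : -1 <= s <= 1 -> D (z + (s * h) *: e).
  move=> /andP[s1 s2]; have s01 : 0 <= (s + 1) / 2 <= 1 by apply/andP; split; lra.
  have := convex_set_seg cD k2 k1 s01; congr (D _).
  rewrite addBB -scalerDl scalerA -addrA -scaleNr -scalerDl.
  by congr (_ + _ *: _); field.
have Dk : D (z + k *: e).
  rewrite (_ : k = k / h * h); last by rewrite divfK // gt_eqF.
  by apply: seg; rewrite ler_pdivlMr // ler_pdivrMr // mul1r mulN1r -ler_norml ltW.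
have kk : k != 0 by rewrite -normr_gt0.
have -> : f (z + k *: e) - f z - k * d = k * (slope z k - d) by rewrite /slope; field.
rewrite normrM mulrC ler_wpM2r //.
have [kpos|kneg] := ltP 0 k.
  have kh' : 0 < k <= h by rewrite kpos /= (le_trans (ler_norm _)) // ltW.
  have := slope_mono kh' Dz' k1; have := dle _ kpos Dk => ? ?.
  by rewrite ger0_norm; lra.
have {kneg}kneg : 0 < - k by rewrite oppr_gt0 lt_neqAle kk.
have kh' : 0 < - k <= h by rewrite kneg /= (le_trans (ler_norm _)) // normrN ltW.
have := slopeN_mono kh' Dz' k2; have := dge _ kneg; rewrite scaleNr opprK => /(_ Dk).
rewrite opprK => ? ?.
by rewrite ler0_norm; lra.
Qed.

Lemma derivable_small_gap z : D^° z -> derivable f z e ->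
  forall eps, 0 < eps -> \forall n \near \oo, small_gap z eps n.+1%:R^-1.
Proof.
move=> Dz df eps eps0.
(* Two slopes within eps / 4 of the derivative differ by at most eps / 2 < eps. *)
have e40 : 0 < eps / 4 by rewrite divr_gt0.
have [d d0 H] := derivable_approx df e40.
have oD : open (D^°) by exact: open_interior.
have near1 (s : R) : \forall n \near \oo, D^° (z + (s * n.+1%:R^-1) *: e).
  have : z + (s * n.+1%:R^-1) *: e @[n --> \oo] --> z.
    rewrite -[X in _ --> X]addr0 -(scale0r e) -(mulr0 s).
    apply: cvgD; first exact: cvg_cst.
    apply: cvgZr_tmp; apply: cvgM; first exact: cvg_cst.
    exact: cvg_harmonic.
  by apply; apply: open_nbhs_nbhs.
have n1 := near1 1; have n2 := near1 (-1).
near=> n; split.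
- by rewrite -[_^-1]mul1r; near: n.
- by rewrite -scaleNr -mulN1r; near: n.
have hd : n.+1%:R^-1 < d by near: n; exact: (near_infty_natSinv_lt (PosNum d0)).
pose h : R := n.+1%:R^-1.
have hp : 0 < h by rewrite invr_gt0.
have := H h; have := H (- h); rewrite normrN gtr0_norm // => /(_ hd) a1 /(_ hd) a2.
have [b1 b2] : f (z + h *: e) - f z <= h * 'D_e f z + eps / 4 * h /\
    f z - f (z + (- h) *: e) >= h * 'D_e f z - eps / 4 * h.
  by move: a1 a2; rewrite !ler_norml => /andP[? ?] /andP[? ?]; split; lra.
rewrite -/h /slope invrN mulNr opprK -mulrDr ltr_pdivrMl //; nra.
Unshelve. all: by end_near. Qed.

(** At a kink the gap between left and right slopes never closes, so a rational fits strictly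
    between all left and all right slopes. *)
Lemma nonderivable_rat z : D^° z -> ~ derivable f z e -> exists q : rat,
  forall h, 0 < h -> (D (z + h *: e) -> ratr q < slope z h) /\
                     (D (z - h *: e) -> slope z (- h) < ratr q).
Proof.
move=> Dz nd; have Dz' := interior_subset Dz.
have [eps [eps0 Heps]] : exists eps, 0 < eps /\ forall h, 0 < h -> ~ small_gap z eps h.
  apply: contrapT => N; apply: nd; apply: small_gap_derivable => // eps eps0.
  apply: contrapT => N'; apply: N; exists eps; split=> // h h0 g.
  by apply: N'; exists h.
have [r r0 rD] : exists2 r, 0 < r & forall h, `|h| <= r -> D^° (z + h *: e).
  have : z + h *: e @[h --> (0 : R)] --> z.
    rewrite -[X in _ --> X]addr0 -(scale0r e).
    apply: cvgD; first exact: cvg_cst.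
    by apply: cvgZr_tmp; exact: cvg_id.
  move=> /(_ D^°) []; first by apply: open_nbhs_nbhs; split => //; exact: open_interior.
  move=> r /= r0 H; exists (r / 2); first by rewrite divr_gt0.
  move=> h hr; apply: H; rewrite /= sub0r normrN; lra.
have Dr h : 0 < h -> h <= r -> D^° (z + h *: e) /\ D^° (z - h *: e).
  move=> h0 hr; split; first by apply: rD; rewrite gtr0_norm.
  by rewrite -scaleNr; apply: rD; rewrite normrN gtr0_norm.
have gap h : 0 < h -> h <= r -> slope z (- h) + eps <= slope z h.
  move=> h0 hr; rewrite leNgt; apply/negP => hlt; apply: (Heps _ h0).
  by have [? ?] := Dr _ h0 hr; split=> //; lra.
pose S := [set slope z (- h) | h in [set h | 0 < h /\ D (z - h *: e)]].
have [i1 i2] := Dr _ r0 (lexx r).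
have S0 : S !=set0 by exists (slope z (- r)); exists r => //; split=> //; exact: interior_subset.
have Sub h : 0 < h -> D (z + h *: e) -> ubound S (slope z h - eps).
  move=> hp Dh _ [k [k0 Dk] <-]; pose m := Num.min (Num.min h k) r.
  have m0 : 0 < m by rewrite !lt_min hp k0.
  have mh : 0 < m <= h by rewrite m0 !ge_min lexx.
  have mk : 0 < m <= k by rewrite m0 !ge_min lexx !orbT.
  have mr : m <= r by rewrite ge_min lexx orbT.
  have := gap _ m0 mr; have := slope_mono mh Dz' Dh; have := slopeN_mono mk Dz' Dk.
  by lra.
pose d := sup S.
have hS : has_ubound S by exists (slope z r - eps); apply: Sub => //; exact: interior_subset.
have dlt : d < d + eps by lra.
have [q] := rat_in_itvoo dlt; rewrite in_itv /= => /andP[q1 q2].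
exists q => h h0; split=> Dh.
  have : d <= slope z h - eps by apply: ge_sup => //; exact: Sub.
  by move=> ?; lra.
have : slope z (- h) <= d by apply: ub_le_sup => //; exists h.
by move=> ?; lra.
Qed.

(** For s < s' the slope of the chord between the two points is a right slope at the first and a
    left slope at the second. The rational chosen at the first kink is therefore strictly smaller,
    and the choice is injective. *)
Lemma countable_nonderivable (z0 : E2) :
  countable [set s : R | D^° (z0 + s *: e) /\ ~ derivable f (z0 + s *: e) e].
Proof.
set N := [set _ | _].
have /choice[q Hq] : forall s : R, exists q : rat, N s ->
    forall h, 0 < h -> (D (z0 + s *: e + h *: e) -> ratr q < slope (z0 + s *: e) h) /\
      (D (z0 + s *: e - h *: e) -> slope (z0 + s *: e) (- h) < ratr q).
  move=> s; have [[Ds nd]|nN] := pselect (N s); last by exists 0.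
  by have [q Hq] := nonderivable_rat Ds nd; exists q.
have lt s s' : N s -> N s' -> s < s' -> ratr (q s) < ratr (q s') :> R.
  move=> Ns Ns' ss'; have h0 : 0 < s' - s by rewrite subr_gt0.
  have E1 : z0 + s *: e + (s' - s) *: e = z0 + s' *: e by rewrite -addrA -scalerDl subrKC.
  have E2 : z0 + s' *: e - (s' - s) *: e = z0 + s *: e by rewrite -E1 addrK.
  have [+ _] := Hq s Ns _ h0; have [_ +] := Hq s' Ns' _ h0; rewrite E1 E2.
  move=> /(_ (interior_subset Ns.1)) h1 /(_ (interior_subset Ns'.1)) h2.
  apply: (lt_trans h2); apply: le_lt_trans h1.
  by rewrite /slope E1 scaleNr E2 invrN mulNr -mulrN opprB.
apply/countable_injP; exists (fun s => pickle (q s)) => s s'; rewrite !inE => Ns Ns' pq.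
have qq : q s = q s' := pcan_inj (@pickleK rat) pq.
have [ss'|ss'|//] := ltgtP s s'.
  by have := lt _ _ Ns Ns' ss'; rewrite qq ltxx.
by have := lt _ _ Ns' Ns ss'; rewrite qq ltxx.
Qed.
End convex_partial.

Section convex_partial_measurable.
Context {R : realType}.
Local Notation E2 := (R * R)%type.
Variables (D : set E2) (f : E2 -> R).
Hypothesis cD : convex_set D.
Hypothesis cf : convex_function D f.

Lemma continuous_translation (V : normedModType R) (a : V) : continuous (fun z : V => z + a).
Proof. by move=> z; apply: cvgD; [exact: cvg_id|exact: cvg_cst]. Qed.

Lemma open_translation (V : normedModType R) (O : set V) (a : V) : open O -> open [set z | O (z + a)].
Proof. by move=> oO; exact: (open_comp (fun z _ => @continuous_translation V a z) oO). Qed.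

Lemma open_small_gap (e : E2) (eps h : R) :
  open [set z | D^° z /\ small_gap D f e z eps h].
Proof.
have oD : open (D^°) by exact: open_interior.
rewrite openE => z [Dz [D1 D2 g]].
have cz : {for z, continuous (fun w => slope f e w h - slope f e w (- h))}.
  have c0 := convex_continuous cf Dz.
  have ct a : D^° (z + a) -> {for z, continuous (fun w : E2 => f (w + a))}.
    move=> Da; apply: (@continuous_comp _ _ _ (fun w : E2 => w + a) f).
      exact: continuous_translation.
    exact: (convex_continuous cf).
  apply: cvgB; apply: cvgM; try exact: cvg_cst; apply: cvgB => //.
    exact: ct.
  by rewrite scaleNr; exact: ct.
rewrite /interior; near=> w; split; [|split].
- by near: w; exact: open_nbhs_nbhs.
- by near: w; apply: (open_nbhs_nbhs (conj (open_translation (h *: e) oD) _)).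
- by near: w; apply: (open_nbhs_nbhs (conj (open_translation (- (h *: e)) oD) _)).
- near: w; apply: (cvgr_lt _ cz _ g).
Unshelve. all: by end_near. Qed.

Lemma derivable_setE (e : E2) : [set z | D^° z /\ derivable f z e] =
  \bigcap_k \bigcup_n [set z | D^° z /\ small_gap D f e z k.+1%:R^-1 n.+1%:R^-1].
Proof.
apply/seteqP; split=> [z [Dz dz] k _|z H].
  have k0 : 0 < k.+1%:R^-1 :> R by rewrite invr_gt0.
  by have [n _ /(_ n (leqnn n))] := derivable_small_gap Dz dz k0; exists n.
have Dz : D^° z by have [n _ []] := H 0%N I.
split=> //; apply: (small_gap_derivable cD cf) => // eps eps0.
have [k _ /(_ k (leqnn k)) /= keps] := near_infty_natSinv_lt (PosNum eps0).
have [n _ [_ [? ? g]]] := H k I; exists n.+1%:R^-1; first by rewrite invr_gt0.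
by split=> //; exact: lt_trans keps.
Qed.

Lemma measurable_derivable (e : E2) :
  measurable ([set z | D^° z /\ derivable f z e] : set (plane R)).
Proof.
rewrite derivable_setE; apply: bigcapT_measurable => k.
apply: bigcupT_measurable => n; apply: open_measurable2; exact: open_small_gap.
Qed.

(** On the set of derivability the derivative is a limit of difference quotients; on the rest it is
    the constant default value. *)
Lemma measurable_fun_derive (e : E2) :
  measurable_fun (D^° : set (plane R)) ('D_e f : plane R -> R).
Proof.
have oD : open (D^°) by exact: open_interior.
have mD : measurable (D^° : set (plane R)) by exact: open_measurable2.
have mE := measurable_derivable e.
rewrite -(@setDUK _ [set z | D^° z /\ derivable f z e] (D^°)); last by move=> z [].
apply/measurable_funU => //; first exact: measurableD.
split.
  (* Extension by zero makes the translates measurable on the whole plane. At a fixed interior point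
     the quotients of [fr] are eventually those of [f]. *)
  pose fr : plane R -> R := f \_ (D^°).
  have mfr : measurable_fun setT fr.
    apply/(measurable_restrictT _ mD); apply: continuous_measurable_fun2 => // z Dz.
    exact: (convex_continuous cf).
  have fr_in z : D^° z -> fr z = f z by move=> Dz; rewrite /fr patchE mem_set.
  apply: (@measurable_fun_cvg _ (plane R) R _
    (fun n z => n.+1%:R * (fr (z + n.+1%:R^-1 *: e) - fr z))).
    move=> n; apply: measurable_funTS; apply: measurable_funM => //.
    apply: measurable_funB => //.
    apply: (measurableT_comp mfr).
    have mt (b : R) : measurable_fun setT ((fun x : R => x + b)%R : measurableTypeR R -> measurableTypeR R).
      apply: continuous_measurable_fun; exact: (@continuous_translation R^o).
    exact: (measurable_fun_map_pair (mt (n.+1%:R^-1 *: e).1) (mt (n.+1%:R^-1 *: e).2)).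
  move=> z [Dz dz]; have := derive_seq_cvg dz (@cvg_harmonic R).
  move=> /(_ (fun n => invr_neq0 (lt0r_neq0 (ltr0Sn R n)))).
  apply: cvg_trans; apply: near_eq_cvg; near=> n.
  have [Dn _ _] : small_gap D f e z 1 n.+1%:R^-1.
    by near: n; exact: (derivable_small_gap Dz dz ltr01).
  by rewrite /harmonic /= invrK (fr_in _ Dz) (fr_in _ Dn).
apply: (@eq_measurable_fun _ _ (plane R) _ _ (cst point)); last exact: measurable_cst.
move=> z; rewrite inE => -[Dz nd]; apply/esym.
by apply: derive_not_derivable => dz; apply: nd.
Unshelve. all: by end_near. Qed.

(** Kinks in direction (1, 0) are countable on horizontal lines, while [borel_leb2] integrates the
    measures of vertical sections. The measure is first rewritten as the product taken in the other
    order. *)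
Lemma borel_leb2_nonderivable1 :
  @borel_leb2 R (D^° `\` [set z | D^° z /\ derivable f z (1, 0)]) = 0%E.
Proof.
set N := _ `\` _.
have mN : measurable (N : set (plane R)).
  apply: measurableD; last exact: measurable_derivable.
  by apply: open_measurable2; exact: open_interior.
have := @product_measure_unique _ _ (measurableTypeR R) (measurableTypeR R) R
  (@lebesgue_measure R) (@lebesgue_measure R)
  (@lebesgue_measure R \x^ @lebesgue_measure R)%E _ N mN.
rewrite /borel_leb2 => ->; last first.
  by move=> A B mA mB; exact: (@product_measure2E _ _ (measurableTypeR R) (measurableTypeR R)).
rewrite /product_measure2; apply: integral0_eq => y _ /=.
apply: countable_lebesgue_measure0.
apply: (sub_countable _ (countable_nonderivable cD cf (1, 0) (0, y))).
apply: subset_card_le => x; rewrite /ysection /= inE.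
have -> : (0, y) + x *: (1, 0) = (x, y) :> E2.
  by congr (_, _); rewrite /= /GRing.scale /= ?mulr0 ?addr0 ?mulr1 ?add0r.
by move=> [Dz nd]; split=> // dz; apply: nd.
Qed.

Lemma borel_leb2_nonderivable2 :
  @borel_leb2 R (D^° `\` [set z | D^° z /\ derivable f z (0, 1)]) = 0%E.
Proof.
rewrite /borel_leb2 /product_measure1; apply: integral0_eq => x _ /=.
apply: countable_lebesgue_measure0.
apply: (sub_countable _ (countable_nonderivable cD cf (0, 1) (x, 0))).
apply: subset_card_le => y; rewrite /xsection /= inE.
have -> : (x, 0) + y *: (0, 1) = (x, y) :> E2.
  by congr (_, _); rewrite /= /GRing.scale /= ?mulr0 ?addr0 ?mulr1 ?add0r.
by move=> [Dz nd]; split=> // dz; apply: nd.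
Qed.

(** Only the two partial derivatives are available, not the differential. Moving by -2 s h1 and -2 s
    h2 along the axes gives two points with midpoint z - s (h1, h2), so convexity bounds f there to
    first order. With f(z + s (z' - z)) <= f(z) + s (f(z') - f(z)) and midpoint convexity at z,
    dividing by s gives the inequality up to a small error. *)
Lemma convex_subgradient z z' : D^° z -> D z' ->
  derivable f z (1, 0) -> derivable f z (0, 1) ->
  f z + dot (gradient f z) (z' - z) <= f z'.
Proof.
move=> Dz Dz' d1 d2; rewrite /dot /gradient /=.
set p1 := 'D_(1, 0) f z; set p2 := 'D_(0, 1) f z.
set h1 := (z' - z).1; set h2 := (z' - z).2.
rewrite -/(z'.1 - z.1) -/(z'.2 - z.2).
have zE : z' = z + (h1, h2).
  rewrite [LHS]surjective_pairing; congr (_, _); rewrite /= subrKC //.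
apply/ler_addgt0Pr => eps0 eps00.
pose eps := eps0 / (`|h1| + `|h2| + 1).
have hh : 0 < `|h1| + `|h2| + 1 by rewrite ltr_wpDl // addr_ge0.
have epsp : 0 < eps by rewrite divr_gt0.
have [a1 a10 H1] := derivable_approx d1 epsp; have [a2 a20 H2] := derivable_approx d2 epsp.
have u0 (c : R) : - (2 * n.+1%:R^-1 * c) @[n --> \oo] --> (0 : R).
  under eq_fun do rewrite mulrAC -mulNr.
  rewrite -(mulr0 (- (2 * c))).
  by apply: cvgM; [exact: cvg_cst|exact: cvg_harmonic].
have nD (c : R) (e : E2) : \forall n \near \oo, D^° (z + (- (2 * n.+1%:R^-1 * c)) *: e).
  have : z + (- (2 * n.+1%:R^-1 * c)) *: e @[n --> \oo] --> z.
    rewrite -[X in _ --> X]addr0 -(scale0r e).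
    by apply: cvgD; [exact: cvg_cst|apply: cvgZr_tmp; exact: u0].
  by apply; apply: open_nbhs_nbhs; split => //; exact: open_interior.
have nsm (c a : R) : 0 < a -> \forall n \near \oo, `|- (2 * n.+1%:R^-1 * c)| < a.
  by move=> a0; have /cvgr0_norm_lt := u0 c; apply.
have [n [Ds1 Ds2 s1 s2]] : exists n : nat, [/\ D^° (z + (- (2 * n.+1%:R^-1 * h1)) *: (1, 0)),
   D^° (z + (- (2 * n.+1%:R^-1 * h2)) *: (0, 1)),
   `|- (2 * n.+1%:R^-1 * h1)| < a1 & `|- (2 * n.+1%:R^-1 * h2)| < a2].
  have n1 := nD h1 (1, 0); have n2 := nD h2 (0, 1).
  have n3 := nsm h1 _ a10; have n4 := nsm h2 _ a20.
  near \oo => n; exists n; split; by near: n.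
pose s : R := n.+1%:R^-1; rewrite -/s in Ds1 Ds2 s1 s2.
have sp : 0 < s by rewrite invr_gt0.
have s1' : s <= 1 by rewrite invf_le1 // ler1n.
have {s1}b1 := H1 _ s1; have {s2}b2 := H2 _ s2.
have half : 0 <= (1 / 2 : R) <= 1 by rewrite divr_ge0 // ler_pdivrMr // mul1r ler1n.
have ss : 0 <= s <= 1 by rewrite ltW.
have c1 := convex_function_seg cf (interior_subset Ds1) (interior_subset Ds2) half.
have Dm := convex_set_seg cD (interior_subset Ds1) (interior_subset Ds2) half.
move: c1 Dm.
have -> : z + (- (2 * s * h1)) *: (1, 0) + (1 / 2) *: (z + (- (2 * s * h2)) *: (0, 1) -
    (z + (- (2 * s * h1)) *: (1, 0))) = z - s *: (h1, h2) :> E2.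
  by rewrite [RHS]surjective_pairing; congr (_, _); rewrite /= /GRing.scale /=; field.
move=> c1 Dm.
have c2 := convex_function_seg cf (interior_subset Dz) Dz' ss.
have Ds : D (z + s *: (z' - z)) by apply: (convex_set_seg cD) => //; exact: interior_subset.
have c3 := convex_function_seg cf Dm Ds half.
move: c3; have -> : z - s *: (h1, h2) + (1 / 2) *: (z + s *: (z' - z) - (z - s *: (h1, h2))) = z.
  rewrite [RHS]surjective_pairing; congr (_, _); rewrite /= /GRing.scale /=.
    by rewrite -/h1; field.
  by rewrite -/h2; field.
move=> c3.
move: b1 b2; rewrite !normrN !normrM (gtr0_norm sp) (ger0_norm (ltW (ltr0Sn R 1))).
rewrite !ler_norml => /andP[_ u1] /andP[_ u2].
have e1 : eps * (`|h1| + `|h2|) <= eps0.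
  rewrite /eps mulrAC ler_pdivrMr // ler_pM2l // lerDl //.
have E : s * (h1 * p1 + h2 * p2 - eps * (`|h1| + `|h2|)) <= s * (f z' - f z).
  rewrite -/p1 -/p2 in u1 u2; nra.
move: E; rewrite ler_pM2l //; lra.
Unshelve. all: by end_near. Qed.
End convex_partial_measurable.

(** * The contact set *)

Section contact_set.
Context {R : realType}.
Local Notation E2 := (R * R)%type.
Variables (D : set E2) (f g : E2 -> R).
Hypothesis cD : convex_set D.
Hypothesis cf : convex_function D f.
Hypothesis cg : convex_function D (fun z => - g z).
Hypothesis fg : forall z, D z -> f z <= g z.
Let C := region D f g.
Let plane_at (z z' : E2) : R := f z + 2 * im_mul_conj z z'.

Lemma im_mul_conjxx (z : E2) : im_mul_conj z z = 0.
Proof. by rewrite /im_mul_conj mulrC subrr. Qed.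

Lemma interior_vertical (A : set (R * R * R)) z t : A^° (z, t) ->
  exists2 d : R, 0 < d & A (z, t - d) /\ A (z, t + d).
Proof.
move=> /nbhs_ballP[e /= e0 eA]; exists (e / 2); first by rewrite divr_gt0.
have e2 : `|e / 2| < e by rewrite gtr0_norm ?divr_gt0 //; lra.
split; apply: eA; apply/ballP3; split; rewrite /= ?subrr ?normr0 //.
  by rewrite (_ : t - e / 2 - t = - (e / 2)) ?normrN //; ring.
by rewrite (_ : t + e / 2 - t = e / 2) //; ring.
Qed.

Lemma not_interior_region z : D z -> ~ C^° (z, f z).
Proof.
by move=> Dz /interior_vertical[d d0 [[_ /andP[/= h _]] _]]; lra.
Qed.

Lemma boundary_region z : D z -> boundary C (z, f z).
Proof.
move=> Dz; split; last exact: not_interior_region.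
by apply: subset_closure; split=> //=; rewrite lexx fg.
Qed.

(** If the graph of f stayed above the horizontal plane, an interior point of [C] on that plane
    would have a point of [C] strictly beneath it, hence beneath f. So the plane would be
    supporting. *)
Lemma not_Sigma_below z : D^° z -> ~ Sigma C D f z ->
  exists2 z', D z' & f z' < plane_at z z'.
Proof.
move=> /interior_subset Dz nS; apply: contrapT => N; apply: nS.
split=> //; split; first exact: boundary_region.
  by rewrite /horizontal_plane /= im_mul_conjxx mulr0 addr0.
move=> [w t] [/= wt cl]; split=> // iC.
have [d d0 [[Dw /andP[/= fw _]] _]] := interior_vertical iC.
by apply: N; exists w => //; rewrite /plane_at -wt (le_lt_trans fw) // gtrBl.
Qed.

(** The convex function f - g is nonpositive; if it vanishes at an interior point, it vanishes on
    all of [D], as one sees by prolonging each segment from [w] to [z] slightly beyond [z]. Then [C]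
    has empty interior and every plane through (z, f z) is supporting. *)
Lemma not_Sigma_lt z : D^° z -> ~ Sigma C D f z -> f z < g z.
Proof.
move=> Dz nS; have Dz' := interior_subset Dz.
rewrite lt_neqAle fg // andbT; apply/eqP => fgz.
have fgD w : D w -> f w = g w.
  move=> Dw; have [s s0 Ds] : exists2 s : R, 0 < s & D (z + (- s) *: (w - z)).
    have : z + (- s) *: (w - z) @[s --> (0 : R)] --> z.
      rewrite -[X in _ --> X]addr0 -(scale0r (w - z)) -[X in X *: _]oppr0.
      apply: cvgD; first exact: cvg_cst.
      by apply: cvgZr_tmp; apply: cvgN; exact: cvg_id.
    move=> /(_ D) [] // e /= e0 H; exists (e / 2); first by rewrite divr_gt0.
    by apply: H; rewrite /= sub0r normrN gtr0_norm ?divr_gt0 //; lra.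
  have s1 : 0 < 1 + s by rewrite addr_gt0.
  have s01 : 0 <= s / (1 + s) <= 1 by rewrite divr_ge0 ?ler_pdivrMr ?mul1r ?lerDr // ltW.
  have zE : z + (- s) *: (w - z) + (s / (1 + s)) *: (w - (z + (- s) *: (w - z))) = z.
    by rewrite [RHS]surjective_pairing; congr (_, _); rewrite /= /GRing.scale /=; field;
      rewrite gt_eqF.
  have := convex_function_seg cf Ds Dw s01; have := convex_function_seg cg Ds Dw s01.
  rewrite zE fgz; set u := z + _; have := fg Ds; rewrite -/u => fu h1 h2.
  have fw := fg Dw; apply/eqP; rewrite eq_le fw /=.
  have h3 : 0 <= (1 - s / (1 + s)) * (f u - g u) + s / (1 + s) * (f w - g w) by lra.
  have h4 : (1 - s / (1 + s)) * (f u - g u) <= 0.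
    by case/andP: s01 => ? ?; rewrite mulr_ge0_le0 ?subr_le0 ?subr_ge0.
  have h5 : 0 <= s / (1 + s) * (f w - g w) by lra.
  by move: h5; rewrite pmulr_rge0 ?divr_gt0 // subr_ge0.
have nint p : ~ C^° p.
  case: p => w t iC; have [d d0 [[Dw /andP[/= a1 a2]] [_ /andP[/= b1 b2]]]] := interior_vertical iC.
  by have := fgD _ Dw; lra.
apply: nS; split=> //; split; first exact: boundary_region.
  by rewrite /horizontal_plane /= im_mul_conjxx mulr0 addr0.
by move=> q [_ cl]; split=> //; exact: nint.
Qed.

Lemma interior_region z t : D^° z -> f z < t < g z -> C^° (z, t).
Proof.
move=> Dz /andP[ft tg]; have oD : open (D^°) by exact: open_interior.
have cfz := convex_continuous cf Dz; have cgz := convex_continuous cg Dz.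
pose m1 := (f z + t) / 2; pose m2 := (t + g z) / 2.
have n1 : \forall w \near z, f w < m1 by apply: (cvgr_lt _ cfz); rewrite /m1; lra.
have n2 : \forall w \near z, - g w < - m2 by apply: (cvgr_lt _ cgz); rewrite /m2; lra.
have n3 : \forall w \near z, D w by exact: Dz.
have n4 : \forall s \near t, m1 < s < m2.
  near=> s; apply/andP; split; near: s.
    by apply: lt_nbhsr; rewrite /m1; lra.
  by apply: lt_nbhsl; rewrite /m2; lra.
exists ([set w | [/\ f w < m1, - g w < - m2 & D w]], [set s | m1 < s < m2]).
  split=> //=; near=> w; split; by near: w.
move=> [w s] [[/= a1 a2 a3] /andP[b1 b2]]; split=> //=.
by rewrite ltrN2 in a2; apply/andP; split; apply: ltW; [exact: lt_trans b1|exact: lt_trans a2].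
Unshelve. all: by end_near. Qed.

(** Go a short way from [w] towards [z']: the plane is affine, so convexity keeps f strictly below
    it, and continuity keeps g above it. The plane thus enters the interior of [C]. *)
Lemma below_not_Sigma w z' : D^° w -> f w < g w -> D z' -> f z' < plane_at w z' ->
  ~ Sigma C D f w.
Proof.
move=> Dw fgw Dz' fz' [_ [_ _ sub]].
pose zs (s : R) := w + s *: (z' - w).
have zs0 : zs s @[s --> (0 : R)] --> w.
  rewrite -[X in _ --> X]addr0 -(scale0r (z' - w)).
  by apply: cvgD; [exact: cvg_cst|apply: cvgZr_tmp; exact: cvg_id].
have cgz := convex_continuous cg Dw.
have n1 : \forall s \near (0 : R), D^° (zs s).
  by apply: zs0; apply: open_nbhs_nbhs; split=> //; exact: open_interior.
have plE s : plane_at w (zs s) = f w + s * (plane_at w z' - f w).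
  by rewrite /plane_at /zs /im_mul_conj /= /GRing.scale /=; ring.
have n2 : \forall s \near (0 : R), 0 < g (zs s) - plane_at w (zs s).
  have : g (zs s) - plane_at w (zs s) @[s --> (0 : R)] --> g w - f w.
    apply: cvgB.
      have := cvgN (cvg_comp _ _ zs0 cgz); rewrite opprK.
      by rewrite opprK; apply; exact: nbhs_filter.
    under eq_fun do rewrite plE.
    have H : f w + s * (plane_at w z' - f w) @[s --> (0 : R)] -->
        f w + 0 * (plane_at w z' - f w).
      by apply: cvgD; [exact: cvg_cst|apply: cvgM; [exact: cvg_id|exact: cvg_cst]].
    by rewrite mul0r addr0 in H.
  by move=> /cvgr_gt; apply; rewrite subr_gt0.
have : \forall s \near (0 : R), D^° (zs s) /\ 0 < g (zs s) - plane_at w (zs s).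
  by near=> s; split; near: s.
move=> /nbhs_ballP[e /= e0 He].
pose s := Num.min (e / 2) 1; have s0 : 0 < s by rewrite lt_min divr_gt0 // ltr01.
have s1 : s <= 1 by rewrite ge_min lexx orbT.
have [Ds gs] : D^° (zs s) /\ 0 < g (zs s) - plane_at w (zs s).
  apply: He; rewrite /ball /= sub0r normrN gtr0_norm // /s gt_min; apply/orP; left; lra.
have fs : f (zs s) < plane_at w (zs s).
  have s01 : 0 <= s <= 1 by rewrite ltW.
  apply: (le_lt_trans (convex_function_seg cf (interior_subset Dw) Dz' s01)).
  by rewrite plE ltrD2l ltr_pM2l // ltrD2r.
have iC : C^° (zs s, plane_at w (zs s)) by apply: interior_region => //; rewrite fs -subr_gt0.
have [_] := sub (zs s, plane_at w (zs s)) (conj erefl (subset_closure (interior_subset iC))).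
by apply.
Unshelve. all: by end_near. Qed.

(** Both f < g and the presence of a graph point beneath the plane persist nearby, with the same
    witness [z']. *)
Lemma open_not_Sigma : open (D^° `\` Sigma C D f).
Proof.
rewrite openE => z [Dz nS]; have fgz := not_Sigma_lt Dz nS.
have [z' Dz' fz'] := not_Sigma_below Dz nS.
have cfz := convex_continuous cf Dz; have cgz := convex_continuous cg Dz.
have n1 : \forall w \near z, D^° w.
  by apply: open_nbhs_nbhs; split=> //; exact: open_interior.
have n2 : \forall w \near z, 0 < g w - f w.
  have : - (- g w) - f w @[w --> z] --> - (- g z) - f z by apply: cvgB => //; exact: cvgN.
  by move=> /cvgr_gt /(_ 0); rewrite opprK subr_gt0 => /(_ fgz); apply: filterS => w; rewrite opprK.
have n3 : \forall w \near z, 0 < plane_at w z' - f z'.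
  have : plane_at w z' - f z' @[w --> z] --> plane_at z z' - f z'.
    apply: cvgB; last exact: cvg_cst.
    apply: cvgD => //; apply: cvgM; first exact: cvg_cst.
    apply: cvgB; apply: cvgM; try exact: cvg_cst; [exact: cont_snd|exact: cont_fst].
  by move=> /cvgr_gt; apply; rewrite subr_gt0.
rewrite /interior; near=> w.
have Dw : D^° w by near: w.
split=> //; apply: (@below_not_Sigma _ z') => //; rewrite -subr_gt0; by near: w.
Unshelve. all: by end_near. Qed.

(** If v(z) = 0, the affine minorant given by the subgradient inequality is exactly the horizontal
    plane at z, contradicting a graph point strictly beneath it. *)
Lemma not_Sigma_gradient z : D^° z -> ~ Sigma C D f z ->
  derivable f z (1, 0) -> derivable f z (0, 1) -> gradient f z + 2 *: perp z != 0.
Proof.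
move=> Dz nS d1 d2; apply/eqP => v0.
have [z' Dz' fz'] := not_Sigma_below Dz nS.
have := convex_subgradient cD cf Dz Dz' d1 d2.
have -> : dot (gradient f z) (z' - z) = 2 * im_mul_conj z z'.
  have := congr1 fst v0; have := congr1 snd v0.
  rewrite /= /GRing.scale /= => /eqP; rewrite addr_eq0 => /eqP e2 /eqP; rewrite addr_eq0 => /eqP e1.
  rewrite /dot [X in X * _]e1 [X in _ + X * _]e2 /im_mul_conj /=; ring.
by rewrite leNgt fz'.
Qed.
End contact_set.

(** * The divergence formula under a Lipschitz graph *)

Section bounded_integrals.
Context d (T : measurableType d) (R : realType) (mu : {measure set T -> \bar R}).
Implicit Types (D : set T) (f g : T -> R).

Lemma le_bounded_integrable D f (M : R) : measurable D -> (mu D < +oo)%E ->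
  measurable_fun D f -> (forall x, D x -> `|f x| <= M) -> mu.-integrable D (EFin \o f).
Proof.
move=> mD fD mf fM; apply: measurable_bounded_integrable => //.
by exists M; split; [exact: num_real|move=> x Mx y Dy; exact: (le_trans (fM _ Dy) (ltW Mx))].
Qed.

Lemma le_Rintegral_norm D f (M : R) : measurable D -> (mu D < +oo)%E ->
  measurable_fun D f -> (forall x, D x -> `|f x| <= M) ->
  `|\int[mu]_(x in D) f x| <= M * fine (mu D).
Proof.
move=> mD fD mf fM; have fi := le_bounded_integrable mD fD mf fM.
apply: (le_trans (le_normr_Rintegral mD fi)).
rewrite -(Rintegral_cst _ mD); apply: le_Rintegral => //.
- exact: (integrable_norm fi).
- by apply: (le_bounded_integrable (M := `|M|) mD fD) => //; exact: measurable_cst.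
Qed.

Lemma bounded_cvg_Rintegral D (f_ : nat -> T -> R) f (M : R) :
  measurable D -> (mu D < +oo)%E -> (forall n, measurable_fun D (f_ n)) ->
  (forall n x, D x -> `|f_ n x| <= M) ->
  (forall x, D x -> f_ n x @[n --> \oo] --> f x) ->
  \int[mu]_(x in D) f_ n x @[n --> \oo] --> \int[mu]_(x in D) f x.
Proof.
move=> mD fD mf fM fcv; rewrite /Rintegral.
have mlim : measurable_fun D f := measurable_fun_cvg mf fcv.
have limM x : D x -> `|f x| <= M.
  move=> Dx; apply: (cvgr_to_le (cvg_norm (fcv x Dx))); near=> n; exact: fM.
have fi : mu.-integrable D (EFin \o f) := le_bounded_integrable mD fD mlim limM.
apply: fine_cvg; rewrite fineK; last exact: (integrable_fin_num mD fi).
apply: (@dominated_cvg _ _ _ mu D mD (fun n => EFin \o f_ n) (EFin \o f) (cst M%:E)).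
- by move=> n; apply/measurable_EFinP.
- by move=> x Dx; apply: cvg_EFin; [near=> n|exact: fcv].
- by move=> x Dx.
- apply: (le_bounded_integrable (f := cst M) (M := `|M|)) => //; exact: measurable_cst.
- by move=> n x Dx /=; rewrite lee_fin fM.
Unshelve. all: by end_near. Qed.

End bounded_integrals.

(** * Integrals over thin vertical slices *)

Section vertical_slice.
Context {R : realType}.
Local Notation mu := (@lebesgue_measure R).

Lemma lipschitz_measurable (chi : R -> R) (M : R) :
  (forall s t, `|chi s - chi t| <= M * `|s - t|) ->
  measurable_fun setT (chi : measurableTypeR R -> measurableTypeR R).
Proof.
move=> L; have M0 : 0 <= M by have := L 1 0; rewrite subr0 normr1 mulr1; apply: le_trans.
apply: continuous_measurable_fun => s; apply/cvgrPdist_le => e e0; near=> t.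
apply: (le_trans (L _ _)).
have : `|s - t| <= e / (M + 1).
  near: t; have /cvgrPdist_le := @cvg_id _ (nbhs s); apply.
  by rewrite divr_gt0 // ltr_wpDl.
rewrite ler_pdivlMr; last by rewrite ltr_wpDl.
move=> ?; have := normr_ge0 (s - t); nra.
Unshelve. all: by end_near. Qed.

Lemma lebesgue_measure_itvco_lty (a b : R) : (mu [set` `[a, b[] < +oo)%E.
Proof. by rewrite lebesgue_measure_itv /=; case: ifP => _; rewrite ?ltry. Qed.

Lemma lipschitz_integrable_slice (chi : R -> R) (M a b : R) :
  (forall s t, `|chi s - chi t| <= M * `|s - t|) ->
  mu.-integrable [set` `[a, b[] (EFin \o chi).
Proof.
move=> L; have M0 : 0 <= M by have := L 1 0; rewrite subr0 normr1 mulr1; apply: le_trans.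
apply: (le_bounded_integrable (M := M * (b - a) + `|chi a|)).
- exact: measurable_itv.
- exact: lebesgue_measure_itvco_lty.
- by apply: measurable_funTS; exact: (lipschitz_measurable L).
- move=> x; rewrite /= in_itv /= => /andP[ax xb].
  rewrite -[chi x](subrK (chi a)); apply: (le_trans (ler_normD _ _)).
  rewrite lerD2r; apply: (le_trans (L _ _)); rewrite ler_wpM2l //.
  by rewrite ler_norml; apply/andP; split; lra.
Qed.

Lemma Rintegral_slice_le (chi : R -> R) (M a b c : R) : a <= b ->
  (forall s t, `|chi s - chi t| <= M * `|s - t|) -> a <= c <= b ->
  `|\int[mu]_(t in `[a, b[) chi t - (b - a) * chi c| <= M * (b - a) ^+ 2.
Proof.
move=> ab L /andP[ac cb].
have mab : measurable ([set` `[a, b[] : set (measurableTypeR R)) by exact: measurable_itv.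
have muab : mu [set` `[a, b[] = (b - a)%:E.
  rewrite lebesgue_measure_itv /= lte_fin; case: ltP => //.
  by move=> ba; rewrite (_ : b = a) ?subrr //; apply/eqP; rewrite eq_le ab ba.
have fab := lebesgue_measure_itvco_lty a b.
have M0 : 0 <= M by have := L 1 0; rewrite subr0 normr1 mulr1; apply: le_trans.
have mchi : measurable_fun [set` `[a, b[] chi.
  by apply: measurable_funTS; exact: (lipschitz_measurable L).
have bnd x : [set` `[a, b[] x -> `|chi x - chi c| <= M * (b - a).
  rewrite /= in_itv /= => /andP[ax xb]; apply: (le_trans (L _ _)).
  by rewrite ler_wpM2l // ler_norml; apply/andP; split; lra.
have mB : measurable_fun [set` `[a, b[] (fun t => chi t - chi c).
  by apply: measurable_funB => //; exact: measurable_cst.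
have iB := le_bounded_integrable mab fab mB bnd.
have iC : mu.-integrable [set` `[a, b[] (EFin \o cst (chi c)).
  by apply: (le_bounded_integrable (M := `|chi c|) mab fab) => //; exact: measurable_cst.
have -> : \int[mu]_(t in `[a, b[) chi t =
    \int[mu]_(t in `[a, b[) (chi t - chi c) + (b - a) * chi c.
  rewrite -[X in _ + X]mulrC -[X in _ * X]/(fine (b - a)%:E) -muab -Rintegral_cst //.
  by rewrite -RintegralD //; apply: eq_Rintegral => t _; rewrite subrK.
rewrite addrK; apply: (le_trans (le_Rintegral_norm mab fab mB bnd)).
by rewrite [X in fine X](_ : _ = (b - a)%:E) /= -?mulrA -?expr2 //; exact: muab.
Qed.

(** The difference of the two half-line indicators is the oriented indicator of the interval between
    a and b, so either order is covered. The error is quadratic in b - a and survives division by a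
    translation step of the same order. *)
Lemma Rintegral_step_le (chi : R -> R) (M a b : R) :
  (forall s t, `|chi s - chi t| <= M * `|s - t|) ->
  `|\int[mu]_t (((a <= t)%R%:R - (b <= t)%R%:R) * chi t) - (b - a) * chi b|
    <= M * (b - a) ^+ 2.
Proof.
move=> L; have [ab|ba] := leP a b.
  rewrite (_ : \int[mu]_t _ = \int[mu]_(t in `[a, b[) chi t).
    by apply: Rintegral_slice_le => //; rewrite ab lexx.
  rewrite [RHS]Rintegral_mkcond; apply: eq_Rintegral => t _; rewrite patchE.
  case: ifPn; rewrite ?notin_setE ?inE /= in_itv /=.
    by move=> /andP[-> tb]; rewrite leNgt tb subr0 mul1r.
  case: (leP a t) => at_; case: (leP b t) => bt //; rewrite ?subrr ?mul0r //.
  by have := le_lt_trans (le_trans ab bt) at_; rewrite ltxx.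
rewrite (_ : \int[mu]_t _ = - \int[mu]_(t in `[b, a[) chi t).
  rewrite (_ : - _ - _ = - (\int[mu]_(t in `[b, a[) chi t - (a - b) * chi b)); last by ring.
  rewrite normrN -(sqrrN (b - a)) opprB.
  by apply: Rintegral_slice_le => //; rewrite ?lexx ltW.
rewrite [X in - X]Rintegral_mkcond -mulN1r -RintegralZl //.
  apply: eq_Rintegral => t _; rewrite patchE.
  case: ifPn; rewrite ?notin_setE ?inE /= in_itv /=.
    by move=> /andP[-> ta]; rewrite leNgt ta sub0r.
  case: (leP a t) => at_; case: (leP b t) => bt //; rewrite ?subrr ?mul0r ?mulr0 //.
  by have := le_lt_trans at_ (lt_trans bt ba); rewrite ltxx.
rewrite -restrict_EFin.
have mI : measurable ([set` `[b, a[] : set (measurableTypeR R)) by exact: measurable_itv.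
exact: ((@integrable_mkcond _ (measurableTypeR R) R mu _ (EFin \o chi) mI).1 (lipschitz_integrable_slice b a L)).
Qed.
End vertical_slice.

Section C1_support.
Context {R : realType} {V : normedModType R}.
Implicit Types (psi : V -> R) (e p : V).

Lemma derive_out_tsupport psi e p : ~ tsupport psi p -> 'D_e psi p = 0.
Proof.
move=> np; rewrite /derive; have pz := near_notin_tsupport np.
apply/cvg_lim => //; apply: (@cvg_trans _ (cst (0 : R) @ 0^')); last exact: cvg_cst.
apply: near_eq_cvg; near=> h.
rewrite /shift /= (notin_tsupport np) subr0.
suff -> : psi (h *: e + p) = 0 by rewrite scaler0.
near: h; apply: nbhs_dnbhs.
have : h *: e + p @[h --> (0 : R)] --> p.
  rewrite -[X in _ --> X]add0r -(scale0r e).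
  by apply: cvgD; [apply: cvgZr_tmp; exact: cvg_id|exact: cvg_cst].
by move=> /(_ _ pz).
Unshelve. all: by end_near. Qed.

Lemma compact_support_bounded (f : V -> R) (K : set V) : compact K -> continuous f ->
  (forall p, ~ K p -> f p = 0) -> exists M : R, forall p, `|f p| <= M.
Proof.
move=> cK cf fK; have : compact (f @` K).
  by apply: continuous_compact => //; exact: continuous_subspaceT.
move=> /compact_bounded[M [Mr HM]]; exists (`|M| + 1) => p.
have MM : M < `|M| + 1 by rewrite (le_lt_trans (ler_norm M)) // ltrDl.
have [Kp|nKp] := pselect (K p); last by rewrite fK // normr0 addr_ge0.
by apply: (HM _ MM); exists p.
Qed.

Lemma C1_derive_bounded psi e : class_C 1 psi -> compact (tsupport psi) ->
  exists M : R, forall p, `|'D_e psi p| <= M.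
Proof.
move=> [_ cd] cs; apply: (compact_support_bounded cs (cd e)) => p.
exact: derive_out_tsupport.
Qed.

Lemma C1_lipschitz psi e (M : R) : class_C 1 psi -> (forall p, `|'D_e psi p| <= M) ->
  forall p h, `|psi (p + h *: e) - psi p| <= M * `|h|.
Proof.
move=> Cpsi bM p h; pose g (s : R) := psi (p + s *: e).
have dg (s : R) : is_derive s (1 : R) g ('D_e psi (p + s *: e)).
  apply: approx_derivable => eps eps0.
  have [d d0 H] := derivable_approx (C1_derivable (p := p + s *: e) (v := e) Cpsi) eps0.
  exists d => // k /andP[_ kd]; rewrite /g.
  have -> : s + k *: (1 : R) = s + k by rewrite /GRing.scale /= mulr1.
  by rewrite scalerDl addrA; exact: H.
have cg : continuous g.
  by move=> s; apply/differentiable_continuous/derivable1_diffP; case: (dg s).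
have M0 : 0 <= M := le_trans (normr_ge0 _) (bM p).
have key a b : a < b -> `|g b - g a| <= M * `|b - a|.
  move=> ab; have [|c _ ->] := MVT ab (fun x _ => dg x); first exact: continuous_subspaceT.
  by rewrite normrM ler_wpM2r.
have -> : psi (p + h *: e) - psi p = g h - g 0 by rewrite /g scale0r addr0.
rewrite -[X in `|X|]subr0; have [h0|h0|->] := ltgtP h 0.
- by rewrite subr0 distrC (le_trans (key _ _ h0)) // sub0r normrN.
- by rewrite subr0 (le_trans (key _ _ h0)) // subr0.
- by rewrite subrr subr0 normr0 mulr0.
Qed.
End C1_support.

Section bounded_borel.
Context {R : realType}.
Local Notation mu2 := (@borel_leb2 R).
Local Notation mu3 := (@borel_leb3 R).
Local Notation mu := (@lebesgue_measure R).

(* Bounded Borel functions with bounded support. *)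
Definition bbs (f : space R -> R) := [/\ measurable_fun setT f,
  exists M : R, forall p, `|f p| <= M & exists r : R, forall p, f p != 0 -> box 0 r p].

Lemma measurable_box p r : measurable (box p r : set (space R)).
Proof. by do 2 (apply: measurableX; last exact: measurable_itv); exact: measurable_itv. Qed.

Lemma borel_leb3_box_lty (p : R * R * R) (r : R) : (mu3 (box p r) < +oo)%E.
Proof.
have lt (a b : R) : (mu [set` `[a, b]] < +oo)%E.
  by rewrite lebesgue_measure_itv /=; case: ifP => _; rewrite ?ltry.
rewrite /borel_leb3 /box.
rewrite (@product_measure1E _ _ (plane R) (measurableTypeR R) R mu2 mu);
  [|by apply: measurableX; exact: measurable_itv|exact: measurable_itv].
rewrite lte_mul_pinfty ?ge0_fin_numE //.
rewrite [ltLHS](@product_measure1E _ _ (measurableTypeR R) (measurableTypeR R) R mu mu);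
  [|exact: measurable_itv|exact: measurable_itv].
  by rewrite lte_mul_pinfty ?ge0_fin_numE //; exact: lt.
exact: lt.
Qed.

Lemma bbs_integrable (f : space R -> R) (A : set (space R)) : measurable A -> bbs f ->
  mu3.-integrable A (EFin \o f).
Proof.
move=> mA [mf [M bM] [r br]].
have mB := measurable_box 0 r.
apply: (@integrableS _ (space R) R mu3 setT) => //.
have -> : EFin \o f = (EFin \o f) \_ (box 0 r).
  apply/funext => p; rewrite patchE; case: ifPn => //.
  rewrite notin_setE => nb; rewrite /=; congr _%:E.
  by apply/eqP; apply: contrapT => /negP /br.
apply: ((@integrable_mkcond _ (space R) R mu3 _ (EFin \o f) mB).1).
apply: (le_bounded_integrable mB (borel_leb3_box_lty 0 r)) => //.
exact: measurable_funTS.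
Qed.

Lemma bounded_set_box (K : set (R * R * R)) : compact K -> exists2 r : R, 0 < r & K `<=` box 0 r.
Proof.
move=> /compact_bounded[M [Mr HM]]; exists (`|M| + 1); first by rewrite ltr_wpDl.
move=> p Kp; have MM : M < `|M| + 1 by rewrite (le_lt_trans (ler_norm M)) // ltrDl.
have /= := HM _ MM p Kp; rewrite prod_normE /= ge_max prod_normE /= ge_max => /andP[/andP[? ?] ?].
by apply/boxP; rewrite /= !subr0.
Qed.

Lemma bbs_continuous (f : R * R * R -> R) : continuous f -> compact (tsupport f) -> bbs f.
Proof.
move=> cf cK; split.
- by apply: continuous_measurable_fun3; [exact: openT|move=> z _; exact: cf].
- by apply: (compact_support_bounded cK cf) => p; exact: notin_tsupport.
- have [r _ Kr] := bounded_set_box cK; exists r => p fp; apply: Kr.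
  exact: subset_closure.
Qed.

Lemma bbs_mul (f k : space R -> R) (M : R) : measurable_fun setT k ->
  (forall p, `|k p| <= M) -> bbs f -> bbs (fun p => k p * f p).
Proof.
move=> mk bk [mf [N bN] [r br]]; split.
- exact: measurable_funM.
- by exists (M * N) => p; rewrite normrM ler_pM.
- by exists r => p; rewrite mulf_eq0 negb_or => /andP[_ /br].
Qed.

Lemma bbs_translation (f : space R -> R) (a : R * R * R) : bbs f -> bbs (fun p => f (p + a)).
Proof.
move=> [mf [M bM] [r br]]; split.
- apply: (measurableT_comp mf).
  have mt (b : R) : measurable_fun setT ((fun x : R => x + b)%R : measurableTypeR R -> measurableTypeR R).
    by apply: continuous_measurable_fun; exact: (@continuous_translation _ R^o).
  exact: (measurable_fun_map_pair (measurable_fun_map_pair (mt a.1.1) (mt a.1.2)) (mt a.2)).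
- by exists M => p.
- exists (r + `|a|) => p /br /boxP[]; rewrite /= !subr0 => h1 h2 h3.
  have : `|a| <= `|a| by []; rewrite {1}prod_normE /= ge_max prod_normE /= ge_max => /andP[/andP[a1 a2] a3].
  have H (x y : R) : `|x + y| <= r -> `|y| <= `|a| -> `|x| <= r + `|a|.
    move=> xy ya; rewrite -[x](addrK y); apply: (le_trans (ler_normB _ _)); exact: lerD.
  by apply/boxP; rewrite /= !subr0; split; [exact: H h1 a1|exact: H h2 a2|exact: H h3 a3].
Qed.

Lemma bbs_sub (f g : space R -> R) : bbs f -> bbs g -> bbs (fun p => f p - g p).
Proof.
move=> [mf [M bM] [r br]] [mg [N bN] [s bs]]; split.
- exact: measurable_funB.
- by exists (M + N) => p; apply: (le_trans (ler_normB _ _)); exact: lerD.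
- exists (Num.max r s) => p.
  have [/eqP ->|fp _] := boolP (f p == 0).
    rewrite sub0r oppr_eq0 => /bs /boxP[? ? ?].
    by apply/boxP; rewrite !le_max; split; apply/orP; right.
  by move: fp => /br /boxP[? ? ?]; apply/boxP; rewrite !le_max; split; apply/orP; left.
Qed.

Lemma Rintegral3_translation (f : space R -> R) (a : R * R * R) : measurable_fun setT f ->
  \int[mu3]_p f (p + a) = \int[mu3]_p f p.
Proof.
move=> mf; rewrite /Rintegral; congr fine.
by apply: (integral3_translation a (f := EFin \o f)); exact/measurable_EFinP.
Qed.

Lemma Rintegral3_fubini (f : space R -> R) : bbs f ->
  mu2.-integrable setT (fun z : plane R => (\int[mu]_t f (z, t))%:E) /\
  \int[mu3]_p f p = \int[mu2]_z \int[mu]_t f (z, t).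
Proof.
move=> bf; have fi := bbs_integrable measurableT bf.
have [mf [M bM] [r br]] := bf.
have sl (z : plane R) : mu.-integrable setT (fun t => (f (z, t))%:E).
  have mI : measurable ([set` `[- r, r]] : set (measurableTypeR R)) by exact: measurable_itv.
  have mfz : measurable_fun setT ((fun t => f (z, t)) : measurableTypeR R -> R).
    exact: (measurableT_comp mf (@pair1_measurable _ _ (plane R) (measurableTypeR R) z)).
  have -> : (fun t => (f (z, t))%:E) = (EFin \o (fun t => f (z, t))) \_ [set` `[- r, r]].
    apply/funext => t; rewrite patchE; case: ifPn => //.
    rewrite notin_setE /= => nb; congr _%:E; apply/eqP; apply: contrapT => /negP /br /boxP[_ _].
    by rewrite /= subr0 ler_norml => H; apply: nb; rewrite in_itv.
  apply: ((@integrable_mkcond _ (measurableTypeR R) R mu _ (EFin \o (fun t => f (z, t))) mI).1).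
  apply: (le_bounded_integrable (M := M) mI) => //; last exact: measurable_funTS.
  by rewrite [ltLHS]lebesgue_measure_itv /=; case: ifP => _; rewrite ?ltry.
have JE (z : plane R) : fubini_F mu (EFin \o f) z = (\int[mu]_t f (z, t))%:E.
  by rewrite /fubini_F /Rintegral fineK //; apply: integrable_fin_num.
split.
  have := @integrable_fubini_F _ _ (plane R) (measurableTypeR R) R mu2 mu _ fi.
  by apply: eq_integrable => // z _; exact: JE.
rewrite {1}/Rintegral integral3_fubini // {1}/Rintegral; congr fine.
by apply: eq_integral => z _; exact: JE.
Qed.
End bounded_borel.

(** * Flux of a directional derivative through a Lipschitz graph *)

Section flux.
Context {R : realType}.
Local Notation mu2 := (@borel_leb2 R).
Local Notation mu3 := (@borel_leb3 R).
Local Notation mu := (@lebesgue_measure R).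
Variables (psi : R * R * R -> R) (e : R * R * R).
Hypothesis Cpsi : class_C 1 psi.
Hypothesis supp_psi : compact (tsupport psi).

Lemma bbs_psi : bbs psi.
Proof. by apply: bbs_continuous => //; exact: C1_continuous. Qed.

Lemma bbs_derive : bbs ('D_e psi).
Proof.
have [_ cd] := Cpsi; split.
- by apply: continuous_measurable_fun3; [exact: openT|move=> z _; exact: cd].
- exact: C1_derive_bounded.
- have [r _ Kr] := bounded_set_box supp_psi; exists r => p dp; apply: Kr.
  by apply: contrapT => /(@derive_out_tsupport _ _ _ e) /eqP; exact/negP.
Qed.

Lemma bbs_indic (A : set (space R)) (f : space R -> R) : measurable A -> bbs f ->
  bbs (fun p => \1_A p * f p).
Proof.
move=> mA bf; apply: (@bbs_mul _ _ _ 1) => //.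
by move=> p; rewrite indicE; case: (_ \in _); rewrite ?normr1 ?normr0.
Qed.

(** By translation invariance the difference quotient can be moved from psi to the indicator of [A].
    On the side of psi it converges by dominated convergence; on the side of [A] it will be computed
    slice by slice. *)
Lemma derive_quotient_cvg (A : set (space R)) (u : nat -> R) : measurable A ->
  u @ \oo --> (0 : R) -> (forall n, 0 < u n <= 1) ->
  (u n)^-1 * \int[mu3]_p ((\1_A (p - u n *: e) - \1_A p) * psi p) @[n --> \oo] -->
    \int[mu3]_(p in A) 'D_e psi p.
Proof.
move=> mA u0 u01.
have [Me bMe] := C1_derive_bounded e Cpsi supp_psi.
have lip := C1_lipschitz Cpsi bMe.
have [r r0 Kr] := bounded_set_box supp_psi.
have psi0 p : ~ box 0 r p -> psi p = 0.
  by move=> nb; apply: notin_tsupport => /Kr.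
(* Since u n <= 1, psi and its translate both vanish outside this box, whose measure is finite. *)
pose B : set (space R) := box 0 (r + `|e|).
have mB : measurable B := measurable_box _ _.
pose F (n : nat) (p : space R) : R := \1_A p * ((u n)^-1 * (psi (p + u n *: e) - psi p)).
have un0 n : 0 < u n by case/andP: (u01 n).
have F0 n p : ~ B p -> F n p = 0.
  move=> nB; rewrite /F psi0 ?psi0 ?subrr ?mulr0 //.
    move=> /boxP[/= ? ? ?]; apply: nB; apply/boxP; rewrite /=.
    by have := normr_ge0 e; split; lra.
  move=> /boxP[]; rewrite /= !subr0 => h1 h2 h3; apply: nB; apply/boxP; rewrite /= !subr0.
  have : `|e| <= `|e| by []; rewrite {1}prod_normE /= ge_max prod_normE /= ge_max => /andP[/andP[a1 a2] a3].
  have H (x y : R) : `|x + u n * y| <= r -> `|y| <= `|e| -> `|x| <= r + `|e|.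
    move=> xy ya; rewrite -[x](addrK (u n * y)); apply: (le_trans (ler_normB _ _)).
    apply: lerD => //; rewrite normrM gtr0_norm //; apply: le_trans ya.
    by rewrite ler_piMl //; case/andP: (u01 n).
  by split; [exact: H h1 a1|exact: H h2 a2|exact: H h3 a3].
have bF n : bbs (F n).
  apply: bbs_indic => //; apply: (@bbs_mul _ _ (cst (u n)^-1) `|(u n)^-1|) => //.
  by apply: bbs_sub; [exact: (bbs_translation (u n *: e) bbs_psi)|exact: bbs_psi].
have FM n p : `|F n p| <= `|Me|.
  rewrite /F normrM normrM normfV (gtr0_norm (un0 n)).
  apply: (@le_trans _ _ (1 * ((u n)^-1 * (Me * u n)))).
    apply: ler_pM => //; rewrite ?mulr_ge0 ?invr_ge0 ?(ltW (un0 n)) //.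
      by rewrite indicE; case: (_ \in _); rewrite ?normr1 ?normr0.
    rewrite ler_wpM2l ?invr_ge0 ?(ltW (un0 n)) //.
    by have := lip p (u n); rewrite (gtr0_norm (un0 n)).
  by rewrite mul1r mulrCA mulVf ?mulr1 ?ler_norm // gt_eqF.
have Fcvg p : F n p @[n --> \oo] --> \1_A p * 'D_e psi p.
  apply: cvgM; first exact: cvg_cst.
  by apply: derive_seq_cvg => //; [exact: C1_derivable|move=> n; rewrite gt_eqF].
have intF n : \int[mu3]_(p in B) F n p =
    (u n)^-1 * \int[mu3]_p ((\1_A (p - u n *: e) - \1_A p) * psi p).
  have -> : \int[mu3]_(p in B) F n p = \int[mu3]_p F n p.
    rewrite Rintegral_mkcond; apply: eq_Rintegral => p _; rewrite patchE.
    by case: ifPn => //; rewrite notin_setE => /F0 ->.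
  have b1 : bbs (fun p => \1_A p * psi (p + u n *: e)).
    by apply: bbs_indic => //; exact: (bbs_translation (u n *: e) bbs_psi).
  have b2 : bbs (fun p => \1_A p * psi p) by apply: bbs_indic => //; exact: bbs_psi.
  have b3 : bbs (fun p => \1_A (p - u n *: e) * psi p).
    have := bbs_translation (- (u n *: e)) b1.
    by under [X in bbs X -> _]eq_fun do rewrite subrK.
  transitivity ((u n)^-1 * (\int[mu3]_p (\1_A p * psi (p + u n *: e)) - \int[mu3]_p (\1_A p * psi p))).
    rewrite -RintegralB //; [|exact: (bbs_integrable measurableT)..].
    rewrite -RintegralZl //; last exact: (bbs_integrable measurableT (bbs_sub b1 b2)).
    by apply: eq_Rintegral => p _; rewrite /F; ring.
  congr (_ * _); have [mb3 _ _] := b3.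
  rewrite -[X in X - _](@Rintegral3_translation _ (fun p => \1_A p * psi (p + u n *: e)) (- (u n *: e))); last first.
    by case: b1.
  rewrite -RintegralB //; [|exact: (bbs_integrable measurableT (bbs_translation _ b1))|exact: (bbs_integrable measurableT)].
  by apply: eq_Rintegral => p _; rewrite subrK mulrBl.
under eq_fun do rewrite -intF.
have -> : \int[mu3]_(p in A) 'D_e psi p = \int[mu3]_(p in B) (\1_A p * 'D_e psi p).
  rewrite Rintegral_mkcond [RHS]Rintegral_mkcond; apply: eq_Rintegral => p _.
  rewrite !patchE indicE; case: (p \in A); rewrite ?mul0r ?mul1r; last by case: ifP.
  case: ifPn => //; rewrite notin_setE => nB.
  apply: derive_out_tsupport => /Kr /boxP[? ? ?]; apply: nB; apply/boxP.
  by have := normr_ge0 e; split; lra.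
apply: (bounded_cvg_Rintegral (M := `|Me|)) => //.
- exact: borel_leb3_box_lty.
- by move=> n; apply: measurable_funTS; case: (bF n).
Qed.

Variables (h : R * R -> R) (A : set (space R)) (G N : set (plane R)) (d L : R).
Hypothesis mA : measurable A.
Hypothesis mG : measurable G.
Hypothesis fG : (mu2 G < +oo)%E.
Hypothesis mN : measurable N.
Hypothesis N0 : mu2 N = 0%E.
Hypothesis supp_GN : forall p, tsupport psi p -> (G `|` N) p.1.
Hypothesis d0 : 0 < d.
Hypothesis L0 : 0 <= L.
Hypothesis lip_h : forall z w, G z -> `|w - z| < d -> `|h w - h z| <= L * `|w - z|.
Hypothesis dh : forall z, G z -> derivable h z e.1.
Hypothesis above : forall p q, tsupport psi p -> `|q - p| < d -> (A q <-> h q.1 <= q.2).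

(** Over a point z the translated and the original set differ only between two heights at distance
    O(u n). The slice integral divided by u n is bounded and tends to ('D h - e.2) psi on the graph,
    so dominated convergence over [G] applies. *)
Lemma flux_formula : \int[mu3]_(p in A) 'D_e psi p =
  \int[mu2]_(z in G) (('D_(e.1) h z - e.2) * psi (z, h z)).
Proof.
(* The steps u n <= c must be at most 1 for [derive_quotient_cvg], and must move points by less than
   [d], the range in which [A] is known to be the epigraph of h. *)
pose c := Num.min 1 (d / (`|e| + 1)).
have e1 : 0 < `|e| + 1 by rewrite ltr_wpDl.
have c0 : 0 < c by rewrite lt_min ltr01 divr_gt0.
have c1 : c <= 1 by rewrite ge_min lexx.
have cd : c * `|e| < d.
  apply: (@le_lt_trans _ _ (d / (`|e| + 1) * `|e|)).
    by rewrite ler_wpM2r // ge_min lexx orbT.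
  by rewrite mulrAC ltr_pdivrMr // ltr_pM2l // ltrDl.
pose u n : R := c * n.+1%:R^-1.
have un0 n : 0 < u n by rewrite mulr_gt0 // invr_gt0.
have uc n : u n <= c by rewrite ler_piMr ?(ltW c0) // invf_le1 // ler1n.
have u1 n : 0 < u n <= 1 by rewrite un0 (le_trans (uc n)).
have u0 : u @ \oo --> (0 : R).
  rewrite -(mulr0 c); apply: cvgM; [exact: cvg_cst|exact: cvg_harmonic].
have ud n : `|u n *: e| < d.
  rewrite normrZ gtr0_norm //; apply: le_lt_trans cd.
  by rewrite ler_wpM2r.
have : `|e| <= `|e| by []; rewrite {1}prod_normE /= ge_max => /andP[ez et].
have [S bS] : exists S : R, forall p, `|psi p| <= S by have [_ ? _] := bbs_psi.
have S0 : 0 <= S := le_trans (normr_ge0 _) (bS 0).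
have [M bM] := C1_derive_bounded ((0, 0, 1) : R * R * R) Cpsi supp_psi.
have lipt z (s t : R) : `|psi (z, s) - psi (z, t)| <= M * `|s - t|.
  have := C1_lipschitz Cpsi bM (z, t) (s - t).
  congr (`|psi _ - _| <= _); rewrite [RHS]surjective_pairing; congr (_, _).
    rewrite [LHS]surjective_pairing [RHS]surjective_pairing /=.
    by congr (_, _); rewrite /GRing.scale /= mulr0 addr0.
  by rewrite /= /GRing.scale /= mulr1 subrKC.
have M0 : 0 <= M := le_trans (normr_ge0 _) (bM 0).
(* The height at which the vertical line over z enters the translated set A + u n e. *)
pose b' n z := h (z - u n *: e.1) + u n * e.2.
pose F n (p : space R) : R := (\1_A (p - u n *: e) - \1_A p) * psi p.
have bF n : bbs (F n).
  have b2 : bbs (fun p => \1_A p * psi p) by apply: bbs_indic => //; exact: bbs_psi.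
  have b1 : bbs (fun p => \1_A p * psi (p + u n *: e)).
    by apply: bbs_indic => //; exact: (bbs_translation (u n *: e) bbs_psi).
  have b3 : bbs (fun p => \1_A (p - u n *: e) * psi p).
    have := bbs_translation (- (u n *: e)) b1.
    by under [X in bbs X -> _]eq_fun do rewrite subrK.
  by have := bbs_sub b3 b2; under [X in bbs X -> _]eq_fun do rewrite -mulrBl.
pose J n (z : plane R) : R := (u n)^-1 * \int[mu]_t F n (z, t).
have JE n z : G z -> J n z = (u n)^-1 *
    \int[mu]_t (((b' n z <= t)%R%:R - (h z <= t)%R%:R) * psi (z, t)).
  move=> Gz; congr (_ * _); apply: eq_Rintegral => t _; rewrite /F.
  have [st|nst] := pselect (tsupport psi (z, t)); last first.
    by rewrite (notin_tsupport nst) !mulr0.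
  have Aq : A ((z, t) - u n *: e) <-> b' n z <= t.
    by rewrite (above st) /= ?lerBrDr // addrAC subrr add0r normrN.
  have Ap : A (z, t) <-> h z <= t by rewrite (above st) // subrr normr0.
  have iE (X : set (space R)) p (c' : bool) : (X p <-> c') -> \1_X p = c'%:R :> R.
    by move=> E; rewrite indicE; congr (_%:R : R); congr nat_of_bool; apply/idP/idP; rewrite inE => /E.
  by rewrite (iE _ _ _ Aq) (iE _ _ _ Ap).
have b'b n z : G z -> `|h z - b' n z| <= u n * ((L + 1) * `|e|).
  move=> Gz; rewrite /b' opprD addrA; apply: (le_trans (ler_normB _ _)).
  have ue1 : `|u n *: e.1| <= u n * `|e|.
    by rewrite normrZ (gtr0_norm (un0 n)) ler_wpM2l // ltW.
  have : `|h (z - u n *: e.1) - h z| <= L * (u n * `|e|).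
    apply: (le_trans (lip_h Gz _)); rewrite (addrC z) addrK normrN.
      apply: (le_lt_trans ue1); apply: le_lt_trans cd.
      by rewrite ler_wpM2r.
    by rewrite ler_wpM2l.
  have : `|u n * e.2| <= u n * `|e|.
    by rewrite normrM (gtr0_norm (un0 n)) ler_wpM2l // ltW.
  by rewrite (distrC (h z)); lra.
(* Leading part of the slice integral: [J n z] differs from Q n z * psi (z, h z) by O(u n). *)
pose Q n z := (u n)^-1 * (h z - b' n z).
have QB n z : G z -> `|Q n z| <= (L + 1) * `|e|.
  move=> Gz; rewrite /Q normrM normfV (gtr0_norm (un0 n)) ler_pdivrMl //; exact: b'b.
have JQ n z : G z -> `|J n z - Q n z * psi (z, h z)| <= u n * (M * ((L + 1) * `|e|) ^+ 2).
  move=> Gz; rewrite (JE _ _ Gz) /Q -mulrA -mulrBr normrM normfV (gtr0_norm (un0 n)) ler_pdivrMl //.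
  apply: (le_trans (Rintegral_step_le _ _ (lipt z))).
  have -> : u n * (u n * (M * ((L + 1) * `|e|) ^+ 2)) = M * (u n * ((L + 1) * `|e|)) ^+ 2 by ring.
  rewrite ler_wpM2l // -real_normK ?num_real // lerXn2r ?nnegrE //; last exact: b'b.
  by rewrite !mulr_ge0 ?addr_ge0 // ltW.
have JM n z : G z -> `|J n z| <= M * ((L + 1) * `|e|) ^+ 2 + (L + 1) * `|e| * S.
  move=> Gz; rewrite -[J n z](subrK (Q n z * psi (z, h z))).
  apply: (le_trans (ler_normD _ _)); apply: lerD.
    apply: (le_trans (JQ n z Gz)); rewrite ler_piMl //; last by case/andP: (u1 n).
    by rewrite mulr_ge0 // sqr_ge0.
  by rewrite normrM ler_pM //; exact: QB.
have Jcvg z : G z -> J n z @[n --> \oo] --> ('D_(e.1) h z - e.2) * psi (z, h z).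
  move=> Gz.
  have Qcvg : Q n z @[n --> \oo] --> 'D_(e.1) h z - e.2.
    have un : - u n @[n --> \oo] --> (0 : R) by rewrite -oppr0; exact: cvgN.
    have nun n : - u n != 0 by rewrite oppr_eq0 gt_eqF.
    have := derive_seq_cvg (dh Gz) un nun => H.
    have : (- u n)^-1 * (h (z + (- u n) *: e.1) - h z) - e.2 @[n --> \oo] --> 'D_(e.1) h z - e.2.
      by apply: cvgB => //; exact: cvg_cst.
    apply: cvg_trans; apply: near_eq_cvg; near=> n.
    by rewrite /Q /b' scaleNr; field; rewrite gt_eqF.
  have QP : Q n z * psi (z, h z) @[n --> \oo] --> ('D_(e.1) h z - e.2) * psi (z, h z).
    by apply: cvgM => //; exact: cvg_cst.
  rewrite -[X in _ --> X]addr0.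
  have -> : J ^~ z = (fun n => Q n z * psi (z, h z) + (J n z - Q n z * psi (z, h z))).
    by apply/funext => n; rewrite subrKC.
  apply: cvgD => //; apply: norm_cvg0.
  apply: (@squeeze_cvgr _ _ _ _ (cst 0) (fun n => u n * (M * ((L + 1) * `|e|) ^+ 2))).
  - by near=> n; rewrite normr_ge0 JQ.
  - exact: cvg_cst.
  - rewrite -[X in _ --> X](mul0r (M * ((L + 1) * `|e|) ^+ 2)).
    by apply: cvgM => //; exact: cvg_cst.
have mJ n : measurable_fun setT (J n).
  have [/measurable_int/measurable_EFinP mI _] := Rintegral3_fubini (bF n).
  by apply: measurable_funM => //; exact: measurable_cst.
have intJ n : \int[mu2]_(z in G) J n z = (u n)^-1 * \int[mu3]_p F n p.
  have [iI ->] := Rintegral3_fubini (bF n).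
  rewrite -RintegralZl // /Rintegral; congr fine.
  have iJ : mu2.-integrable setT (EFin \o J n) by exact: (integrableZl measurableT _ iI).
  have iJG := integrableS measurableT mG (@subsetT _ _) iJ.
  (* Off [G] and [N] the vertical line misses the support of psi. Once the null set [N] is removed,
     the integrals over the plane and over [G] coincide. *)
  rewrite [RHS](negligible_integral mN measurableT iJ N0).
  rewrite [LHS](negligible_integral mN mG iJG N0).
  rewrite integral_mkcond [RHS]integral_mkcond; apply: eq_integral => z _; rewrite !patchE.
  have [Nz|nNz] := pselect (N z).
    by rewrite !memNset // => -[].
  rewrite [in RHS]mem_set //; have [Gz|nGz] := pselect (G z); first by rewrite mem_set.
  rewrite memNset; last by move=> [].
  rewrite /= /J (_ : \int[mu]_t F n (z, t) = 0) ?mulr0 //.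
  rewrite /Rintegral integral0_eq // => t _; rewrite /F (@notin_tsupport _ _ psi (z, t)) ?mulr0 //.
  by move=> /supp_GN [].
have H1 := derive_quotient_cvg mA u0 u1.
have H2 := bounded_cvg_Rintegral mG fG (fun n => measurable_funTS (mJ n)) JM Jcvg.
have H3 : \int[mu2]_(z in G) J n z @[n --> \oo] --> \int[mu3]_(p in A) 'D_e psi p.
  by under eq_fun do rewrite intJ; exact: H1.
exact: (cvg_unique _ H3 H2).
Unshelve. all: by end_near. Qed.
End flux.

Section leb3_integrals.
Context {R : realType}.
Local Notation mu2 := (@borel_leb2 R).
Local Notation mu3 := (@borel_leb3 R).
Local Notation cspace := (caratheodory_type (@borel_leb3 R)^*%mu).
Implicit Types (A B : set (R * R * R)) (F : R * R * R -> R).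

Lemma leb3_integrable A F : lebesgue_measurable A -> bbs F ->
  (leb3 : {measure set cspace -> \bar R}).-integrable (A : set cspace) (EFin \o F).
Proof.
move=> mA bF; apply: (@integrableS _ cspace R leb3 setT) => //.
have fi := bbs_integrable measurableT bF; have [mF _ _] := bF.
have mE : measurable_fun (setT : set (space R)) (EFin \o F) by exact/measurable_EFinP.
apply/integrableP; split.
  exact: (@measurable_fun_caratheodory _ (space R) R mu3 _ _ setT (EFin \o F)).
have -> : (\int[leb3]_x `|(EFin \o F) x| = \int[mu3]_x `|(EFin \o F) x|)%E.
  apply: (@ge0_integral_completed _ (space R) R mu3 setT (fun x => `|(EFin \o F) x|%E)) => //.
  exact: measurableT_comp.
by have /integrableP[] := fi.
Qed.

Lemma leb3_RintegralE A F : lebesgue_measurable A -> bbs F ->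
  (\int[leb3]_(p in A) (F p)%:E)%E = (\int[leb3]_(p in A) F p)%:E.
Proof.
by move=> mA bF; rewrite /Rintegral fineK //; exact: (integrable_fin_num mA (leb3_integrable mA bF)).
Qed.

Lemma leb3_RintegralD A F1 F2 : lebesgue_measurable A -> bbs F1 -> bbs F2 ->
  \int[leb3]_(p in A) (F1 p + F2 p) = \int[leb3]_(p in A) F1 p + \int[leb3]_(p in A) F2 p.
Proof.
by move=> mA b1 b2; apply: (@RintegralD _ cspace R leb3) => //; exact: leb3_integrable.
Qed.

Lemma leb3_eq_domain A B F : (forall p, F p != 0 -> (A p <-> B p)) ->
  \int[leb3]_(p in A) F p = \int[leb3]_(p in B) F p.
Proof.
move=> AB; rewrite Rintegral_mkcond [RHS]Rintegral_mkcond; apply: eq_Rintegral => p _.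
rewrite !patchE; have [/eqP ->|/AB E] := boolP (F p == 0); first by rewrite !if_same.
by rewrite (_ : (p \in A) = (p \in B)) //; apply/idP/idP; rewrite !inE => /E.
Qed.

Lemma leb3_Rintegral_borel (A : set (space R)) F : measurable A -> bbs F ->
  \int[leb3]_(p in A) F p = \int[mu3]_(p in A) F p.
Proof.
move=> mA [mF _ _]; rewrite /Rintegral; congr fine.
apply: (@integral_completed _ (space R) R mu3 A (EFin \o F)) => //.
by apply/measurable_EFinP; exact: measurable_funTS.
Qed.

Lemma lebesgue_measurable_borel (A : set (space R)) : measurable A -> lebesgue_measurable A.
Proof. by move=> mA; exact: (@measurable_caratheodory _ (space R) R mu3). Qed.

Lemma bbs_add F1 F2 : bbs F1 -> bbs F2 -> bbs (fun p => F1 p + F2 p).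
Proof.
move=> b1 b2; have bN : bbs (fun p => 0 - F2 p).
  apply: bbs_sub => //; split; first exact: measurable_cst.
    by exists 0 => p; rewrite normr0.
  by exists 0 => p; rewrite eqxx.
by have := bbs_sub b1 bN; under [X in bbs X -> _]eq_fun do rewrite sub0r opprK.
Qed.
End leb3_integrals.

Section bounded_measurable.
Context {R : realType}.
Local Notation mu2 := (@borel_leb2 R).
Variable G : set (plane R).
Hypothesis mG : measurable G.
Hypothesis fG : (mu2 G < +oo)%E.

(* bm stands for bounded and measurable. *)
Definition bm (k : plane R -> R) := measurable_fun G k /\ exists M : R, forall z, G z -> `|k z| <= M.

Lemma bm_integrable k : bm k -> mu2.-integrable G (EFin \o k).
Proof. by move=> [mk [M bk]]; exact: (le_bounded_integrable mG fG mk bk). Qed.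

Lemma bm_add k1 k2 : bm k1 -> bm k2 -> bm (fun z => k1 z + k2 z).
Proof.
move=> [m1 [M1 b1]] [m2 [M2 b2]]; split; first exact: measurable_funD.
by exists (M1 + M2) => z Gz; apply: (le_trans (ler_normD _ _)); apply: lerD; [exact: b1|exact: b2].
Qed.

Lemma bm_sub k1 k2 : bm k1 -> bm k2 -> bm (fun z => k1 z - k2 z).
Proof.
move=> [m1 [M1 b1]] [m2 [M2 b2]]; split; first exact: measurable_funB.
by exists (M1 + M2) => z Gz; apply: (le_trans (ler_normB _ _)); apply: lerD; [exact: b1|exact: b2].
Qed.

Lemma bm_mul k1 k2 : bm k1 -> bm k2 -> bm (fun z => k1 z * k2 z).
Proof.
move=> [m1 [M1 b1]] [m2 [M2 b2]]; split; first exact: measurable_funM.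
by exists (M1 * M2) => z Gz; rewrite normrM; apply: ler_pM => //; [exact: b1|exact: b2].
Qed.

Lemma bm_cst (c : R) : bm (cst c).
Proof. by split; [exact: measurable_cst|exists `|c|]. Qed.

Lemma bm_RintegralD k1 k2 : bm k1 -> bm k2 ->
  \int[mu2]_(z in G) (k1 z + k2 z) = \int[mu2]_(z in G) k1 z + \int[mu2]_(z in G) k2 z.
Proof. by move=> /bm_integrable i1 /bm_integrable i2; exact: RintegralD. Qed.

Lemma bm_RintegralB k1 k2 : bm k1 -> bm k2 ->
  \int[mu2]_(z in G) (k1 z - k2 z) = \int[mu2]_(z in G) k1 z - \int[mu2]_(z in G) k2 z.
Proof. by move=> /bm_integrable i1 /bm_integrable i2; exact: RintegralB. Qed.

Lemma bm_le k1 k2 : bm k1 -> bm k2 -> (forall z, G z -> k1 z <= k2 z) ->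
  \int[mu2]_(z in G) k1 z <= \int[mu2]_(z in G) k2 z.
Proof. by move=> /bm_integrable i1 /bm_integrable i2; exact: le_Rintegral. Qed.
End bounded_measurable.

Section divergence.
Context {R : realType}.
Local Notation E2 := (R * R)%type.
Local Notation E3 := (R * R * R)%type.
Local Notation mu2 := (@borel_leb2 R).
Local Notation mu3 := (@borel_leb3 R).

(** The coefficient 2 y does not depend on t, so it can be moved under the t-derivative. Each field
    then becomes a sum of pure directional derivatives, to which the flux formula applies. *)
Lemma bbs_field_X (psi : E3 -> R) : C1c psi ->
  (forall p, field_X psi p = 'D_((1, 0, 0) : E3) psi p + 'D_((0, 0, 1) : E3) (fun p : E3 => 2 * p.1.2 * psi p) p) /\
  C1c (fun p : E3 => 2 * p.1.2 * psi p) /\ tsupport (fun p : E3 => 2 * p.1.2 * psi p) `<=` tsupport psi.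
Proof.
move=> [Cp sp].
have Cb : class_C 1 (fun p : E3 => 2 * p.1.2) by apply: C1_mul; [exact: C1_cst|exact: C1_y].
have sub : tsupport (fun p : E3 => 2 * p.1.2 * psi p) `<=` tsupport psi.
  apply: closure_subset => p /=; rewrite mulf_eq0 negb_or => /andP[] //.
split; [|split=> //; split; first exact: C1_mul].
  move=> p; rewrite /field_X; congr (_ + _).
  rewrite [RHS](@deriveM _ _ (fun p : E3 => 2 * p.1.2) psi); [|exact: C1_derivable..].
  rewrite (_ : 'D__ (fun p : E3 => 2 * p.1.2) p = 0) ?scaler0 ?addr0 //.
  rewrite /derive; apply/cvg_lim => //.
  apply: (@cvg_trans _ (cst (0 : R) @ 0^')); last exact: cvg_cst.
  apply: near_eq_cvg; near=> h.
  by rewrite /shift /= /GRing.scale /= mulr0 add0r subrr mulr0.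
apply: (subclosed_compact _ sp sub); exact: closed_closure.
Unshelve. all: by end_near. Qed.

Lemma bbs_field_Y (psi : E3 -> R) : C1c psi ->
  (forall p, field_Y psi p = 'D_((0, 1, 0) : E3) psi p + 'D_((0, 0, 1) : E3) (fun p : E3 => - 2 * p.1.1 * psi p) p) /\
  C1c (fun p : E3 => - 2 * p.1.1 * psi p) /\ tsupport (fun p : E3 => - 2 * p.1.1 * psi p) `<=` tsupport psi.
Proof.
move=> [Cp sp].
have Cb : class_C 1 (fun p : E3 => - 2 * p.1.1) by apply: C1_mul; [exact: C1_cst|exact: C1_x].
have sub : tsupport (fun p : E3 => - 2 * p.1.1 * psi p) `<=` tsupport psi.
  apply: closure_subset => p /=; rewrite mulf_eq0 negb_or => /andP[] //.
split; [|split=> //; split; first exact: C1_mul].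
  move=> p; rewrite /field_Y -mulNr -mulNr; congr (_ + _).
  rewrite [RHS](@deriveM _ _ (fun p : E3 => - 2 * p.1.1) psi); [|exact: C1_derivable..].
  rewrite (_ : 'D__ (fun p : E3 => - 2 * p.1.1) p = 0) ?scaler0 ?addr0 //.
  rewrite /derive; apply/cvg_lim => //.
  apply: (@cvg_trans _ (cst (0 : R) @ 0^')); last exact: cvg_cst.
  apply: near_eq_cvg; near=> h.
  by rewrite /shift /= /GRing.scale /= mulr0 add0r subrr mulr0.
apply: (subclosed_compact _ sp sub); exact: closed_closure.
Unshelve. all: by end_near. Qed.

End divergence.

Section graph_divergence.
Context {R : realType}.
Local Notation E2 := (R * R)%type.
Local Notation E3 := (R * R * R)%type.
Local Notation mu2 := (@borel_leb2 R).
(* [Z] is the region of interest, well inside the open set [W]; [G] collects the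
   points of [Z] where [h] has partial derivatives, up to the null set [N]. *)
Variables (W Z : set E2) (G N : set (plane R)) (h : E2 -> R) (d L : R) (A : set E3).
Hypothesis oW : open W.
Hypothesis ch : forall z, W z -> {for z, continuous h}.
Hypothesis mG : measurable G.
Hypothesis fG : (mu2 G < +oo)%E.
Hypothesis mN : measurable N.
Hypothesis N0 : mu2 N = 0%E.
Hypothesis GZ : G `<=` Z.
Hypothesis ZGN : Z `<=` G `|` N.
Hypothesis d0 : 0 < d.
Hypothesis L0 : 0 <= L.
Hypothesis lip_h : forall z w, Z z -> `|w - z| < d -> W w /\ `|h w - h z| <= L * `|w - z|.
Hypothesis mA : lebesgue_measurable A.

Let ZW : Z `<=` W.
Proof. by move=> z Zz; have [] := lip_h Zz (w := z); rewrite ?subrr ?normr0. Qed.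

Lemma measurable_epigraph : measurable ([set q | W q.1 /\ h q.1 <= q.2] : set (space R)).
Proof.
pose O : set E3 := [set q | W q.1].
have oO : open O by exact: (open_comp (fun q _ => cont_fst (x := q)) oW).
have mF : measurable_fun O (fun q : E3 => q.2 - h q.1).
  apply: continuous_measurable_fun3 => // q Oq; apply: cvgB; first exact: cont_snd.
  by apply: (@continuous_comp _ _ _ (@fst E2 R) h); [exact: cont_fst|exact: ch].
have := mF (open_measurable3 oO) _ (measurable_itv `[0, +oo[).
congr measurable; apply/seteqP; split=> q /=; rewrite in_itv /= andbT subr_ge0;
  by move=> [].
Qed.

(** [A] is only Lebesgue measurable. On the support of psi it agrees with the Borel epigraph of h
    over [W], for which the Borel flux formula holds. *)
Lemma leb3_flux (psi : E3 -> R) (e : E3) : C1c psi ->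
  (forall p, tsupport psi p -> Z p.1 /\ (A p <-> h p.1 <= p.2)) ->
  (forall z, G z -> derivable h z e.1) ->
  \int[leb3]_(p in A) 'D_e psi p =
  \int[mu2]_(z in G) (('D_(e.1) h z - e.2) * psi (z, h z)).
Proof.
move=> [Cp sp] supp dh.
have mA' := measurable_epigraph.
have bd := bbs_derive e Cp sp.
have dist1 (p q : E3) : `|q.1 - p.1| <= `|q - p| by rewrite [leRHS]prod_normE /= le_max lexx.
rewrite (@leb3_eq_domain _ A [set q | W q.1 /\ h q.1 <= q.2]); last first.
  move=> p /eqP np; have sp' : tsupport psi p.
    by apply: contrapT => /(@derive_out_tsupport _ _ _ e).
  have [Zp ->] := supp p sp'; split=> [?|[]//]; split=> //; exact: ZW.
rewrite leb3_Rintegral_borel //.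
apply: (flux_formula Cp sp mA' mG fG mN N0 _ d0 L0 _ dh).
- by move=> p /supp[/ZGN].
- by move=> z w /GZ /lip_h H /H[].
- move=> p q /supp[Zp _] qp; split=> [[]//|hq]; split=> //.
  by have [] := lip_h Zp (le_lt_trans (dist1 p q) qp).
Qed.

Hypothesis dh1 : forall z, G z -> derivable h z (1, 0).
Hypothesis dh2 : forall z, G z -> derivable h z (0, 1).
Hypothesis mdh1 : measurable_fun G ('D_((1, 0) : E2) h).
Hypothesis mdh2 : measurable_fun G ('D_((0, 1) : E2) h).

Lemma derive_bounded_lipschitz (e : E2) z : `|e| <= 1 -> G z -> derivable h z e ->
  `|'D_e h z| <= L.
Proof.
move=> e1 Gz dz; have hc := derive_seq_cvg dz (@cvg_harmonic R).
have {}hc := cvg_norm (hc (fun n => invr_neq0 (lt0r_neq0 (ltr0Sn R n)))).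
apply: (cvgr_to_le (hc _)); near=> n.
rewrite /harmonic /= invrK normrM (ger0_norm (ler0n R n.+1)).
have se : `|n.+1%:R^-1 *: e| <= n.+1%:R^-1 :> R.
  by rewrite normrZ ger0_norm ?invr_ge0 // ler_piMr ?invr_ge0.
have [] := lip_h (GZ Gz) (w := z + n.+1%:R^-1 *: e).
  rewrite addrAC subrr add0r; apply: (le_lt_trans se).
  by near: n; exact: (near_infty_natSinv_lt (PosNum d0)).
rewrite addrAC subrr add0r => _ H.
rewrite mulrC -ler_pdivlMr ?ltr0Sn //; apply: (le_trans H).
by rewrite ler_wpM2l.
Unshelve. all: by end_near. Qed.

Lemma bm_partial1 : bm G ('D_((1, 0) : E2) h).
Proof.
split=> //; exists L => z Gz; apply: derive_bounded_lipschitz => //; last exact: dh1.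
by rewrite prod_normE /= normr1 normr0 ge_max lexx ler01.
Qed.

Lemma bm_partial2 : bm G ('D_((0, 1) : E2) h).
Proof.
split=> //; exists L => z Gz; apply: derive_bounded_lipschitz => //; last exact: dh2.
by rewrite prod_normE /= normr1 normr0 ge_max lexx ler01.
Qed.

Lemma bm_on_graph (psi : E3 -> R) (M : R) : continuous psi -> (forall p, `|psi p| <= M) ->
  bm G (fun z => psi (z, h z)).
Proof.
move=> cpsi bM; split; last by exists M.
have mW : measurable_fun W (fun z => psi (z, h z)).
  apply: continuous_measurable_fun2 => // z Wz.
  apply: (@continuous_comp _ _ _ (fun z => (z, h z)) psi); last exact: cpsi.
  exact: (cvg_pair (@cvg_id _ (nbhs z)) (ch Wz)).
by apply: (measurable_funS _ _ mW); [exact: open_measurable2|move=> z /GZ /ZW].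
Qed.

Lemma bm_fst (r : R) : (forall z, G z -> `|z| <= r) -> bm G fst.
Proof.
move=> Gr; split; last by exists r => z /Gr; apply: le_trans; rewrite [leRHS]prod_normE le_max lexx.
by apply: measurable_funTS; exact: measurable_fst.
Qed.

Lemma bm_snd (r : R) : (forall z, G z -> `|z| <= r) -> bm G snd.
Proof.
move=> Gr; split; last by exists r => z /Gr; apply: le_trans; rewrite [leRHS]prod_normE le_max lexx orbT.
by apply: measurable_funTS; exact: measurable_snd.
Qed.

Variable r : R.
Hypothesis Gr : forall z, G z -> `|z| <= r.

(** The horizontal directions contribute the partial derivatives of h. The vertical direction
    contributes minus the values 2 y psi1 and -2 x psi2 on the graph, which is where 2 z^perp comes
    from. *)
Lemma divergence_formula (psi1 psi2 : E3 -> R) : C1c psi1 -> C1c psi2 ->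
  (forall p, tsupport psi1 p \/ tsupport psi2 p -> Z p.1 /\ (A p <-> h p.1 <= p.2)) ->
  \int[leb3]_(p in A) (field_X psi1 p + field_Y psi2 p) =
  \int[mu2]_(z in G) dot (psi1 (z, h z), psi2 (z, h z)) (gradient h z + 2 *: perp z).
Proof.
move=> C1 C2 supp.
have [eX [CX sX]] := bbs_field_X C1; have [eY [CY sY]] := bbs_field_Y C2.
have bD (psi : E3 -> R) (e : E3) : C1c psi -> bbs ('D_e psi).
  by move=> [? ?]; exact: bbs_derive.
have bmp (psi : E3 -> R) : C1c psi -> bm G (fun z => psi (z, h z)).
  move=> [Cp sp]; have [M bM] := compact_support_bounded sp (C1_continuous Cp) (@notin_tsupport _ _ psi).
  exact: (bm_on_graph (C1_continuous Cp) bM).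
under eq_Rintegral do rewrite eX eY.
rewrite leb3_RintegralD //; [|by apply: bbs_add; exact: bD..].
rewrite leb3_RintegralD //; [|exact: bD..].
rewrite leb3_RintegralD //; [|exact: bD..].
have d00 z : G z -> derivable h z ((0, 0) : E2) by move=> _; exact: derivable0.
have s1 p : tsupport psi1 p -> Z p.1 /\ (A p <-> h p.1 <= p.2) by move=> ?; apply: supp; left.
have s2 p : tsupport psi2 p -> Z p.1 /\ (A p <-> h p.1 <= p.2) by move=> ?; apply: supp; right.
rewrite (@leb3_flux psi1 (1, 0, 0) C1 s1 dh1) (@leb3_flux psi2 (0, 1, 0) C2 s2 dh2).
rewrite (@leb3_flux _ (0, 0, 1) CX (fun p sp => s1 p (sX p sp)) d00).
rewrite (@leb3_flux _ (0, 0, 1) CY (fun p sp => s2 p (sY p sp)) d00).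
rewrite /=.
have b1 := bm_partial1; have b2 := bm_partial2; have p1 := bmp _ C1; have p2 := bmp _ C2.
have f1 := bm_fst Gr; have f2 := bm_snd Gr.
have z0 z : 'D_((0, 0) : E2) h z = 0 by exact: derive0.
have bz : bm G ('D_((0, 0) : E2) h).
  by rewrite (_ : 'D_((0, 0) : E2) h = cst 0); [exact: bm_cst|apply/funext => z; exact: z0].
have X1 := bm_mul (bm_sub b1 (bm_cst _ 0)) p1.
have Y1 := bm_mul (bm_sub b2 (bm_cst _ 0)) p2.
have X2 := bm_mul (bm_sub bz (bm_cst _ 1)) (bm_mul (bm_mul (bm_cst _ 2) f2) p1).
have Y2 := bm_mul (bm_sub bz (bm_cst _ 1)) (bm_mul (bm_mul (bm_cst _ (- 2)) f1) p2).
rewrite -(bm_RintegralD mG fG X1 X2) -(bm_RintegralD mG fG Y1 Y2).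
rewrite -(bm_RintegralD mG fG (bm_add X1 X2) (bm_add Y1 Y2)).
by apply: eq_Rintegral => z _; rewrite z0 /dot /gradient /perp /= /GRing.scale /=; ring.
Qed.
End graph_divergence.

(** * Calibration of the perimeter near the graph *)

Section euclidean_plane.
Context {R : realType}.
Implicit Types (z w : R * R).

Lemma dot_ge0 z : 0 <= dot z z.
Proof. by rewrite /dot -!expr2 addr_ge0 ?sqr_ge0. Qed.

Lemma enorm_ge0 z : 0 <= enorm z.
Proof. exact: sqrtr_ge0. Qed.

Lemma sqr_enorm z : enorm z ^+ 2 = dot z z.
Proof. by rewrite sqr_sqrtr ?dot_ge0. Qed.

Lemma enorm_gt0 z : z != 0 -> 0 < enorm z.
Proof.
move=> z0; rewrite lt_def enorm_ge0 andbT sqrtr_eq0 -ltNge /dot -!expr2.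
rewrite lt_def addr_ge0 ?sqr_ge0 // andbT paddr_eq0 ?sqr_ge0 // !sqrf_eq0.
by apply: contra z0 => /andP[/eqP e1 /eqP e2]; rewrite [z]surjective_pairing e1 e2.
Qed.

Lemma dot_le z w : dot z w <= enorm z * enorm w.
Proof.
have [//|p] := leP (dot z w) (enorm z * enorm w).
have h0 : 0 <= enorm z * enorm w by rewrite mulr_ge0 ?enorm_ge0.
have : (enorm z * enorm w) ^+ 2 < dot z w ^+ 2 by rewrite ltrXn2r // ?nnegrE // ltW // (le_lt_trans h0).
rewrite exprMn !sqr_enorm /dot => h.
by have := sqr_ge0 (z.1 * w.2 - z.2 * w.1); nra.
Qed.

Lemma enorm_le1 z : z.1 ^+ 2 + z.2 ^+ 2 <= 1 -> enorm z <= 1.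
Proof. by move=> h; rewrite -sqrtr1 ler_sqrt ?ltr01 // /dot -!expr2. Qed.

Lemma dot_le_enorm z w : z.1 ^+ 2 + z.2 ^+ 2 <= 1 -> dot z w <= enorm w.
Proof.
move=> /enorm_le1 h; apply: (le_trans (dot_le z w)).
by rewrite ler_piMl ?enorm_ge0.
Qed.
End euclidean_plane.

(** * C^1 approximation preserving the unit bound *)

Section quasi_interpolation.
Context {R : realType}.
Local Notation E2 := (R * R)%type.
Local Notation E3 := (R * R * R)%type.

(** A bump around the integer k - M. Consecutive bumps telescope, so their sum over k is 1 on
    [-M, M]. *)
Definition spline (M k : nat) (s : R) : R := step (s + M%:R + 1 - k%:R) - step (s + M%:R - k%:R).

Lemma spline_ge0 M k s : 0 <= spline M k s.
Proof. by rewrite subr_ge0; apply: step_homo; lra. Qed.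

Lemma spline_sum M s :
  \sum_(k < (M + M).+1) spline M k s = step (s + M%:R + 1) - step (s - M%:R).
Proof.
rewrite -(big_mkord xpredT (fun k => spline M k s)).
have -> : \sum_(0 <= k < (M + M).+1) spline M k s =
    \sum_(0 <= k < (M + M).+1) (- step (s + M%:R + 1 - k.+1%:R) - - step (s + M%:R + 1 - k%:R)).
  apply: eq_bigr => k _; rewrite /spline opprK addrC; congr (_ + _).
  by congr (- step _); rewrite -natr1; ring.
rewrite telescope_sumr // subr0 opprK addrC; congr (_ - step _).
by rewrite -natr1 natrD; ring.
Qed.

Lemma spline_sum_le1 M s : 0 <= \sum_(k < (M + M).+1) spline M k s <= 1.
Proof.
rewrite sumr_ge0 => [/=|k _]; last exact: spline_ge0.
rewrite spline_sum; have /andP[? ?] := step_itv (s + M%:R + 1).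
by have /andP[? ?] := step_itv (s - M%:R); lra.
Qed.

Lemma spline_sum1 M s : `|s| <= M%:R -> \sum_(k < (M + M).+1) spline M k s = 1.
Proof.
rewrite ler_norml => /andP[? ?]; rewrite spline_sum step_ge1; last lra.
by rewrite step_le0 ?subr0 //; lra.
Qed.

Lemma spline_neq0 M k s : spline M k s != 0 -> `|s - (k%:R - M%:R)| <= 1.
Proof.
move=> /eqP nz; rewrite ler_norml; apply/andP; split; rewrite leNgt; apply/negP => h; apply: nz.
  by rewrite /spline !step_le0 ?subrr //; lra.
by rewrite /spline !step_ge1 ?subrr //; lra.
Qed.

Lemma C1_spline (V : normedModType R) M k (f : V -> R) : class_C 1 f ->
  class_C 1 (fun v => spline M k (f v)).
Proof.
move=> Cf; apply: C1_sub; apply: C1_step.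
  exact: (C1_sub (C1_add (C1_add Cf (C1_cst _)) (C1_cst _)) (C1_cst _)).
exact: (C1_sub (C1_add Cf (C1_cst _)) (C1_cst _)).
Qed.

(** With (m+1)^2 nodes of spacing 1/(m+1) on each side of 0, the grid covers [-(m+1), m+1]: it
    exhausts the plane while its mesh tends to 0. *)
Let M (m : nat) := (m.+1 * m.+1)%N.
Let I m : finType := ('I_(M m + M m).+1 * 'I_(M m + M m).+1)%type.
Let node m (i : I m) : E2 :=
  ((i.1%:R - (M m)%:R) / m.+1%:R, (i.2%:R - (M m)%:R) / m.+1%:R).
Let weight m (i : I m) (z : E2) : R :=
  spline (M m) i.1 (m.+1%:R * z.1) * spline (M m) i.2 (m.+1%:R * z.2).

(* A C^1 substitute for convolution: a locally convex combination of the values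
   of [u] at the nodes of a grid of mesh [1 / m.+1], so that pointwise unit
   bounds are preserved. *)
Definition quasi_interpolant (u : E2 -> R) (m : nat) (p : E3) : R :=
  \sum_i weight i p.1 * u (@node m i).

Let weight_ge0 m (i : I m) z : 0 <= weight i z.
Proof. by rewrite mulr_ge0 ?spline_ge0. Qed.

Let weight_sum m z : \sum_i @weight m i z =
  (\sum_(k < (M m + M m).+1) spline (M m) k (m.+1%:R * z.1)) *
  (\sum_(k < (M m + M m).+1) spline (M m) k (m.+1%:R * z.2)).
Proof.
rewrite big_distrl /= -(pair_bigA _ (fun k l : 'I_(M m + M m).+1 =>
  spline (M m) k (m.+1%:R * z.1) * spline (M m) l (m.+1%:R * z.2))) /=.
by apply: eq_bigr => k _; rewrite big_distrr.
Qed.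

Lemma C1_quasi_interpolant u m : class_C 1 (quasi_interpolant u m).
Proof.
apply: C1_sum => i; apply: C1_mul; last exact: C1_cst.
by apply: C1_mul; apply: C1_spline; apply: C1_mul; [exact: C1_cst|exact: C1_x|exact: C1_cst|exact: C1_y].
Qed.

(** With n the interpolated vector, |n|^2 is the weighted sum of the products of nodal values with
    n. Cauchy-Schwarz at each node and total weight at most 1 give |n|^2 <= |n|. *)
Lemma quasi_interpolant_unit (u1 u2 : E2 -> R) m p :
  (forall z, u1 z ^+ 2 + u2 z ^+ 2 <= 1) ->
  quasi_interpolant u1 m p ^+ 2 + quasi_interpolant u2 m p ^+ 2 <= 1.
Proof.
move=> u_le1; set n1 := quasi_interpolant u1 m p; set n2 := quasi_interpolant u2 m p.
pose r := enorm (n1, n2); have r0 : 0 <= r := enorm_ge0 _.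
have r2 : r ^+ 2 = n1 ^+ 2 + n2 ^+ 2 by rewrite sqr_enorm /dot -!expr2.
suff : r ^+ 2 <= r by rewrite -r2 expr2 => h; nra.
have /andP[s1 s2] := spline_sum_le1 (M m) (m.+1%:R * p.1.1).
have /andP[s3 s4] := spline_sum_le1 (M m) (m.+1%:R * p.1.2).
have ws : \sum_i @weight m i p.1 <= 1 by rewrite weight_sum mulr_ile1.
apply: (@le_trans _ _ (\sum_i @weight m i p.1 * r)); last by rewrite -mulr_suml ler_piMl.
have E (u : E2 -> R) (c : R) : quasi_interpolant u m p * c =
    \sum_i @weight m i p.1 * (u (node i) * c).
  by rewrite mulr_suml; apply: eq_bigr => i _; rewrite mulrA.
rewrite r2 !expr2 (E u1 n1) (E u2 n2) -big_split /=.
apply: ler_sum => i _; rewrite -mulrDr; apply: ler_wpM2l => //.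
by apply: (@dot_le_enorm _ (u1 (node i), u2 (node i)) (n1, n2)); exact: u_le1.
Qed.

(** Only nodes within 1/(m+1) of z carry weight, so continuity at the single point z suffices. This
    matters because the fields to be approximated are controlled only over [G]. *)
Lemma quasi_interpolant_cvg (u : E2 -> R) z t : {for z, continuous u} ->
  quasi_interpolant u m (z, t) @[m --> \oo] --> u z.
Proof.
move=> cu; apply/cvgrPdist_le => eps eps0.
have [d /= d0 Hd] : exists2 d : R, 0 < d & forall w, ball z d w -> `|u z - u w| <= eps.
  by have /cvgrPdist_le /(_ _ eps0) /nbhs_ballP := cu.
near=> m.
have mz : `|z| <= m.+1%:R.
  near: m; exists (Num.bound `|z|) => // m /= hm.
  apply: (le_trans (ltW (archi_boundP (normr_ge0 z)))).
  by rewrite ler_nat (leq_trans hm).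
have md : m.+1%:R^-1 < d by near: m; exact: (near_infty_natSinv_lt (PosNum d0)).
have m0 : 0 < m.+1%:R :> R by rewrite ltr0Sn.
have MM : (M m)%:R = m.+1%:R * m.+1%:R :> R by rewrite natrM.
have : `|z| <= m.+1%:R := mz; rewrite prod_normE ge_max => /andP[z1 z2].
have ws : \sum_i @weight m i z = 1.
  by rewrite weight_sum !spline_sum1 ?mulr1 // normrM gtr0_norm // MM ler_pM2l.
rewrite -[u z]mul1r -{1}ws /quasi_interpolant mulr_suml -sumrB /=.
apply: (le_trans (ler_norm_sum _ _ _)).
apply: (@le_trans _ _ (\sum_i @weight m i z * eps)); last by rewrite -mulr_suml ws mul1r.
apply: ler_sum => i _; rewrite -mulrBr normrM ger0_norm //.
have [->|] := eqVneq (weight i z) 0; first by rewrite !mul0r.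
move=> wn; have /andP[/spline_neq0 w1 /spline_neq0 w2] :
  (spline (M m) i.1 (m.+1%:R * z.1) != 0) && (spline (M m) i.2 (m.+1%:R * z.2) != 0).
  by move: wn; rewrite /weight mulf_eq0 negb_or.
apply: ler_wpM2l => //; apply: Hd; apply/ballP2.
have H (x a : R) : `|m.+1%:R * x - a| <= 1 -> `|a / m.+1%:R - x| < d.
  move=> h; apply: le_lt_trans md; rewrite distrC.
  have -> : x - a / m.+1%:R = (m.+1%:R * x - a) * m.+1%:R^-1 by field; rewrite gt_eqF.
  by rewrite normrM normfV (gtr0_norm m0) ler_piMl // invr_ge0 ltW.
by split; apply: H.
Unshelve. all: by end_near. Qed.
End quasi_interpolation.

Section C1_plane.
Context {R : realType}.
Local Notation E2 := (R * R)%type.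

Lemma C1_compact_lipschitz2 (phi : E2 -> R) : class_C 1 phi -> compact (tsupport phi) ->
  exists2 L : R, 0 <= L & forall z w, `|phi w - phi z| <= L * `|w - z|.
Proof.
move=> Cp sp; have [M1 b1] := C1_derive_bounded ((1, 0) : E2) Cp sp.
have [M2 b2] := C1_derive_bounded ((0, 1) : E2) Cp sp.
have M10 : 0 <= M1 := le_trans (normr_ge0 _) (b1 0).
have M20 : 0 <= M2 := le_trans (normr_ge0 _) (b2 0).
exists (M1 + M2) => [|z w]; first exact: addr_ge0.
pose h1 := w.1 - z.1; pose h2 := w.2 - z.2.
have wE : w = z + h1 *: (1, 0) + h2 *: (0, 1).
  by rewrite [LHS]surjective_pairing; congr (_, _); rewrite /= /GRing.scale /= /h1 /h2; ring.
have l1 := C1_lipschitz Cp b1 z h1.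
have l2 := C1_lipschitz Cp b2 (z + h1 *: (1, 0)) h2.
have : `|w - z| <= `|w - z| by []; rewrite {1}prod_normE ge_max => /andP[/= n1 n2].
have -> : phi w - phi z = (phi (z + h1 *: (1, 0) + h2 *: (0, 1)) - phi (z + h1 *: (1, 0))) +
    (phi (z + h1 *: (1, 0)) - phi z) by rewrite -wE addrA subrK.
apply: (le_trans (ler_normD _ _)).
have := ler_wpM2l M10 n1; have := ler_wpM2l M20 n2; rewrite -/h1 -/h2; lra.
Qed.
End C1_plane.

Section C1c_functions.
Context {R : realType}.
Local Notation E3 := (R * R * R)%type.
Implicit Types (psi chi : E3 -> R).

Lemma tsupport_mulr chi psi : tsupport (fun p => chi p * psi p) `<=` tsupport psi.
Proof. by apply: closure_subset => p /=; rewrite mulf_eq0 negb_or => /andP[]. Qed.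

Lemma tsupport_mull chi psi : tsupport (fun p => chi p * psi p) `<=` tsupport chi.
Proof. by apply: closure_subset => p /=; rewrite mulf_eq0 negb_or => /andP[]. Qed.

Lemma C1c_mull chi psi : C1c chi -> class_C 1 psi -> C1c (fun p => chi p * psi p).
Proof.
move=> [Cc sc] Cp; split; first exact: C1_mul.
by apply: (subclosed_compact _ sc); [exact: closed_closure|exact: tsupport_mull].
Qed.

Lemma C1c_mulr chi psi : class_C 1 chi -> C1c psi -> C1c (fun p => chi p * psi p).
Proof.
move=> Cc [Cp sp]; split; first exact: C1_mul.
by apply: (subclosed_compact _ sp); [exact: closed_closure|exact: tsupport_mulr].
Qed.

Lemma C1c_add chi psi : C1c chi -> C1c psi -> C1c (fun p => chi p + psi p).
Proof.
move=> [Cc sc] [Cp sp]; split; first exact: C1_add.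
apply: (@compact_tsupport _ _ (tsupport chi `|` tsupport psi)); first exact: compactU.
move=> p; have [/eqP ->|n _] := boolP (chi p == 0); last by left; exact: subset_closure.
by rewrite add0r => n; right; exact: subset_closure.
Qed.

Lemma field_XD psi1 psi2 p : class_C 1 psi1 -> class_C 1 psi2 ->
  field_X (fun q => psi1 q + psi2 q) p = field_X psi1 p + field_X psi2 p.
Proof.
move=> C1 C2; rewrite /field_X !(@deriveD _ _ _ psi1 psi2); first ring.
all: exact: C1_derivable.
Qed.

Lemma field_YD psi1 psi2 p : class_C 1 psi1 -> class_C 1 psi2 ->
  field_Y (fun q => psi1 q + psi2 q) p = field_Y psi1 p + field_Y psi2 p.
Proof.
move=> C1 C2; rewrite /field_Y !(@deriveD _ _ _ psi1 psi2); first ring.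
all: exact: C1_derivable.
Qed.

Lemma bbs_div psi1 psi2 : C1c psi1 -> C1c psi2 -> bbs (fun p => field_X psi1 p + field_Y psi2 p).
Proof.
have bD (psi : E3 -> R) (e : E3) : C1c psi -> bbs ('D_e psi).
  by move=> [? ?]; exact: bbs_derive.
move=> C1 C2; have [eX [CX sX]] := bbs_field_X C1; have [eY [CY sY]] := bbs_field_Y C2.
rewrite (_ : (fun p => _) = fun p =>
  ('D_((1, 0, 0) : E3) psi1 p + 'D_((0, 0, 1) : E3) (fun p : E3 => 2 * p.1.2 * psi1 p) p) +
  ('D_((0, 1, 0) : E3) psi2 p + 'D_((0, 0, 1) : E3) (fun p : E3 => - 2 * p.1.1 * psi2 p) p)).
  by apply: bbs_add; apply: bbs_add; exact: bD.
by apply/funext => p; rewrite eX eY.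
Qed.

Lemma derive_near0 psi (e : E3) p : (\forall q \near p, psi q = 0) -> 'D_e psi p = 0.
Proof. by move=> H; rewrite (@near_eq_derive _ _ _ psi (cst 0) _ e H) derive_cst. Qed.
End C1c_functions.

Section bounded_vector_fields.
Context {R : realType}.
Variable G : set (plane R).

Lemma bm_enorm (u1 u2 : plane R -> R) : bm G u1 -> bm G u2 ->
  bm G (fun z => enorm (u1 z, u2 z)).
Proof.
move=> b1 b2; have [mS [M bM]] := bm_add (bm_mul b1 b1) (bm_mul b2 b2); split.
  apply: (measurable_comp (F := setT) _ _ _ mS) => //.
  by apply: continuous_measurable_fun; exact: sqrt_continuous.
exists (Num.sqrt M) => z Gz; rewrite ger0_norm ?enorm_ge0 //.
by apply: ler_wsqrtr; exact: (le_trans (ler_norm _) (bM z Gz)).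
Qed.

Lemma bm_limit (u : nat -> plane R -> R) (w : plane R -> R) (M : R) : (forall m, bm G (u m)) ->
  (forall m z, `|u m z| <= M) -> (forall z, G z -> u m z @[m --> \oo] --> w z) -> bm G w.
Proof.
move=> bu uM cu; split.
  by apply: (measurable_fun_cvg _ cu) => m; case: (bu m).
exists M => z Gz; apply: (cvgr_to_le (cvg_norm (cu z Gz))); near=> m; exact: uM.
Unshelve. all: by end_near. Qed.

Lemma bm_dot (u1 u2 v1 v2 : plane R -> R) : bm G u1 -> bm G u2 -> bm G v1 -> bm G v2 ->
  bm G (fun z => dot (u1 z, u2 z) (v1 z, v2 z)).
Proof. by move=> b1 b2 c1 c2; apply: bm_add; exact: bm_mul. Qed.
End bounded_vector_fields.

Lemma unit_norm_le1 (R : realType) (a b : R) : a ^+ 2 + b ^+ 2 <= 1 -> `|a| <= 1 /\ `|b| <= 1.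
Proof.
have H (x y : R) : x ^+ 2 + y ^+ 2 <= 1 -> `|x| <= 1.
  move=> h; rewrite -(@expr_le1 _ 2) // real_normK ?num_real //.
  by apply: le_trans h; rewrite lerDl sqr_ge0.
by move=> h; split; [exact: (H a b)|apply: (H b a); rewrite addrC].
Qed.

(** * An almost optimal field for [C] *)

Section lower_bound.
Context {R : realType}.
Local Notation E2 := (R * R)%type.
Local Notation E3 := (R * R * R)%type.
Local Notation mu2 := (@borel_leb2 R).
Variables (W Z : set E2) (G N : set (plane R)) (f : E2 -> R) (C : set E3) (chi : E3 -> R).
Variables (d L r : R).
Hypothesis oW : open W.
Hypothesis cf : forall z, W z -> {for z, continuous f}.
Hypothesis mG : measurable G.
Hypothesis fG : (mu2 G < +oo)%E.
Hypothesis mN : measurable N.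
Hypothesis N0 : mu2 N = 0%E.
Hypothesis GZ : G `<=` Z.
Hypothesis ZGN : Z `<=` G `|` N.
Hypothesis d0 : 0 < d.
Hypothesis L0 : 0 <= L.
Hypothesis lip_f : forall z w, Z z -> `|w - z| < d -> W w /\ `|f w - f z| <= L * `|w - z|.
Hypothesis df1 : forall z, G z -> derivable f z (1, 0).
Hypothesis df2 : forall z, G z -> derivable f z (0, 1).
Hypothesis mdf1 : measurable_fun G ('D_((1, 0) : E2) f).
Hypothesis mdf2 : measurable_fun G ('D_((0, 1) : E2) f).
Hypothesis Gr : forall z, G z -> `|z| <= r.
Hypothesis mC : lebesgue_measurable C.
Hypothesis C1chi : C1c chi.
Hypothesis chi01 : forall p, 0 <= chi p <= 1.
Hypothesis chi_supp : forall p, tsupport chi p -> Z p.1 /\ (C p <-> f p.1 <= p.2).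
Hypothesis fin_perimeter : perimeter C \is a fin_num.

Let v z : E2 := gradient f z + 2 *: perp z.
Hypothesis v_neq0 : forall z, G z -> v z != 0.

Let bm_v1 : bm G (fun z => (v z).1).
Proof.
have := bm_add (bm_partial1 GZ d0 L0 lip_f df1 mdf1) (bm_mul (bm_cst G (- 2)) (bm_snd Gr)).
congr bm; apply/funext => z.
by rewrite /v /gradient /perp /= /GRing.scale /=; ring.
Qed.

Let bm_v2 : bm G (fun z => (v z).2).
Proof.
have := bm_add (bm_partial2 GZ d0 L0 lip_f df2 mdf2) (bm_mul (bm_cst G 2) (bm_fst Gr)).
congr bm; apply/funext => z.
Qed.

Let bm_chi0 : bm G (fun z => chi (z, f z)).
Proof.
apply: (bm_on_graph oW cf GZ d0 lip_f (C1_continuous C1chi.1) (M := 1)) => // p.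
by have /andP[? ?] := chi01 p; rewrite ger0_norm.
Qed.

Lemma bm_dotv (u1 u2 : plane R -> R) : bm G u1 -> bm G u2 ->
  bm G (fun z => dot (u1 z, u2 z) (v z)).
Proof.
move=> b1 b2; have := bm_dot b1 b2 bm_v1 bm_v2.
by congr bm; apply/funext => z; rewrite /dot.
Qed.

Lemma bm_enormv : bm G (fun z => enorm (v z)).
Proof.
have := bm_enorm bm_v1 bm_v2; congr bm; apply/funext => z.
Qed.

Definition admissible_field (psi1 psi2 : E3 -> R) :=
  [/\ C1c psi1, C1c psi2 & forall p, psi1 p ^+ 2 + psi2 p ^+ 2 <= 1].

Lemma divergence_le_perimeter (A : set E3) psi1 psi2 : lebesgue_measurable A ->
  admissible_field psi1 psi2 -> perimeter A \is a fin_num ->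
  \int[leb3]_(p in A) (field_X psi1 p + field_Y psi2 p) <= fine (perimeter A).
Proof.
move=> mA [C1 C2 le1] fA; rewrite -lee_fin (fineK fA).
rewrite -(leb3_RintegralE mA (bbs_div C1 C2)).
by apply: ereal_sup_ubound; exists psi1, psi2.
Qed.

Variables (phi1 phi2 : E3 -> R).
Hypothesis adm_phi : admissible_field phi1 phi2.

Let div_phi := \int[leb3]_(p in C) (field_X phi1 p + field_Y phi2 p).
Let flux_phi := \int[mu2]_(z in G) (chi (z, f z) * dot (phi1 (z, f z), phi2 (z, f z)) (v z)).

Let bm_c1 (psi : E3 -> R) : C1c psi -> bm G (fun z => psi (z, f z)).
Proof.
move=> [Cp sp]; have [M bM] := compact_support_bounded sp (C1_continuous Cp) (@notin_tsupport _ _ psi).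
exact: (bm_on_graph oW cf GZ d0 lip_f (C1_continuous Cp) bM).
Qed.

(* Test the perimeter of [C] with [chi *: n + (1 - chi) *: phi]. *)
Lemma replaced_field_bound (n1 n2 : E3 -> R) : class_C 1 n1 -> class_C 1 n2 ->
  (forall p, n1 p ^+ 2 + n2 p ^+ 2 <= 1) ->
  div_phi + \int[mu2]_(z in G) (chi (z, f z) * dot (n1 (z, f z), n2 (z, f z)) (v z)) <=
  fine (perimeter C) + flux_phi.
Proof.
move=> Cn1 Cn2 n_le1; have [C1 C2 phi_le1] := adm_phi.
pose psi (n phi : E3 -> R) p := chi p * (n p - phi p).
have Cpsi n phi : class_C 1 n -> C1c phi -> C1c (psi n phi).
  by move=> Cn [Cp _]; apply: C1c_mull => //; exact: C1_sub.
have Cs1 := Cpsi _ _ Cn1 C1; have Cs2 := Cpsi _ _ Cn2 C2.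
have adm : admissible_field (fun p => phi1 p + psi n1 phi1 p) (fun p => phi2 p + psi n2 phi2 p).
  split; [exact: C1c_add..|] => p; rewrite /psi.
  have /andP[c0 c1] := chi01 p; have := n_le1 p; have := phi_le1 p.
  set a := phi1 p; set b := phi2 p; set k := n1 p; set l := n2 p; set x := chi p in c0 c1 *.
  move=> h1 h2.
  (* Convexity of the squared norm with its defect made explicit: the mixture of two vectors of the
     unit disc stays in the disc. *)
  have -> : (a + x * (k - a)) ^+ 2 + (b + x * (l - b)) ^+ 2 =
    (1 - x) * (a ^+ 2 + b ^+ 2) + x * (k ^+ 2 + l ^+ 2) -
    x * (1 - x) * ((k - a) ^+ 2 + (l - b) ^+ 2) by ring.
  have h3 : 0 <= x * (1 - x) * ((k - a) ^+ 2 + (l - b) ^+ 2).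
    by apply: mulr_ge0; [apply: mulr_ge0 => //; rewrite subr_ge0|rewrite addr_ge0 ?sqr_ge0].
  nra.
have := divergence_le_perimeter mC adm fin_perimeter.
have -> : \int[leb3]_(p in C) (field_X (fun p => phi1 p + psi n1 phi1 p) p +
    field_Y (fun p => phi2 p + psi n2 phi2 p) p) =
    div_phi + \int[leb3]_(p in C) (field_X (psi n1 phi1) p + field_Y (psi n2 phi2) p).
  rewrite /div_phi -leb3_RintegralD //; [|exact: bbs_div..].
  apply: eq_Rintegral => p _; rewrite field_XD ?field_YD; [ring|..].
  - exact: C2.1.
  - exact: Cs2.1.
  - exact: C1.1.
  - exact: Cs1.1.
have supp p : tsupport (psi n1 phi1) p \/ tsupport (psi n2 phi2) p -> Z p.1 /\ (C p <-> f p.1 <= p.2).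
  by move=> [/tsupport_mull|/tsupport_mull]; exact: chi_supp.
rewrite (divergence_formula oW cf mG fG mN N0 GZ ZGN d0 L0 lip_f mC df1 df2 mdf1 mdf2 Gr Cs1 Cs2 supp).
have bn (n : E3 -> R) : class_C 1 n -> (forall p, `|n p| <= 1) -> bm G (fun z => n (z, f z)).
  by move=> Cn n1'; exact: (bm_on_graph oW cf GZ d0 lip_f (C1_continuous Cn) n1').
have b1 p : `|n1 p| <= 1 by case: (unit_norm_le1 (n_le1 p)).
have b2 p : `|n2 p| <= 1 by case: (unit_norm_le1 (n_le1 p)).
have -> : \int[mu2]_(z in G) dot (psi n1 phi1 (z, f z), psi n2 phi2 (z, f z)) (v z) =
    \int[mu2]_(z in G) (chi (z, f z) * dot (n1 (z, f z), n2 (z, f z)) (v z)) - flux_phi.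
  rewrite /flux_phi -bm_RintegralB //; last first.
  - by apply: bm_mul => //; apply: bm_dotv; exact: bm_c1.
  - by apply: bm_mul => //; apply: bm_dotv; exact: bn.
  by apply: eq_Rintegral => z _; rewrite /dot /psi /=; ring.
by rewrite addrA lerBlDr.
Qed.

Let bound (u1 u2 : plane R -> R) :=
  div_phi + \int[mu2]_(z in G) (chi (z, f z) * dot (u1 z, u2 z) (v z)) <=
  fine (perimeter C) + flux_phi.

Lemma bound_limit (u1 u2 : nat -> plane R -> R) (w1 w2 : plane R -> R) :
  (forall m, bm G (u1 m)) -> (forall m, bm G (u2 m)) ->
  (forall m z, u1 m z ^+ 2 + u2 m z ^+ 2 <= 1) ->
  (forall z, G z -> u1 m z @[m --> \oo] --> w1 z) ->
  (forall z, G z -> u2 m z @[m --> \oo] --> w2 z) ->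
  (forall m, bound (u1 m) (u2 m)) -> bound w1 w2.
Proof.
move=> b1 b2 le1 c1 c2 H.
have [_ [V bV]] := bm_enormv.
have cv : \int[mu2]_(z in G) (chi (z, f z) * dot (u1 m z, u2 m z) (v z)) @[m --> \oo] -->
    \int[mu2]_(z in G) (chi (z, f z) * dot (w1 z, w2 z) (v z)).
  apply: (bounded_cvg_Rintegral (M := V)) => //.
  - by move=> m; have [] : bm G (fun z => chi (z, f z) * dot (u1 m z, u2 m z) (v z))
      by apply: bm_mul => //; exact: bm_dotv.
  - move=> m z Gz; rewrite normrM -[leRHS]mul1r; apply: ler_pM => //.
      by have /andP[? ?] := chi01 (z, f z); rewrite ger0_norm.
    apply: (@le_trans _ _ (enorm (v z))); last by have := bV z Gz; rewrite (ger0_norm (enorm_ge0 _)).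
    rewrite ler_norml; apply/andP; split; last by apply: dot_le_enorm; exact: le1.
    have := @dot_le_enorm _ (- u1 m z, - u2 m z) (v z).
    by rewrite /= !sqrrN => /(_ (le1 m z)); rewrite /dot /=; lra.
  - move=> z Gz; apply: cvgM; first exact: cvg_cst.
    by apply: cvgD; (apply: cvgM; last exact: cvg_cst); [exact: c1|exact: c2].
rewrite /bound -lerBrDl; apply: (cvgr_to_le cv); near=> m.
by rewrite lerBrDl; exact: H.
Unshelve. all: by end_near. Qed.

(** The factor d / 2 keeps the shifted points z + delta n e within distance [d] of [Z], hence inside
    [W], where f is continuous. *)
Let delta n : R := d / 2 * n.+1%:R^-1.
Let w1 n (z : E2) : R := (delta n)^-1 * (f (z + delta n *: (1, 0)) - f z) - 2 * z.2.
Let w2 n (z : E2) : R := (delta n)^-1 * (f (z + delta n *: (0, 1)) - f z) + 2 * z.1.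
Let w n z : E2 := (w1 n z, w2 n z).
(** A strictly positive substitute for |w|: the quotient w / q is defined, continuous over [G] and
    of norm at most 1 even where [w n] vanishes. *)
Let q n z : R := enorm (w n z) + n.+1%:R^-1.

Let delta0 n : 0 < delta n.
Proof. by rewrite mulr_gt0 ?divr_gt0 // invr_gt0. Qed.

Let deltad n : delta n < d.
Proof.
apply: (@le_lt_trans _ _ (d / 2)); last by rewrite ltr_pdivrMr // ltr_pMr // ltr1n.
by rewrite ler_piMr ?(ltW (divr_gt0 d0 _)) // invf_le1 // ler1n.
Qed.

Let q0 n z : 0 < q n z.
Proof. by rewrite ltr_wpDl ?enorm_ge0 // invr_gt0. Qed.

Let ZW z : Z z -> W z.
Proof. by move=> Zz; have [] := lip_f Zz (w := z); rewrite ?subrr ?normr0. Qed.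

Let cw n z : G z -> {for z, continuous (w1 n)} /\ {for z, continuous (w2 n)}.
Proof.
move=> /GZ Zz; have cfz := cf (ZW Zz).
have ce (e : E2) : `|e| <= 1 -> {for z, continuous (fun y : E2 => f (y + delta n *: e))}.
  move=> e1; apply: (@continuous_comp _ _ _ (fun y : E2 => y + delta n *: e) f).
    exact: continuous_translation.
  have [] := lip_f Zz (w := z + delta n *: e) => [|? _]; last exact: cf.
  rewrite addrAC subrr add0r normrZ gtr0_norm //; apply: le_lt_trans (deltad n).
  by rewrite ler_piMr // ltW.
have e1 : `|((1, 0) : E2)| <= 1 by rewrite prod_normE /= normr1 normr0 ge_max lexx ler01.
have e2 : `|((0, 1) : E2)| <= 1 by rewrite prod_normE /= normr1 normr0 ge_max lexx ler01.
split; [apply: cvgB|apply: cvgD]; apply: cvgM; try exact: cvg_cst.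
- by apply: cvgB => //; exact: ce.
- exact: cont_snd.
- by apply: cvgB => //; exact: ce.
- exact: cont_fst.
Qed.

Let cq n z : G z -> {for z, continuous (q n)}.
Proof.
move=> /(cw n)[c1 c2]; apply: cvgD; last exact: cvg_cst.
apply: (@continuous_comp _ _ _ (fun z => dot (w n z) (w n z)) Num.sqrt); last exact: sqrt_continuous.
by apply: cvgD; apply: cvgM.
Qed.

Let wcvg z : G z -> w1 n z @[n --> \oo] --> (v z).1 /\ w2 n z @[n --> \oo] --> (v z).2.
Proof.
move=> Gz; have dc : delta @ \oo --> (0 : R).
  by rewrite -(mulr0 (d / 2)); apply: cvgM; [exact: cvg_cst|exact: cvg_harmonic].
have dn n : delta n != 0 by rewrite gt_eqF.
have H1 := derive_seq_cvg (df1 Gz) dc dn; have H2 := derive_seq_cvg (df2 Gz) dc dn.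
split.
  have -> : (v z).1 = 'D_((1, 0) : E2) f z - 2 * z.2.
    by rewrite /v /gradient /perp /= /GRing.scale /=; ring.
  exact: (cvgB H1 (cvg_cst _)).
have -> : (v z).2 = 'D_((0, 1) : E2) f z + 2 * z.1.
  by rewrite /v /gradient /perp /= /GRing.scale /=; ring.
exact: (cvgD H2 (cvg_cst _)).
Qed.

Let qcvg z : G z -> q n z @[n --> \oo] --> enorm (v z).
Proof.
move=> /wcvg[c1 c2]; rewrite -[enorm (v z)]addr0; apply: cvgD; last exact: cvg_harmonic.
have : dot (w n z) (w n z) @[n --> \oo] --> dot (v z) (v z) by apply: cvgD; apply: cvgM.
by move=> /(cvg_comp _ _); apply; exact: sqrt_continuous.
Qed.

Let unit_w n z : (w1 n z / q n z) ^+ 2 + (w2 n z / q n z) ^+ 2 <= 1.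
Proof.
rewrite !exprMn -mulrDl exprVn ler_pdivrMr ?exprn_gt0 // mul1r.
have -> : w1 n z ^+ 2 + w2 n z ^+ 2 = enorm (w n z) ^+ 2 by rewrite sqr_enorm /dot !expr2.
by rewrite lerXn2r ?nnegrE ?enorm_ge0 ?(ltW (q0 n z)) // lerDl invr_ge0.
Qed.

(* [v / |v|] need not be continuous: stage 1 reaches the continuous difference
   quotients [w n / q n] by [quasi_interpolant], stage 2 lets their step go to 0. *)
Lemma lower_bound : div_phi + \int[mu2]_(z in G) (chi (z, f z) * enorm (v z)) <=
  fine (perimeter C) + flux_phi.
Proof.
have stage1 n : [/\ bm G (fun z => w1 n z / q n z), bm G (fun z => w2 n z / q n z) &
    bound (fun z => w1 n z / q n z) (fun z => w2 n z / q n z)].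
  pose n1 := quasi_interpolant (fun z => w1 n z / q n z).
  pose n2 := quasi_interpolant (fun z => w2 n z / q n z).
  have le1 m p : n1 m p ^+ 2 + n2 m p ^+ 2 <= 1.
    by apply: quasi_interpolant_unit => z; exact: unit_w.
  have ab m p : `|n1 m p| <= 1 /\ `|n2 m p| <= 1.
    by apply: unit_norm_le1; exact: le1.
  have b1 m : bm G (fun z => n1 m (z, f z)).
    apply: (bm_on_graph oW cf GZ d0 lip_f _ (M := 1)); last by move=> p; case: (ab m p).
    exact: (C1_continuous (C1_quasi_interpolant _ m)).
  have b2 m : bm G (fun z => n2 m (z, f z)).
    apply: (bm_on_graph oW cf GZ d0 lip_f _ (M := 1)); last by move=> p; case: (ab m p).
    exact: (C1_continuous (C1_quasi_interpolant _ m)).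
  have l1 z : G z -> n1 m (z, f z) @[m --> \oo] --> w1 n z / q n z.
    move=> Gz; apply: quasi_interpolant_cvg; have [c1 _] := cw n Gz.
    by apply: cvgM => //; apply: cvgV; [rewrite gt_eqF|exact: cq].
  have l2 z : G z -> n2 m (z, f z) @[m --> \oo] --> w2 n z / q n z.
    move=> Gz; apply: quasi_interpolant_cvg; have [_ c2] := cw n Gz.
    by apply: cvgM => //; apply: cvgV; [rewrite gt_eqF|exact: cq].
  split.
  - by apply: (bm_limit b1 (M := 1) _ l1) => m z; case: (ab m (z, f z)).
  - by apply: (bm_limit b2 (M := 1) _ l2) => m z; case: (ab m (z, f z)).
  - apply: (bound_limit b1 b2 _ l1 l2) => [m z|m]; first exact: le1.
    by apply: replaced_field_bound => //; exact: C1_quasi_interpolant.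
have : bound (fun z => (v z).1 / enorm (v z)) (fun z => (v z).2 / enorm (v z)).
  apply: (@bound_limit (fun n z => w1 n z / q n z) (fun n z => w2 n z / q n z)) => //.
  - by move=> n; case: (stage1 n).
  - by move=> n; case: (stage1 n).
  - move=> z Gz; have [c1 _] := wcvg Gz; apply: cvgM => //; apply: cvgV; last exact: qcvg.
    by rewrite gt_eqF // enorm_gt0 // v_neq0.
  - move=> z Gz; have [_ c2] := wcvg Gz; apply: cvgM => //; apply: cvgV; last exact: qcvg.
    by rewrite gt_eqF // enorm_gt0 // v_neq0.
  - by move=> n; case: (stage1 n).
rewrite /bound; congr (_ + _ <= _); apply: eq_Rintegral => z; rewrite inE => Gz; congr (_ * _).
have e0 : enorm (v z) != 0 by rewrite gt_eqF // enorm_gt0 // v_neq0.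
rewrite {1}/dot /= mulrAC [X in _ + X]mulrAC -mulrDl.
by rewrite -/(dot (v z) (v z)) -sqr_enorm expr2 mulfK.
Qed.
End lower_bound.

(** In [perimeter_variation], [a] and [t] are the fluxes of the cut-off field through the old and
    the new graph, [b] is the contribution away from the graph, [c] the integral of chi |v|, [p] the
    perimeter of C and [w] its increment. *)
Lemma add_le_cancel (R : realDomainType) (a b c t p w : R) :
  a + b + c <= p + a -> t <= c + w -> t + b <= p + w.
Proof. by lra. Qed.

Section upper_bound.
Context {R : realType}.
Local Notation E2 := (R * R)%type.
Local Notation E3 := (R * R * R)%type.
Local Notation mu2 := (@borel_leb2 R).
Variables (W Z : set E2) (G N : set (plane R)) (f : E2 -> R) (C : set E3) (chi : E3 -> R).
Variables (d L r : R).
Hypothesis oW : open W.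
Hypothesis cf : forall z, W z -> {for z, continuous f}.
Hypothesis mG : measurable G.
Hypothesis fG : (mu2 G < +oo)%E.
Hypothesis mN : measurable N.
Hypothesis N0 : mu2 N = 0%E.
Hypothesis GZ : G `<=` Z.
Hypothesis ZGN : Z `<=` G `|` N.
Hypothesis d0 : 0 < d.
Hypothesis L0 : 0 <= L.
Hypothesis lip_f : forall z w, Z z -> `|w - z| < d -> W w /\ `|f w - f z| <= L * `|w - z|.
Hypothesis df1 : forall z, G z -> derivable f z (1, 0).
Hypothesis df2 : forall z, G z -> derivable f z (0, 1).
Hypothesis mdf1 : measurable_fun G ('D_((1, 0) : E2) f).
Hypothesis mdf2 : measurable_fun G ('D_((0, 1) : E2) f).
Hypothesis Gr : forall z, G z -> `|z| <= r.
Hypothesis mC : lebesgue_measurable C.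
Hypothesis C1chi : C1c chi.
Hypothesis chi01 : forall p, 0 <= chi p <= 1.
Hypothesis chi_supp : forall p, tsupport chi p -> Z p.1 /\ (C p <-> f p.1 <= p.2).
Hypothesis fin_perimeter : perimeter C \is a fin_num.
Hypothesis v_neq0 : forall z, G z -> gradient f z + 2 *: perp z != 0.
Variables (phi : E2 -> R) (eps : R) (A : set E3).
Hypothesis Cphi : class_C 1 phi.
Hypothesis supp_phi : compact (tsupport phi).
Let h z := f z + eps * phi z.
Hypothesis mA : lebesgue_measurable A.
Hypothesis chi_suppA : forall p, tsupport chi p -> (A p <-> h p.1 <= p.2).
Hypothesis sameCA : forall p, ~ (\forall q \near p, chi q = 1) -> (C p <-> A p).
Hypothesis chi_eq1 : forall z, tsupport phi z -> chi (z, f z) = 1 /\ chi (z, h z) = 1.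

Let v z : E2 := gradient f z + 2 *: perp z.
Let vh z : E2 := v z + eps *: gradient phi z.

Lemma derivable_perturbation (e : E2) z : derivable f z e -> derivable h z e.
Proof.
move=> dz; have dp : derivable phi z e by exact: C1_derivable.
have dZ : derivable (eps \*: phi) z e := derivableZ dp.
have -> : h = f + (eps \*: phi) by [].
exact: (derivableD dz dZ).
Qed.

Lemma derive_perturbation (e : E2) z : derivable f z e -> 'D_e h z = 'D_e f z + eps * 'D_e phi z.
Proof.
move=> dz; have dp : derivable phi z e by exact: C1_derivable.
have dZ : derivable (eps \*: phi) z e := derivableZ dp.
have -> : h = f + (eps \*: phi) by [].
by rewrite (deriveD dz dZ) (deriveZ eps dp).
Qed.

Lemma gradient_perturbation z : G z -> gradient h z + 2 *: perp z = vh z.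
Proof.
move=> Gz; rewrite /vh /v /gradient (derive_perturbation (df1 Gz)) (derive_perturbation (df2 Gz)).
by rewrite [LHS]surjective_pairing [RHS]surjective_pairing; congr (_, _); rewrite /= /GRing.scale /=; ring.
Qed.

Let ch z : W z -> {for z, continuous h}.
Proof.
move=> Wz; apply: cvgD; first exact: cf.
by apply: cvgM; [exact: cvg_cst|exact: C1_continuous].
Qed.

Let lip_h : exists2 L', 0 <= L' & forall z w, Z z -> `|w - z| < d -> W w /\ `|h w - h z| <= L' * `|w - z|.
Proof.
have [Lp Lp0 Hp] := C1_compact_lipschitz2 Cphi supp_phi.
exists (L + `|eps| * Lp) => [|z w Zz wd]; first by rewrite addr_ge0 ?mulr_ge0.
have [Ww fw] := lip_f Zz wd; split=> //.
have -> : h w - h z = (f w - f z) + eps * (phi w - phi z) by rewrite /h; ring.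
apply: (le_trans (ler_normD _ _)); rewrite mulrDl; apply: lerD => //.
by rewrite normrM -mulrA ler_wpM2l.
Qed.

Let mdh (e : E2) : (forall z, G z -> derivable f z e) -> measurable_fun G ('D_e f) ->
  measurable_fun G ('D_e h).
Proof.
move=> de me; apply: (eq_measurable_fun (fun z => 'D_e f z + eps * 'D_e phi z)).
  by move=> z; rewrite inE => Gz; rewrite derive_perturbation //; exact: de.
have mphi : measurable_fun G ('D_e phi).
  apply: measurable_funTS; apply: continuous_measurable_fun2; first exact: openT.
  by move=> z _; have [_ ] := Cphi; apply.
by apply: measurable_funD => //; apply: measurable_funM => //; exact: measurable_cst.
Qed.

(** Near the perturbed graph any admissible field is bounded by Cauchy-Schwarz. Only [C] requires an
    almost optimal field, and [lower_bound] supplies it with the same competitor away from the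
    graph. *)
Lemma perimeter_variation :
  (perimeter A <= (fine (perimeter C) +
    \int[mu2]_(z in G) (enorm (vh z) - enorm (v z)))%:E)%E.
Proof.
have [L' L'0 lh] := lip_h.
have dh1 z : G z -> derivable h z (1, 0) by move=> /df1; exact: derivable_perturbation.
have dh2 z : G z -> derivable h z (0, 1) by move=> /df2; exact: derivable_perturbation.
have mdh1 := mdh df1 mdf1; have mdh2 := mdh df2 mdf2.
apply: ge_ereal_sup => _ [phi1 [phi2 [C1 C2 phi_le1 ->]]].
rewrite (leb3_RintegralE mA (bbs_div C1 C2)) lee_fin.
have adm : admissible_field phi1 phi2 by split.
have LB := lower_bound oW cf mG fG mN N0 GZ ZGN d0 L0 lip_f df1 df2 mdf1 mdf2 Gr mC C1chi chi01
  chi_supp fin_perimeter v_neq0 adm.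
pose nchi p := 1 - chi p.
have Cn : class_C 1 nchi by apply: C1_sub; [exact: C1_cst|exact: C1chi.1].
have Cc (ps : E3 -> R) : C1c ps -> C1c (fun p => chi p * ps p) by move=> Cp; apply: C1c_mulr => //; exact: C1chi.1.
have Cnc (ps : E3 -> R) : C1c ps -> C1c (fun p => nchi p * ps p) by exact: C1c_mulr.
have Cc1 := Cc _ C1; have Cc2 := Cc _ C2; have Cn1 := Cnc _ C1; have Cn2 := Cnc _ C2.
have split_div B : lebesgue_measurable B -> \int[leb3]_(p in B) (field_X phi1 p + field_Y phi2 p) =
    \int[leb3]_(p in B) (field_X (fun p => chi p * phi1 p) p + field_Y (fun p => chi p * phi2 p) p) +
    \int[leb3]_(p in B) (field_X (fun p => nchi p * phi1 p) p + field_Y (fun p => nchi p * phi2 p) p).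
  move=> mB; rewrite -leb3_RintegralD //; [|exact: bbs_div..].
  apply: eq_Rintegral => p _.
  have E (ps : E3 -> R) : ps = (fun p => chi p * ps p + nchi p * ps p).
    by apply/funext => q; rewrite /nchi; ring.
  rewrite {1}(E phi1) {1}(E phi2) field_XD ?field_YD; [ring|..].
  - exact: Cc2.1.
  - exact: Cn2.1.
  - exact: Cc1.1.
  - exact: Cn1.1.
have suppC p : tsupport (fun p => chi p * phi1 p) p \/ tsupport (fun p => chi p * phi2 p) p ->
    Z p.1 /\ (C p <-> f p.1 <= p.2).
  by move=> [/tsupport_mull|/tsupport_mull]; exact: chi_supp.
have suppA p : tsupport (fun p => chi p * phi1 p) p \/ tsupport (fun p => chi p * phi2 p) p ->
    Z p.1 /\ (A p <-> h p.1 <= p.2).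
  by move=> [/tsupport_mull|/tsupport_mull] H; (split; [exact: (chi_supp H).1|exact: chi_suppA]).
have FC := divergence_formula oW cf mG fG mN N0 GZ ZGN d0 L0 lip_f mC df1 df2 mdf1 mdf2 Gr Cc1 Cc2 suppC.
have FA := divergence_formula oW ch mG fG mN N0 GZ ZGN d0 L'0 lh mA dh1 dh2 mdh1 mdh2 Gr Cc1 Cc2 suppA.
(* Where chi is 1 nearby, the fields cut off by 1 - chi have zero derivatives; at all other points
   [A] and [C] agree. *)
have rest : \int[leb3]_(p in A) (field_X (fun p => nchi p * phi1 p) p + field_Y (fun p => nchi p * phi2 p) p) =
    \int[leb3]_(p in C) (field_X (fun p => nchi p * phi1 p) p + field_Y (fun p => nchi p * phi2 p) p).
  apply/esym; apply: leb3_eq_domain => p /eqP nz; apply: sameCA => near1; apply: nz.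
  have z0 (ps : E3 -> R) (e : E3) : 'D_e (fun p => nchi p * ps p) p = 0.
    by apply: derive_near0; apply: filterS near1 => q q1; rewrite /nchi q1 subrr mul0r.
  by rewrite /field_X /field_Y !z0; ring.
have bf1 := bm_partial1 GZ d0 L0 lip_f df1 mdf1; have bf2 := bm_partial2 GZ d0 L0 lip_f df2 mdf2.
have bh1 := bm_partial1 GZ d0 L'0 lh dh1 mdh1; have bh2 := bm_partial2 GZ d0 L'0 lh dh2 mdh2.
have bx := bm_fst Gr; have by_ := bm_snd Gr.
have perpE (k : E2 -> R) z : gradient k z + 2 *: perp z =
    ('D_((1, 0) : E2) k z - 2 * z.2, 'D_((0, 1) : E2) k z + 2 * z.1).
  by rewrite /gradient /perp [LHS]surjective_pairing; congr (_, _); rewrite /= /GRing.scale /=; ring.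
have bgrad (k : E2 -> R) : bm G ('D_((1, 0) : E2) k) -> bm G ('D_((0, 1) : E2) k) ->
    bm G (fun z => 'D_((1, 0) : E2) k z - 2 * z.2) /\ bm G (fun z => 'D_((0, 1) : E2) k z + 2 * z.1).
  move=> k1 k2; split.
    by apply: (bm_sub k1); apply: (bm_mul (bm_cst _ 2)).
  by apply: (bm_add k2); apply: (bm_mul (bm_cst _ 2)).
have [gf1 gf2] := bgrad f bf1 bf2; have [gh1 gh2] := bgrad h bh1 bh2.
have onG (ps : E3 -> R) : C1c ps -> bm G (fun z => ps (z, f z)) /\ bm G (fun z => ps (z, h z)).
  move=> [Cp sp]; have [M bM] := compact_support_bounded sp (C1_continuous Cp) (@notin_tsupport _ _ ps).
  split; first exact: (bm_on_graph oW cf GZ d0 lip_f (C1_continuous Cp) bM).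
  exact: (bm_on_graph oW ch GZ d0 lh (C1_continuous Cp) bM).
have [c0 ch'] := onG _ C1chi.
have [_ k1] := onG _ Cc1; have [_ k2] := onG _ Cc2.
have ev : bm G (fun z => enorm (v z)).
  by have := bm_enorm gf1 gf2; congr bm; apply/funext => z; rewrite -perpE.
have evh : bm G (fun z => enorm (gradient h z + 2 *: perp z)).
  by have := bm_enorm gh1 gh2; congr bm; apply/funext => z; rewrite -perpE.
have evh' : \int[mu2]_(z in G) (enorm (vh z) - enorm (v z)) =
    \int[mu2]_(z in G) (enorm (gradient h z + 2 *: perp z) - enorm (v z)).
  by apply: eq_Rintegral => z; rewrite inE => Gz; rewrite gradient_perturbation.
have bTA : bm G (fun z => dot (chi (z, h z) * phi1 (z, h z), chi (z, h z) * phi2 (z, h z))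
    (gradient h z + 2 *: perp z)).
  by have := bm_dot k1 k2 gh1 gh2; congr bm; apply/funext => z; rewrite -perpE.
have fluxE : \int[mu2]_(z in G) (chi (z, f z) * dot (phi1 (z, f z), phi2 (z, f z)) (v z)) =
    \int[mu2]_(z in G) dot (chi (z, f z) * phi1 (z, f z), chi (z, f z) * phi2 (z, f z)) (v z).
  by apply: eq_Rintegral => z _; rewrite /dot /=; ring.
have bdiff := bm_sub evh ev; have bc := bm_mul c0 ev.
have TA : \int[mu2]_(z in G) dot (chi (z, h z) * phi1 (z, h z), chi (z, h z) * phi2 (z, h z))
    (gradient h z + 2 *: perp z) <=
    \int[mu2]_(z in G) (chi (z, f z) * enorm (v z)) + \int[mu2]_(z in G) (enorm (vh z) - enorm (v z)).
  rewrite evh' -(bm_RintegralD mG fG bc bdiff); apply: bm_le => //; first exact: bm_add.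
  move=> z Gz.
  have le_e (a : R) (y : E2) t : 0 <= a ->
      dot (a * phi1 (z, t), a * phi2 (z, t)) y <= a * enorm y.
    move=> a0; rewrite (_ : dot _ _ = a * dot (phi1 (z, t), phi2 (z, t)) y); last by rewrite /dot /=; ring.
    by apply: ler_wpM2l => //; apply: dot_le_enorm; exact: phi_le1.
  (* Over the support of phi, chi is 1 at both heights, so the two |v| terms on the right cancel.
     Elsewhere h and its gradient coincide with those of f, and the increment is 0. *)
  have [sz|nz] := pselect (tsupport phi z).
    have [e0 eh] := chi_eq1 sz; rewrite e0 eh.
    have := le_e 1 (gradient h z + 2 *: perp z) (h z) ler01; rewrite !mul1r.
    by move=> le1; apply: (le_trans le1); rewrite addrCA subrr addr0.
  have hz : h z = f z by rewrite /h (notin_tsupport nz) mulr0 addr0.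
  have gz : gradient h z + 2 *: perp z = v z.
    rewrite gradient_perturbation // /vh /gradient !(derive_out_tsupport _ nz).
    by rewrite (_ : (0, 0) = 0 :> E2) // scaler0 addr0.
  rewrite gz hz subrr addr0; apply: le_e.
  by case/andP: (chi01 (z, f z)).
rewrite (split_div A mA) rest FA.
move: LB; rewrite (split_div C mC) FC fluxE => LB.
exact: (add_le_cancel LB TA).
Qed.
End upper_bound.

(** * Perturbed regions *)

Section slab.
Context {R : realType}.
Local Notation E2 := (R * R)%type.
Local Notation E3 := (R * R * R)%type.
Local Notation mu2 := (@borel_leb2 R).
Local Notation mu3 := (@borel_leb3 R).

Lemma compact_measurable2 (K : set E2) : compact K -> measurable (K : set (plane R)).
Proof.
move=> cK; rewrite -[K]setCK; apply: measurableC; apply: open_measurable2.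
by apply: closed_openC; apply: compact_closed => //; exact: norm_hausdorff.
Qed.

Lemma compact_measurable3 (K : set E3) : compact K -> measurable (K : set (space R)).
Proof.
move=> cK; rewrite -[K]setCK; apply: measurableC; apply: open_measurable3.
by apply: closed_openC; apply: compact_closed => //; exact: norm_hausdorff.
Qed.

Lemma compact_bounded_norm (V : normedModType R) (K : set V) : compact K ->
  exists r : R, forall z, K z -> `|z| <= r.
Proof.
move=> /compact_bounded[M [_ bM]]; exists (M + 1) => z Kz.
by apply: (bM (M + 1)) => //; rewrite ltrDl.
Qed.

Lemma bounded_borel_leb2 (K : set E2) (r : R) : measurable (K : set (plane R)) ->
  (forall z, K z -> `|z| <= r) -> (mu2 K < +oo)%E.
Proof.
move=> mK Kr.
have mI : measurable (`[(- r), r]%classic : set (measurableTypeR R)) by exact: measurable_itv.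
have mB : measurable (`[(- r), r]%classic `*` `[(- r), r]%classic : set (plane R)) by exact: measurableX.
apply: (@le_lt_trans _ _ (mu2 (`[(- r), r]%classic `*` `[(- r), r]%classic))).
  apply: le_measure; rewrite ?inE // => -[x y] /Kr.
  rewrite prod_normE /= ge_max => /andP[]; rewrite !ler_norml => hx hy.
  by split=> /=; rewrite in_itv.
rewrite [ltLHS](@product_measure1E _ _ (measurableTypeR R) (measurableTypeR R) R lebesgue_measure lebesgue_measure) //.
have lt (a b : R) : (@lebesgue_measure R [set` `[a, b]] < +oo)%E.
  by rewrite lebesgue_measure_itv /=; case: ifP => _; rewrite ?ltry.
by rewrite lte_mul_pinfty ?ge0_fin_numE //; exact: lt.
Qed.

Lemma compact_gap (K : set E2) (f g : E2 -> R) : compact K ->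
  (forall z, K z -> {for z, continuous f}) -> (forall z, K z -> {for z, continuous g}) ->
  (forall z, K z -> f z < g z) -> exists2 c : R, 0 < c & forall z, K z -> f z + c < g z.
Proof.
move=> cK cf cg fg.
have : compact ((fun z => g z - f z) @` K).
  apply: continuous_compact => //; apply: continuous_in_subspaceT => z; rewrite inE => Kz.
  by apply: cvgB; [exact: cg|exact: cf].
move=> /(compact_closed (@norm_hausdorff _ _)); rewrite closedE => cl.
have : ~ (\forall x \near (0 : R), ((fun z => g z - f z) @` K) x -> False) -> False.
  move=> N.
  have [] : ((fun z => g z - f z) @` K) 0.
    by apply: cl => N'; apply: N; apply: filterS N'.
  by move=> z Kz gf; have := fg _ Kz; rewrite -subr_gt0 gf ltxx.
move=> /contrapT /nbhs_ballP[e /= e0 eN]; exists (e / 2) => [|z Kz]; first by rewrite divr_gt0.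
rewrite ltNge; apply/negP => ge; apply: (eN (g z - f z)); last by exists z.
rewrite /ball /= sub0r normrN gtr0_norm ?subr_gt0 ?fg //; lra.
Qed.

Lemma borel_leb3_slab (K : set E2) (a b : E2 -> R) :
  measurable (K : set (plane R)) -> (forall z, K z -> a z <= b z) ->
  mu3 [set p | K p.1 /\ a p.1 <= p.2 <= b p.1] = (\int[mu2]_(z in K) (b z - a z)%:E)%E.
Proof.
move=> mK ab; rewrite [RHS]integral_mkcond; set S := [set p | _].
change (\int[mu2]_z (@lebesgue_measure R (xsection S z)) =
  \int[mu2]_z ((fun z : plane R => (b z - a z)%:E) \_ K) z)%E; rewrite /S.
apply: (@eq_integral _ (plane R) R mu2) => z _ /=; rewrite patchE.
case: ifPn => [|/negP] Kz; last first.
  rewrite (_ : xsection _ z = set0) ?measure0 //.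
  by apply/seteqP; split => // t; rewrite /xsection /= inE /= => -[/mem_set].
rewrite (_ : xsection _ z = `[a z, b z]%classic).
  rewrite lebesgue_measure_itv /= lte_fin; case: ltP => // ba.
  suff -> : b z = a z by rewrite subrr.
  by apply/eqP; rewrite eq_le ba ab //; exact: set_mem.
apply/seteqP; split => t; rewrite /xsection /= inE /= in_itv /=; first by case.
by split=> //; exact: set_mem.
Qed.

Lemma integral_ae_domain (A B N : set (plane R)) (F : plane R -> \bar R) :
  measurable A -> measurable B -> measurable N -> mu2 N = 0%E ->
  measurable_fun A F -> measurable_fun B F ->
  (forall z, ~ N z -> F z <> 0%E -> (A z <-> B z)) ->
  (\int[mu2]_(z in A) F z = \int[mu2]_(z in B) F z)%E.
Proof.
move=> mA mB mN N0 mFA mFB AB.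
rewrite [LHS]integral_mkcond [RHS]integral_mkcond; apply: ae_eq_integral => //.
- by apply/(measurable_restrictT F mA).
- by apply/(measurable_restrictT F mB).
- exists N; split=> // z /= nz; apply: contrapT => nN; apply: nz => _.
  rewrite !patchE; have [Fz|Fz] := pselect (F z = 0%E).
    by rewrite Fz !if_same.
  have := AB z nN Fz => E.
  suff -> : (z \in A) = (z \in B) by [].
  by apply/idP/idP; rewrite !inE => /E.
Qed.
End slab.

Section variation.
Context {R : realType}.
Local Notation E2 := (R * R)%type.
Local Notation E3 := (R * R * R)%type.
Local Notation mu2 := (@borel_leb2 R).
Local Notation mu3 := (@borel_leb3 R).
Variables (D : set E2) (f g : E2 -> R) (phi : E2 -> R).
Hypothesis cf : convex_function D f.
Hypothesis cg : convex_function D (fun z => - g z).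
Hypothesis fg : forall z, D z -> f z <= g z.
Let C := region D f g.
Let U := D^° `\` Sigma C D f.
Let K := tsupport phi.
Hypothesis mC : lebesgue_measurable C.
Hypothesis Cphi : class_C 1 phi.
Hypothesis cK : compact K.
Hypothesis KU : K `<=` U.

Let contf z : D^° z -> {for z, continuous f}.
Proof. exact: convex_continuous. Qed.

Let contg z : D^° z -> {for z, continuous g}.
Proof.
move=> Dz; have -> : g = (fun z => - - g z) by apply/funext => w; rewrite opprK.
exact: cvgN (convex_continuous cg Dz).
Qed.

Let KD : K `<=` D^°.
Proof. by move=> z /KU[]. Qed.

(** On this open set [C] is just the epigraph of f: the upper graph and the lateral boundary are out
    of reach. The cut-off will be supported here. *)
Lemma open_below_ceiling : open [set p : E3 | U p.1 /\ p.2 < g p.1].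
Proof.
have oU : open U by exact: open_not_Sigma.
rewrite openE => p [Up gp]; have cgp := contg Up.1.
have lim : (fun q : E3 => q.2 - g q.1) q @[q --> p] --> p.2 - g p.1.
  by apply: cvgB; [exact: cont_snd|exact: (@continuous_comp _ _ _ (@fst E2 R) g _ (cont_fst (x := p)))].
have l0 : p.2 - g p.1 < 0 by rewrite subr_lt0.
rewrite /interior; near=> q; split.
  near: q; have oUf : open [set q : E3 | U q.1] by exact: (open_comp (fun q _ => cont_fst (x := q)) oU).
  exact: (open_nbhs_nbhs (conj oUf Up)).
rewrite -subr_lt0; near: q; exact: (cvgr_lt _ lim).
Unshelve. all: by end_near. Qed.

Variable c : R.
Hypothesis c_gt0 : 0 < c.
Hypothesis c_gap : forall z, K z -> f z + c < g z.
(** This collar contains the graphs over [K] of all perturbations with |eps phi| <= c, so one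
    cut-off equal to 1 near it serves every such eps. *)
Let E := [set p : E3 | K p.1 /\ f p.1 - c <= p.2 <= f p.1 + c].

Lemma compact_collar : compact E.
Proof.
have -> : E = (fun q : E3 => (q.1, f q.1 + q.2)) @` (K `*` `[- c, c]%classic).
  apply/seteqP; split => [[z t] [/= Kz /andP[h1 h2]]|_ [[z s] [/= Kz] + <-]].
    exists (z, t - f z) => /=; last by rewrite addrC subrK.
    by split=> //=; rewrite in_itv /=; apply/andP; split; lra.
  by rewrite in_itv /= => /andP[h1 h2]; split=> //=; apply/andP; split; lra.
apply: continuous_compact; last by apply: compact_setX => //; exact: segment_compact.
apply: continuous_in_subspaceT => q; rewrite inE => -[Kq _].
have c1 := @continuous_comp _ _ _ (@fst E2 R) f q (cont_fst (x := q)) (contf (KD Kq)).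
exact: (cvg_pair (cont_fst (x := q)) (cvgD c1 (cont_snd (x := q)))).
Qed.

Lemma collar_below_ceiling : E `<=` [set p : E3 | U p.1 /\ p.2 < g p.1].
Proof.
move=> p [Kp /andP[_ h]]; split; first exact: KU.
by apply: (le_lt_trans h); exact: c_gap.
Qed.

Section perturbed_region.
Variable (eps : R).
Hypothesis eps_small : forall z, `|eps * phi z| <= c.
Let h z := f z + eps * phi z.
Let A := region D h g.

Lemma perturbed_region_out p : ~ E p -> (C p <-> A p).
Proof.
move=> nE; have [Kp|nK] := pselect (K p.1); last first.
  by rewrite /A /C /region /= /h (notin_tsupport nK) mulr0 addr0.
have := eps_small p.1; rewrite ler_norml => /andP[e1 e2].
have [ltf|gef] := ltP p.2 (f p.1 - c).
  by split=> -[_ /andP[]]; rewrite /h; lra.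
have [gtf|lef] := ltP (f p.1 + c) p.2; last by exfalso; apply: nE; split=> //; rewrite gef lef.
by split=> -[Dp /andP[a b]]; (split=> //; rewrite b andbT /h; lra).
Qed.

Let S (k : E2 -> R) : set E3 := [set p | K p.1 /\ k p.1 <= p.2 <= f p.1 + c].

Let S_le (k : E2 -> R) (p : E3) : (forall z, f z - c <= k z) -> S k p -> E p.
Proof.
by move=> kf [Kp /andP[a b]]; split=> //; rewrite b andbT; exact: le_trans (kf _) a.
Qed.

Let h_ge z : f z - c <= h z.
Proof. by have := eps_small z; rewrite ler_norml => /andP[a b]; rewrite /h; lra. Qed.

Let f_ge z : f z - c <= f z.
Proof. by rewrite gerDl oppr_le0 ltW. Qed.

(** Applied with k = f and k = h, this writes [C] and the perturbed region as the same Lebesgue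
    measurable part plus a Borel slab. Measurability and the volume difference are then read off the
    slabs. *)
Let decompose (k : E2 -> R) : (forall z, f z - c <= k z) ->
  (forall p, ~ E p -> (C p <-> region D k g p)) ->
  region D k g = (C `\` E) `|` S k.
Proof.
move=> kf out; apply/seteqP; split=> p.
  move=> rp; have [Ep|nE] := pselect (E p); last by left; split=> //; apply/out.
  by right; case: Ep => Kp /andP[_ b]; split=> //; rewrite b andbT; case: rp => _ /andP[].
case=> [[Cp nE]|Sp]; first by apply/out.
have [Kp /andP[a b]] := Sp; split; first exact: interior_subset (KD Kp).
by rewrite a /=; apply: (le_trans b); apply/ltW/c_gap.
Qed.

Let measurable_S (k : E2 -> R) : (forall z, D^° z -> {for z, continuous k}) ->
  (forall z, f z - c <= k z) -> measurable (S k : set (space R)).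
Proof.
move=> ck kf.
have -> : S k = E `&` [set q | D^° q.1 /\ k q.1 <= q.2].
  apply/seteqP; split=> p.
    move=> Sp; split; first exact: (S_le kf).
    by case: Sp => Kp /andP[kp _]; split=> //; exact: KD.
  by move=> [[Kp /andP[_ b]] [_ kp]]; split=> //; rewrite kp.
apply: measurableI; first exact: (compact_measurable3 compact_collar).
by apply: measurable_epigraph => //; exact: open_interior.
Qed.

Let conth z : D^° z -> {for z, continuous h}.
Proof.
move=> Dz; apply: cvgD; first exact: contf.
by apply: cvgM; [exact: cvg_cst|exact: C1_continuous].
Qed.

Let mE : lebesgue_measurable E.
Proof. exact: (lebesgue_measurable_borel (compact_measurable3 compact_collar)). Qed.

Let mCE : lebesgue_measurable (C `\` E).
Proof. exact: measurableD. Qed.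

Lemma lebesgue_measurable_perturbed_region : lebesgue_measurable A.
Proof.
rewrite /A (decompose h_ge perturbed_region_out); apply: measurableU; first exact: mCE.
exact: (lebesgue_measurable_borel (measurable_S conth h_ge)).
Qed.

Let mK : measurable (K : set (plane R)).
Proof. exact: compact_measurable2. Qed.

Let fK : (mu2 K < +oo)%E.
Proof.
by have [r Kr] := compact_bounded_norm cK; exact: (bounded_borel_leb2 mK Kr).
Qed.

Let volume_decompose (k : E2 -> R) : (forall z, D^° z -> {for z, continuous k}) ->
  (forall z, f z - c <= k z <= f z + c) ->
  (forall p, ~ E p -> (C p <-> region D k g p)) ->
  volume (region D k g) = (leb3 (C `\` E) + \int[mu2]_(z in K) (f z + c - k z)%:E)%E.
Proof.
move=> ck kfc out; have kf z : f z - c <= k z by case/andP: (kfc z).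
rewrite -borel_leb3_slab //; last by move=> z _; case/andP: (kfc z).
rewrite /volume (decompose kf out) measureU.
- congr (_ + _)%E; exact: (@completedE _ (space R) R mu3 (S k) (measurable_S ck kf)).
- exact: mCE.
- exact: (lebesgue_measurable_borel (measurable_S ck kf)).
- by apply/seteqP; split => // p [[_ nE] Sp]; apply: nE; exact: (S_le kf).
Qed.

Lemma volume_perturbed_region : volume C \is a fin_num ->
  volume A = (fine (volume C) - eps * \int[mu2]_(z in K) phi z)%:E.
Proof.
move=> fV.
have bphi : bm K phi.
  split; last first.
    by have [M bM] := compact_support_bounded cK (C1_continuous Cphi) (@notin_tsupport _ _ phi); exists M.
  apply: measurable_funTS; apply: continuous_measurable_fun2; first exact: openT.
  by move=> z _; exact: C1_continuous.
have bc := bm_cst K c; have be := bm_mul (bm_cst K eps) bphi.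
have bce := bm_sub bc be.
have intE k : bm K k -> (\int[mu2]_(z in K) (k z)%:E)%E = (\int[mu2]_(z in K) k z)%:E.
  by move=> bk; rewrite /Rintegral fineK //; apply: integrable_fin_num => //; exact: bm_integrable.
have vC : volume C = (leb3 (C `\` E) + (\int[mu2]_(z in K) c)%:E)%E.
  rewrite (volume_decompose contf) //; last by move=> z; rewrite f_ge lerDl ltW.
  rewrite -(intE _ bc); congr (_ + _)%E; apply: eq_integral => z _; congr _%:E.
  by rewrite addrAC subrr add0r.
have vA : volume A = (leb3 (C `\` E) + (\int[mu2]_(z in K) c - eps * \int[mu2]_(z in K) phi z)%:E)%E.
  rewrite (volume_decompose conth); last exact: perturbed_region_out; last first.
    move=> z; rewrite h_ge /=; have := eps_small z; rewrite ler_norml => /andP[_ b].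
    by rewrite /h lerD2l.
  rewrite -(RintegralZl _ mK (bm_integrable mK fK bphi)) -(bm_RintegralB mK fK bc be).
  rewrite -(intE _ bce); congr (_ + _)%E; apply: eq_integral => z _; congr _%:E.
  by rewrite /h /=; ring.
have fin : leb3 (C `\` E) \is a fin_num by move: fV; rewrite vC fin_numD => /andP[].
by rewrite vA vC -(fineK fin) -!EFinD /= addrA.
Qed.
End perturbed_region.
End variation.

Section variation_bounds.
Context {R : realType}.
Local Notation E2 := (R * R)%type.
Local Notation E3 := (R * R * R)%type.
Local Notation mu2 := (@borel_leb2 R).
Variables (D : set E2) (f g : E2 -> R) (phi : E2 -> R).
Hypothesis cD : convex_set D.
Hypothesis cf : convex_function D f.
Hypothesis cg : convex_function D (fun z => - g z).
Hypothesis fg : forall z, D z -> f z <= g z.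
Let C := region D f g.
Let U := D^° `\` Sigma C D f.
Let v z := gradient f z + 2 *: perp z.
Hypothesis mC : lebesgue_measurable C.
Hypothesis fin_perimeter : perimeter C \is a fin_num.
Hypothesis fin_volume : volume C \is a fin_num.
Hypothesis Cphi : class_C 1 phi.
Hypothesis cK : compact (tsupport phi).
Hypothesis KU : tsupport phi `<=` U.

(** [G], [N] and [c] are chosen before eps. The perimeter increments for all small eps are thus
    integrals over one fixed set, and can be divided by eps and passed to the limit. *)
Lemma variation_bounds : exists G N : set (plane R),
  [/\ [/\ measurable G, (mu2 G < +oo)%E & forall z, G z ->
          [/\ U z, derivable f z (1, 0) & derivable f z (0, 1)]],
      [/\ measurable N, mu2 N = 0%E & tsupport phi `<=` G `|` N],
      bm G (fun z => (v z).1) /\ bm G (fun z => (v z).2) &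
      exists2 c : R, 0 < c & forall eps, (forall z, `|eps * phi z| <= c) ->
        exists A, [/\ lebesgue_measurable A,
          volume A = (fine (volume C) - eps * \int[mu2]_(z in G) phi z)%:E &
          (perimeter A <= (fine (perimeter C) +
            \int[mu2]_(z in G) (enorm (v z + eps *: gradient phi z) - enorm (v z)))%:E)%E]].
Proof.
have contf z : D^° z -> {for z, continuous f} by exact: convex_continuous.
have contg z : D^° z -> {for z, continuous g}.
  move=> Dz; have -> : g = (fun z => - - g z) by apply/funext => w; rewrite opprK.
  exact: cvgN (convex_continuous cg Dz).
have KD : tsupport phi `<=` D^° by move=> z /KU[].
have [c c0 gap] : exists2 c : R, 0 < c & forall z, tsupport phi z -> f z + c < g z.
  apply: (compact_gap cK) => z Kz; [exact/contf/KD|exact/contg/KD|].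
  by have [Dz nS] := KU Kz; exact: not_Sigma_lt.
have cE := compact_collar cf cK KU (c := c).
have EO := collar_below_ceiling KU gap.
have [chi [C1chi chi01 cchi chiO] chi1] := smooth_urysohn (open_below_ceiling cf cg fg) cE EO.
(* The projection of the support of the cut-off, not just of phi: the Lipschitz bound and the flux
   formula are needed wherever the cut-off fields live. *)
pose Z := (@fst E2 R) @` tsupport chi.
have cZ : compact Z.
  by apply: continuous_compact => //; apply: continuous_subspaceT => q; exact: cont_fst.
have ZU : Z `<=` U by move=> _ [p /chiO[Up _] <-].
have ZD : Z `<=` D^° by move=> z /ZU[].
have [d [L [d0 L0 lip]]] := convex_compact_lipschitz cf cZ ZD.
pose D1 := [set z | D^° z /\ derivable f z (1, 0)].
pose D2 := [set z | D^° z /\ derivable f z (0, 1)].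
have mD1 : measurable (D1 : set (plane R)) by exact: measurable_derivable.
have mD2 : measurable (D2 : set (plane R)) by exact: measurable_derivable.
have mD : measurable (D^° : set (plane R)) by apply: open_measurable2; exact: open_interior.
pose G : set (plane R) := Z `&` (D1 `&` D2).
pose N : set (plane R) := (D^° `\` D1) `|` (D^° `\` D2).
have mG : measurable G by apply: measurableI; [exact: compact_measurable2|exact: measurableI].
have [r Zr] := compact_bounded_norm cZ.
have Gr z : G z -> `|z| <= r by move=> [Zz _]; exact: Zr.
have fG : (mu2 G < +oo)%E by exact: (bounded_borel_leb2 mG Gr).
have mN1 : measurable (D^° `\` D1 : set (plane R)) := measurableD mD mD1.
have mN2 : measurable (D^° `\` D2 : set (plane R)) := measurableD mD mD2.
have mN : measurable N := measurableU _ _ mN1 mN2.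
have N0 : mu2 N = 0%E.
  apply/eqP; rewrite eq_le measure_ge0 andbT.
  apply: (@le_trans _ _ (mu2 (D^° `\` D1) + mu2 (D^° `\` D2))%E); first exact: (measureU2 _ mN1 mN2).
  by rewrite [X in (X + _)%E](borel_leb2_nonderivable1 cD cf) [X in (_ + X)%E](borel_leb2_nonderivable2 cD cf) adde0.
have GZ : G `<=` Z by move=> z [].
have ZGN : Z `<=` G `|` N.
  move=> z Zz; have Dz := ZD _ Zz.
  have [d1|n1] := pselect (derivable f z (1, 0)); last by right; left; split=> [//|[]].
  have [d2|n2] := pselect (derivable f z (0, 1)); last by right; right; split=> [//|[]].
  by left.
have df1 z : G z -> derivable f z (1, 0) by move=> [_ [[]]].
have df2 z : G z -> derivable f z (0, 1) by move=> [_ [_ []]].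
have GD : G `<=` D^° by move=> z /GZ/ZD.
have mdf (e : E2) : measurable_fun G ('D_e f).
  by apply: (measurable_funS mD GD); exact: measurable_fun_derive.
have oW : open D^° by exact: open_interior.
have KE z t : tsupport phi z -> `|t - f z| <= c -> chi (z, t) = 1.
  move=> Kz tf; apply: (@nbhs_singleton _ (z, t) (fun q => chi q = 1)); apply: chi1.
  by split=> //=; move: tf; rewrite ler_norml => /andP[a b]; apply/andP; split; lra.
have KZ : tsupport phi `<=` Z.
  move=> z Kz; exists (z, f z) => //; apply: subset_closure => /=.
  by rewrite KE ?subrr ?normr0 ?ltW // oner_neq0.
have ZC p : tsupport chi p -> Z p.1 /\ (C p <-> f p.1 <= p.2).
  move=> sp; have [Up pg] := chiO _ sp; split; first by exists p.
  split=> [[_ /andP[]]//|fp]; split; first exact: interior_subset (Up.1).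
  by rewrite fp ltW.
have vneq0 z : G z -> v z != 0.
  move=> Gz; have [Dz nS] := ZU _ (GZ _ Gz).
  by apply: (not_Sigma_gradient cD cf fg Dz nS); [exact: df1|exact: df2].
have bf1 := bm_partial1 GZ d0 L0 lip df1 (mdf (1, 0)).
have bf2 := bm_partial2 GZ d0 L0 lip df2 (mdf (0, 1)).
have bx := bm_fst Gr; have by_ := bm_snd Gr.
exists G, N; split.
- split=> // z Gz; split; [exact/ZU/GZ|exact: df1|exact: df2].
- by split=> // z /KZ/ZGN.
- split.
    have := bm_sub bf1 (bm_mul (bm_cst _ 2) by_); congr bm.
    by apply/funext => z; rewrite /v /gradient /perp /= /GRing.scale /=; ring.
  have := bm_add bf2 (bm_mul (bm_cst _ 2) bx); congr bm.
exists c => // eps small; exists (region D (fun z => f z + eps * phi z) g).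
have mA := lebesgue_measurable_perturbed_region cf mC Cphi cK KU gap small.
split=> //.
  rewrite (volume_perturbed_region cf mC Cphi cK KU c0 gap small fin_volume).
  congr (_ - _ * _)%:E; rewrite /Rintegral; congr fine.
  have mphi : measurable_fun setT (phi : plane R -> R).
    by apply: continuous_measurable_fun2; [exact: openT|move=> z _; exact: C1_continuous].
  apply: (integral_ae_domain _ mG mN N0).
  + exact: compact_measurable2.
  + by apply/measurable_EFinP; exact: measurable_funTS.
  + by apply/measurable_EFinP; exact: measurable_funTS.
  move=> z nN pz; have Kz : tsupport phi z.
    by apply: contrapT => /notin_tsupport p0; apply: pz; rewrite p0.
  by split=> // _; have [] := ZGN _ (KZ _ Kz).
apply: (perimeter_variation oW contf mG fG mN N0 GZ ZGN d0 L0 lip df1 df2 (mdf _) (mdf _) Gr mC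
  (conj C1chi cchi) chi01 ZC fin_perimeter vneq0 Cphi cK mA).
- move=> p /chiO[Up pg]; split=> [[_ /andP[]]//|hp]; split; first exact: interior_subset (Up.1).
  by rewrite hp ltW.
- move=> p nchi; apply: (perturbed_region_out D g small) => Ep; apply: nchi; exact: chi1.
move=> z Kz; split; apply: KE => //; first by rewrite subrr normr0 ltW.
by rewrite addrAC subrr add0r.
Qed.
End variation_bounds.

(** * A competitor with finite perimeter *)

Section cube.
Context {R : realType}.
Local Notation E2 := (R * R)%type.
Local Notation E3 := (R * R * R)%type.
Local Notation mu2 := (@borel_leb2 R).
Local Notation mu3 := (@borel_leb3 R).
Local Notation mu := (@lebesgue_measure R).

(** Translating [A] by u e changes its indicator only in a layer of measure at most k u, so the
    translated form of the integral of the derivative is at most k M for every step u, and so is its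
    limit. *)
Lemma derive_integral_bound (A : set (space R)) (psi : E3 -> R) (e : E3) (k M : R) :
  measurable A -> C1c psi -> 0 <= M ->
  (forall u, 0 < u <= 1 -> exists S : set (space R), [/\ measurable S, (mu3 S <= (k * u)%:E)%E &
     forall p, (\1_A (p - u *: e) != \1_A p :> R) -> S p /\ `|psi p| <= M]) ->
  `|\int[mu3]_(p in A) 'D_e psi p| <= k * M.
Proof.
move=> mA [Cp sp] M0 H.
pose u n : R := n.+1%:R^-1.
have un0 n : 0 < u n by rewrite invr_gt0.
have u01 n : 0 < u n <= 1 by rewrite un0 invf_le1 // ler1n.
have u0 : u @ \oo --> (0 : R) by exact: cvg_harmonic.
have cv := cvg_norm (derive_quotient_cvg Cp sp mA u0 u01 (e := e)).
apply: (ler_cvg_to (cv _) (cvg_cst (k * M))); apply: nearW => n.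
have [S [mS Sk HS]] := H _ (u01 n).
have bp := bbs_psi Cp sp.
have b2 : bbs (fun p => \1_A p * psi p) by exact: bbs_indic.
have b3 : bbs (fun p => \1_A (p - u n *: e) * psi p).
  have b1 : bbs (fun p => \1_A p * psi (p + u n *: e)).
    exact: (bbs_indic mA (bbs_translation (u n *: e) bp)).
  have := bbs_translation (- (u n *: e)) b1.
  by under [X in bbs X -> _]eq_fun do rewrite subrK.
have bF : bbs (fun p => (\1_A (p - u n *: e) - \1_A p) * psi p).
  by have := bbs_sub b3 b2; under [X in bbs X -> _]eq_fun do rewrite -mulrBl.
have [mF _ _] := bF.
have F0 p : \1_A (p - u n *: e) = \1_A p :> R -> (\1_A (p - u n *: e) - \1_A p) * psi p = 0.
  by move=> ->; rewrite subrr mul0r.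
rewrite normrM normfV (gtr0_norm (un0 n)) ler_pdivrMl // (_ : \int[mu3]_p _ =
    \int[mu3]_(p in S) ((\1_A (p - u n *: e) - \1_A p) * psi p)); last first.
  rewrite [RHS]Rintegral_mkcond; apply: eq_Rintegral => p _; rewrite patchE.
  case: ifPn => //; rewrite notin_setE => nS; apply: F0.
  by apply/eqP; apply: contrapT => /negP /HS[].
have fS : (mu3 S < +oo)%E by exact: le_lt_trans Sk (ltry _).
apply: (@le_trans _ _ (M * fine (mu3 S))).
  apply: (@le_Rintegral_norm _ (space R)) => //; first exact: measurable_funTS.
  move=> p _; have [/eqP/F0 -> |/HS[_ pM]] := boolP (\1_A (p - u n *: e) == \1_A p :> R).
    by rewrite normr0.
  rewrite normrM -[leRHS]mul1r; apply: ler_pM => //.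
  by rewrite !indicE; do 2 case: (_ \in _); rewrite ?subrr ?normr0 ?subr0 ?sub0r ?normrN ?normr1 ?ler01.
rewrite (_ : u n * (k * M) = M * (k * u n)); last by ring.
by rewrite ler_wpM2l // -lee_fin fineK // ge0_fin_numE.
Qed.

Lemma borel_leb3_rect (A1 A2 A3 : set (measurableTypeR R)) :
  measurable A1 -> measurable A2 -> measurable A3 ->
  mu3 ((A1 `*` A2) `*` A3) = (mu A1 * mu A2 * mu A3)%E.
Proof.
move=> m1 m2 m3.
transitivity (mu2 (A1 `*` A2) * mu A3)%E.
  by apply: (@product_measure1E _ _ (plane R) (measurableTypeR R) R mu2 mu) => //; exact: measurableX.
congr (_ * _)%E.
exact: (@product_measure1E _ _ (measurableTypeR R) (measurableTypeR R) R mu mu).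
Qed.

Let I : set (measurableTypeR R) := `[-1, 1]%classic.
(** The layers at the two ends where the indicator of [-1, 1] can change under a shift by u. *)
Let J (u : R) : set (measurableTypeR R) := `[1, 1 + u]%classic `|` `[-1, -1 + u]%classic.

Let mI : measurable I. Proof. exact: measurable_itv. Qed.
Let mJ u : measurable (J u). Proof. by apply: measurableU; exact: measurable_itv. Qed.

Let muI : mu I = 2%:E.
Proof.
have n1 : (-1 : R) < 1 by lra.
by rewrite lebesgue_measure_itv /= lte_fin n1 -EFinB; congr _%:E; lra.
Qed.

Let muJ u : 0 < u -> (mu (J u) <= (2 * u)%:E)%E.
Proof.
move=> u0; have m1 : measurable (`[1, 1 + u]%classic : set (measurableTypeR R)) by exact: measurable_itv.
have m2 : measurable (`[-1, -1 + u]%classic : set (measurableTypeR R)) by exact: measurable_itv.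
apply: (@le_trans _ _ (mu `[1%R, (1 + u)%R] + mu `[(-1)%R, (-1 + u)%R])%E); first exact: (measureU2 mu m1 m2).
rewrite [X in (X + _)%E]lebesgue_measure_itv [X in (_ + X)%E]lebesgue_measure_itv /= !lte_fin.
by rewrite !ltrDl u0 -!EFinD lee_fin; lra.
Qed.

Let I_J (x u : R) : 0 < u <= 1 -> (`|x - u| <= 1) != (`|x| <= 1) -> J u x /\ `|x| <= 2.
Proof.
move=> /andP[u0 u1]; rewrite !ler_norml /J /= !in_itv /=.
case: (leP (-1) x) => h1; case: (leP x 1) => h2; case: (leP (-1) (x - u)) => h3; case: (leP (x - u) 1) => h4 //= _;
 split; try (by apply/andP; split; lra); try (by left; lra); try (by right; lra); try lra.
Qed.

Let Q : set (space R) := box 0 1.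

Let QE (p : space R) : Q p <-> [/\ `|p.1.1| <= 1, `|p.1.2| <= 1 & `|p.2| <= 1].
Proof. by rewrite /Q boxP /= !subr0. Qed.

Let in_I (x : R) : `|x| <= 1 -> I x.
Proof. by rewrite ler_norml /I /= in_itv. Qed.

Let indicQ (p q : space R) : (\1_Q p != \1_Q q :> R) -> ~ (Q p <-> Q q).
Proof.
move=> /eqP ne E; apply: ne; rewrite !indicE; congr (_%:R).
by congr nat_of_bool; apply/idP/idP; rewrite !inE => /E.
Qed.

Let split_neq (a b c d : bool) : ~ ([/\ a, c & d] <-> [/\ b, c & d]) -> [/\ a != b, c & d].
Proof. by case: a; case: b; case: c; case: d => // h; exfalso; apply: h; split=> -[]. Qed.

Let slab_le (A1 A2 A3 : set (measurableTypeR R)) u : 0 < u ->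
  (mu A1 * mu A2 * mu A3 <= mu (J u) * 4%:E)%E ->
  (mu A1 * mu A2 * mu A3 <= (8 * u)%:E)%E.
Proof.
move=> u0 h; apply: (le_trans h); rewrite (_ : (8 * u)%:E = (2 * u)%:E * 4%:E)%E.
  by apply: lee_wpmul2r => //; exact: muJ.
by rewrite -EFinM; congr _%:E; ring.
Qed.

(** 8 is the area 4 of a face times the two faces met by the direction. For u <= 1 the layers stay
    in the box of radius 2, so psi need only be bounded there. *)
Lemma cube_derive_bound (psi : E3 -> R) (M : R) (e : E3) :
  [\/ e = (1, 0, 0), e = (0, 1, 0) | e = (0, 0, 1)] -> C1c psi -> 0 <= M ->
  (forall p, box 0 2 p -> `|psi p| <= M) ->
  `|\int[mu3]_(p in Q) 'D_e psi p| <= 8 * M.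
Proof.
move=> de Cpsi M0 bM; apply: derive_integral_bound => //; first exact: measurable_box.
move=> u u01; have /andP[u0 u1] := u01.
have two x : `|x| <= 1 -> `|x| <= 2 :> R by move=> h; apply: (le_trans h); lra.
have shift0 (x : R) : x - u * 0 = x by rewrite mulr0 subr0.
have shift1 (x : R) : x - u * 1 = x - u by rewrite mulr1.
have four (a : \bar R) : (a * (2%:E * 2%:E) = a * 4%:E)%E.
  by rewrite -EFinM; congr (_ * _%:E)%E; ring.
case: de => ->.
- exists ((J u `*` I) `*` I); split; first by apply: measurableX => //; exact: measurableX.
    by rewrite borel_leb3_rect //; apply: (@slab_le _ _ _ u) => //; rewrite muI -muleA four.
  move=> p /indicQ; rewrite !QE /= !shift0 shift1 => /split_neq[/(I_J u01)[Jx x2] y1 t1].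
  split; first by do !split => //; exact: in_I.
  by apply: bM; apply/boxP; rewrite /= !subr0; split=> //; exact: two.
- exists ((I `*` J u) `*` I); split; first by apply: measurableX => //; exact: measurableX.
    by rewrite borel_leb3_rect //; apply: (@slab_le _ _ _ u) => //; rewrite muI (muleC 2%:E) -muleA four.
  move=> p /indicQ; rewrite !QE /= !shift0 shift1 => h.
  have /split_neq[/(I_J u01)[Jx x2] y1 t1] :
    ~ ([/\ `|p.1.2 - u| <= 1, `|p.1.1| <= 1 & `|p.2| <= 1] <->
       [/\ `|p.1.2| <= 1, `|p.1.1| <= 1 & `|p.2| <= 1]).
    by move=> E; apply: h; split=> -[a b c]; have [] := E; [move=> /(_ (And3 b a c))[]|move=> _ /(_ (And3 b a c))[]].
  split; first by do !split => //; exact: in_I.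
  by apply: bM; apply/boxP; rewrite /= !subr0; split=> //; exact: two.
- exists ((I `*` I) `*` J u); split; first by apply: measurableX => //; exact: measurableX.
    by rewrite borel_leb3_rect //; apply: (@slab_le _ _ _ u) => //; rewrite muI muleC four.
  move=> p /indicQ; rewrite !QE /= !shift0 shift1 => h.
  have /split_neq[/(I_J u01)[Jx x2] y1 t1] :
    ~ ([/\ `|p.2 - u| <= 1, `|p.1.1| <= 1 & `|p.1.2| <= 1] <->
       [/\ `|p.2| <= 1, `|p.1.1| <= 1 & `|p.1.2| <= 1]).
    by move=> E; apply: h; split=> -[a b c]; have [] := E; [move=> /(_ (And3 c a b))[]|move=> _ /(_ (And3 c a b))[]].
  split; first by do !split => //; exact: in_I.
  by apply: bM; apply/boxP; rewrite /= !subr0; split=> //; exact: two.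
Qed.
End cube.

Section finite_perimeter.
Context {R : realType}.
Local Notation E2 := (R * R)%type.
Local Notation E3 := (R * R * R)%type.
Local Notation mu2 := (@borel_leb2 R).
Local Notation mu3 := (@borel_leb3 R).

Lemma perimeter_ge0 (A : set E3) : (0 <= perimeter A)%E.
Proof.
apply: ereal_sup_ubound; exists (fun=> 0), (fun=> 0); split.
- split; first exact: C1_cst.
  rewrite /tsupport (_ : [set p | _] = set0) ?closure0; first exact: compact0.
  by apply/seteqP; split=> // p /=; rewrite eqxx.
- split; first exact: C1_cst.
  rewrite /tsupport (_ : [set p | _] = set0) ?closure0; first exact: compact0.
  by apply/seteqP; split=> // p /=; rewrite eqxx.
- by move=> p; rewrite expr0n /= addr0 ler01.
- rewrite integral0_eq // => p _; rewrite /field_X /field_Y !(derive_cst) !mulr0 addr0 subr0 addr0 //.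
Qed.

Let Q : set E3 := box 0 1.

(** The two horizontal derivatives give 8 * 1 each. The two vertical ones give 8 * 4 each, since the
    coefficients 2 y and -2 x are at most 4 in absolute value on the box of radius 2. *)
Lemma perimeter_cube : (perimeter Q <= 80%:E)%E.
Proof.
have mQ := @measurable_box R 0 1.
apply: ge_ereal_sup => _ [phi1 [phi2 [C1 C2 phi_le1 ->]]].
rewrite (leb3_RintegralE (lebesgue_measurable_borel mQ) (bbs_div C1 C2)) lee_fin.
have [eX [CX sX]] := bbs_field_X C1; have [eY [CY sY]] := bbs_field_Y C2.
have bD (psi : E3 -> R) (e : E3) : C1c psi -> bbs ('D_e psi).
  by move=> [? ?]; exact: bbs_derive.
have mQ' := lebesgue_measurable_borel mQ.
under eq_Rintegral do rewrite eX eY.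
rewrite leb3_RintegralD //; [|by apply: bbs_add; exact: bD..].
rewrite leb3_RintegralD //; [|exact: bD..].
rewrite leb3_RintegralD //; [|exact: bD..].
rewrite !(leb3_Rintegral_borel mQ); [|exact: bD..].
have p1 p : `|phi1 p| <= 1 by have [] := unit_norm_le1 (phi_le1 p).
have p2 p : `|phi2 p| <= 1 by have [] := unit_norm_le1 (phi_le1 p).
have B1 := cube_derive_bound (Or31 _ _ (erefl ((1, 0, 0) : E3))) C1 ler01 (fun p _ => p1 p).
have B2 := cube_derive_bound (Or32 _ _ (erefl ((0, 1, 0) : E3))) C2 ler01 (fun p _ => p2 p).
have le4 (x y s : R) : `|x| <= 2 -> `|y| <= 1 -> `|s| = 2 -> `|s * x * y| <= 4.
  move=> hx hy hs; rewrite !normrM hs (_ : 4 = 2 * 2 * 1); last by ring.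
  by rewrite ler_pM // ler_wpM2l.
have B3 : `|\int[mu3]_(p in Q) 'D_((0, 0, 1) : E3) (fun p : E3 => 2 * p.1.2 * phi1 p) p| <= 8 * 4.
  apply: (cube_derive_bound (Or33 _ _ (erefl ((0, 0, 1) : E3))) CX) => // p /boxP[/= + + _].
  by rewrite !subr0 => h1 h2; apply: le4; rewrite ?normr_nat.
have B4 : `|\int[mu3]_(p in Q) 'D_((0, 0, 1) : E3) (fun p : E3 => - 2 * p.1.1 * phi2 p) p| <= 8 * 4.
  apply: (cube_derive_bound (Or33 _ _ (erefl ((0, 0, 1) : E3))) CY) => // p /boxP[/= + + _].
  by rewrite !subr0 => h1 h2; apply: le4; rewrite ?normrN ?normr_nat.
apply: (le_trans (ler_norm _)); apply: (le_trans (ler_normD _ _)).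
rewrite (_ : 80 = (8 * 1 + 8 * 4) + (8 * 1 + 8 * 4)); last by ring.
exact: (lerD (le_trans (ler_normD _ _) (lerD B1 B3)) (le_trans (ler_normD _ _) (lerD B2 B4))).
Qed.

Lemma admissible_cube : admissible Q.
Proof.
have mQ := @measurable_box R 0 1; split; first exact: lebesgue_measurable_borel.
have mI : measurable (`[0 - 1, 0 + 1]%classic : set (measurableTypeR R)) by exact: measurable_itv.
have -> : volume Q = 8%:E.
  rewrite /volume [LHS](@completedE _ (space R) R mu3 Q mQ) /Q /box /=.
  rewrite (borel_leb3_rect mI mI mI) lebesgue_measure_itv /= lte_fin.
  have n1 : (0 - 1 : R) < 0 + 1 by lra.
  by rewrite n1 -EFinB -!EFinM; congr _%:E; ring.
by rewrite lte_fin ltry andbT; lra.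
Qed.

Let r43 : (4 / 3 : R) != 0.
Proof. by rewrite mulf_neq0 ?invr_eq0 ?pnatr_eq0. Qed.

(** The volume being finite, an infinite perimeter would make the ratio infinite, whereas the cube
    has a finite ratio. *)
Lemma isoperimetric_fin_perimeter (C : set E3) : isoperimetric C -> perimeter C \is a fin_num.
Proof.
move=> [[mC /andP[V0 Voo]] /(_ Q admissible_cube)] le.
have [_ /andP[Q0 Qoo]] := admissible_cube.
rewrite ge0_fin_numE ?perimeter_ge0 // ltNge leye_eq; apply/negP => /eqP Poo.
move: le; rewrite /isoperimetric_ratio Poo poweRyr //.
have V_neq0 : volume C != 0%E by rewrite gt_eqF.
have V_neqy : volume C != +oo%E by rewrite lt_eqF.
rewrite gt0_mulye; last by rewrite inve_gt0.
rewrite leNgt => /negP; apply; rewrite lte_mul_pinfty ?poweR_ge0 //.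
  by apply: fin_num_poweR; rewrite ge0_fin_numE ?perimeter_ge0 // (le_lt_trans perimeter_cube) ?ltry.
by rewrite ltey inve_eqy gt_eqF.
Qed.

(** Cubing removes the real exponent 4/3, and clearing denominators leaves a polynomial
    inequality. *)
Lemma isoperimetric_le (C A : set E3) (q : R) : isoperimetric C -> admissible A ->
  (perimeter A <= q%:E)%E ->
  fine (perimeter C) ^+ 4 * fine (volume A) ^+ 3 <= q ^+ 4 * fine (volume C) ^+ 3.
Proof.
move=> iC aA PA; have fP := isoperimetric_fin_perimeter iC.
have [[_ /andP[V0 Voo]] /(_ A aA)] := iC; have [_ /andP[W0 Woo]] := aA.
have q0 : 0 <= q by rewrite -lee_fin; exact: le_trans (perimeter_ge0 A) PA.
have p0 : 0 <= fine (perimeter C) by rewrite fine_ge0 ?perimeter_ge0.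
rewrite /isoperimetric_ratio -(fineK fP).
have VE : volume C = (fine (volume C))%:E by rewrite fineK // ge0_fin_numE ?ltW.
have WE : volume A = (fine (volume A))%:E by rewrite fineK // ge0_fin_numE ?ltW.
move: V0 W0; rewrite VE WE !lte_fin /=.
set p := fine (perimeter C) in p0 *; set V := fine (volume C); set W := fine (volume A).
move=> V0 W0 h.
have : (p%:E `^ (4 / 3) / V%:E <= q%:E `^ (4 / 3) / W%:E)%E.
  apply: (le_trans h); apply: lee_wpmul2r; first by rewrite inve_ge0 lee_fin ltW.
  have dom (x : \bar R) : (0 <= x)%E -> x \in `[0%E, +oo%E] by move=> x0; rewrite in_itv /= x0 leey.
  apply: gt0_ler_poweR => //.
    by apply: dom; exact: perimeter_ge0.
  by apply: dom; rewrite lee_fin.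
rewrite !poweR_EFin !inver !gt_eqF // -!EFinM lee_fin.
rewrite ler_pdivrMr // mulrAC ler_pdivlMr // => le1.
have cube (x : R) : 0 <= x -> (x `^ (4 / 3)) ^+ 3 = x ^+ 4.
  by move=> x0; rewrite -powR_mulrn ?powR_ge0 // -powRrM -mulrA mulVf ?pnatr_eq0 // mulr1 powR_mulrn.
have V_ge0 := ltW V0; have W_ge0 := ltW W0.
by rewrite -!cube // -!exprMn lerXn2r ?nnegrE ?mulr_ge0 ?powR_ge0.
Qed.
End finite_perimeter.

(** * First variation *)

Section norm_quotient.
Context {R : realType}.
Implicit Types (v w : R * R).

(** Multiply by the sum of the norms and use the difference of squares. This form has no division by
    eps, and yields both a bound independent of eps and the limit. *)
Lemma enorm_quotientE v w (eps : R) : v != 0 -> eps != 0 ->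
  eps^-1 * (enorm (v + eps *: w) - enorm v) =
  (dot (v + eps *: w) w + dot v w) / (enorm (v + eps *: w) + enorm v).
Proof.
move=> v0 eps0; have s0 : enorm (v + eps *: w) + enorm v != 0.
  by rewrite gt_eqF // ltr_wpDl ?enorm_ge0 ?enorm_gt0.
apply: (mulIf s0); rewrite divfK // -mulrA mulrC.
apply: (mulIf eps0); rewrite divfK //.
have := subr_sqr (enorm (v + eps *: w)) (enorm v).
rewrite !sqr_enorm => <-; rewrite /dot /= /GRing.scale /=; ring.
Qed.

Lemma norm_dot_le v w : `|dot v w| <= enorm v * enorm w.
Proof.
rewrite ler_norml dot_le andbT lerNl.
have -> : - dot v w = dot (- v) w by rewrite /dot /=; ring.
by rewrite (_ : enorm v = enorm (- v)) ?dot_le // /enorm /dot /= !mulrNN.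
Qed.

Lemma enorm_quotient_le v w (eps : R) : v != 0 -> eps != 0 ->
  `|eps^-1 * (enorm (v + eps *: w) - enorm v)| <= enorm w.
Proof.
move=> v0 eps0; rewrite enorm_quotientE // normrM normfV.
have s0 : 0 < enorm (v + eps *: w) + enorm v by rewrite ltr_wpDl ?enorm_ge0 ?enorm_gt0.
rewrite (gtr0_norm s0) ler_pdivrMr // mulrDr.
by rewrite !(mulrC (enorm w)); apply: (le_trans (ler_normD _ _)); apply: lerD; exact: norm_dot_le.
Qed.

Lemma enorm_quotient_cvg v w (u : nat -> R) : v != 0 -> u @ \oo --> (0 : R) -> (forall n, u n != 0) ->
  (u n)^-1 * (enorm (v + u n *: w) - enorm v) @[n --> \oo] --> dot v w / enorm v.
Proof.
move=> v0 u0 un0; have e0 := enorm_gt0 v0.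
under eq_fun do rewrite enorm_quotientE //.
have coord (a b : R) : a + u n * b @[n --> \oo] --> a.
  have : a + u n * b @[n --> \oo] --> a + 0 * b by exact: (cvgD (cvg_cst a) (cvgM u0 (cvg_cst b))).
  by rewrite mul0r addr0.
have c1 := coord v.1 w.1; have c2 := coord v.2 w.2.
have cd : dot (v + u n *: w) w @[n --> \oo] --> dot v w.
  exact: (cvgD (cvgM c1 (cvg_cst w.1)) (cvgM c2 (cvg_cst w.2))).
have ce : enorm (v + u n *: w) @[n --> \oo] --> enorm v.
  have c : dot (v + u n *: w) (v + u n *: w) @[n --> \oo] --> dot v v.
    exact: (cvgD (cvgM c1 c1) (cvgM c2 c2)).
  exact: (continuous_cvg _ (@sqrt_continuous R (dot v v)) c).
have -> : dot v w / enorm v = (dot v w + dot v w) / (enorm v + enorm v).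
  have n0 : enorm v != 0 by rewrite gt_eqF.
  by field; rewrite n0 gt_eqF // addr_gt0.
have s0 : enorm v + enorm v != 0 by rewrite gt_eqF // addr_gt0.
exact: (cvgM (cvgD cd (cvg_cst _)) (cvgV s0 (cvgD ce (cvg_cst _)))).
Qed.
End norm_quotient.

(* If [P = 0] the isoperimetric inequality gives nothing at first order, and the
   conclusion comes from the nonnegativity of the perturbed perimeter. *)
Lemma isoperimetric_slope (R : realType) (P V I J : R) (u k : nat -> R) :
  0 <= P -> 0 < V -> u @ \oo --> (0 : R) -> (forall n, 0 < u n) -> k @ \oo --> J ->
  (forall n, 0 <= P + u n * k n) ->
  (forall n, P ^+ 4 * (V - u n * I) ^+ 3 <= (P + u n * k n) ^+ 4 * V ^+ 3) ->
  - (3 * P * I) <= 4 * V * J.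
Proof.
move=> P0 V0 u0 un0 kJ k_ge0 ineq.
move: P0; rewrite le_eqVlt => /predU1P[P0|P0].
  have J0 : 0 <= J.
    apply: (ler_cvg_to (cvg_cst 0) kJ); apply: nearW => n.
    by have := k_ge0 n; rewrite -P0 add0r pmulr_rge0.
  by rewrite -P0 mulr0 mul0r oppr0 !mulr_ge0 // ltW.
(* [a n] and [b n] are the two sides of the inequality expanded, with P^4 V^3 subtracted from both
   and divided by u n. *)
pose a n := P ^+ 4 * (- (3 * V ^+ 2 * I) + u n * (3 * V * I ^+ 2 + - I ^+ 3 * u n)).
pose b n := V ^+ 3 * (4 * P ^+ 3 * k n + u n * (6 * P ^+ 2 * (k n * k n) +
  u n * (4 * P * (k n * (k n * k n)) + u n * (k n * (k n * (k n * k n)))))).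
have ab n : a n <= b n.
  rewrite -(ler_pM2l (un0 n)) -subr_ge0; have := ineq n; rewrite -subr_ge0.
  by rewrite /a /b; congr (_ <= _); ring.
pose la := P ^+ 4 * (- (3 * V ^+ 2 * I) + 0 * (3 * V * I ^+ 2 + - I ^+ 3 * 0)).
have ca : a @ \oo --> la.
  exact: (cvgM (cvg_cst _) (cvgD (cvg_cst _) (cvgM u0 (cvgD (cvg_cst _) (cvgM (cvg_cst _) u0))))).
have k2 : k n * k n @[n --> \oo] --> J * J by exact: (cvgM kJ kJ).
have k3 : k n * (k n * k n) @[n --> \oo] --> J * (J * J) by exact: (cvgM kJ k2).
have k4 : k n * (k n * (k n * k n)) @[n --> \oo] --> J * (J * (J * J)) by exact: (cvgM kJ k3).
pose lb := V ^+ 3 * (4 * P ^+ 3 * J + 0 * (6 * P ^+ 2 * (J * J) +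
  0 * (4 * P * (J * (J * J)) + 0 * (J * (J * (J * J)))))).
have cb : b @ \oo --> lb.
  exact: (cvgM (cvg_cst _) (cvgD (cvgM (cvg_cst _) kJ) (cvgM u0 (cvgD (cvgM (cvg_cst _) k2)
    (cvgM u0 (cvgD (cvgM (cvg_cst _) k3) (cvgM u0 k4))))))).
have le : la <= lb by apply: (ler_cvg_to ca cb); exact: nearW.
move: le; rewrite /la /lb !mul0r !addr0.
(* The limits are -3 P^4 V^2 I and 4 P^3 V^3 J, with common factor P^3 V^2. *)
have pv : 0 < P ^+ 3 * V ^+ 2 by rewrite mulr_gt0 // exprn_gt0.
move=> le; rewrite -(ler_pM2l pv).
apply: le_trans (le_trans le _).
  by rewrite le_eqVlt; apply/orP; left; apply/eqP; ring.
by rewrite le_eqVlt; apply/orP; left; apply/eqP; ring.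
Qed.

Lemma measurable_inv_enorm (R : realType) (A : set (plane R)) (u1 u2 : plane R -> R) :
  measurable_fun A u1 -> measurable_fun A u2 ->
  measurable_fun A (fun z => (enorm (u1 z, u2 z))^-1).
Proof.
move=> m1 m2.
have mn : measurable_fun A (fun z => enorm (u1 z, u2 z)).
  have ms : measurable_fun setT (@Num.sqrt R) by apply: continuous_measurable_fun; exact: sqrt_continuous.
  by apply: (measurableT_comp ms); apply: measurable_funD; exact: measurable_funM.
(* The real power with exponent -1 is measurable on the whole line and agrees with the inverse at
   every nonnegative number, including 0. *)
have -> : (fun z => (enorm (u1 z, u2 z))^-1) = (fun z => enorm (u1 z, u2 z) `^ (-1)).
  by apply/funext => z; rewrite powR_inv1 // enorm_ge0.
exact: (measurableT_comp (measurable_powR (-1)) mn).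
Qed.

Section first_variation.
Context {R : realType}.
Local Notation E2 := (R * R)%type.
Local Notation E3 := (R * R * R)%type.
Local Notation mu2 := (@borel_leb2 R).
Variables (D : set E2) (f g : E2 -> R) (phi : E2 -> R).
Hypothesis cD : convex_set D.
Hypothesis cf : convex_function D f.
Hypothesis cg : convex_function D (fun z => - g z).
Hypothesis fg : forall z, D z -> f z <= g z.
Let C := region D f g.
Let U := D^° `\` Sigma C D f.
Let v z := gradient f z + 2 *: perp z.
Hypothesis iC : isoperimetric C.
Hypothesis Cphi : class_C 1 phi.
Hypothesis cK : compact (tsupport phi).
Hypothesis KU : tsupport phi `<=` U.
Let P := fine (perimeter C).
Let V := fine (volume C).

Lemma first_variation : exists G N : set (plane R),
  [/\ [/\ measurable G, (mu2 G < +oo)%E & G `<=` U],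
      [/\ measurable N, mu2 N = 0%E & tsupport phi `<=` G `|` N] &
      4 * V * \int[mu2]_(z in G) (dot (v z) (gradient phi z) / enorm (v z)) =
        - (3 * P * \int[mu2]_(z in G) phi z)].
Proof.
have [[mC /andP[V0 Voo]] _] := iC.
have fV : volume C \is a fin_num by rewrite ge0_fin_numE // ltW.
have fP := isoperimetric_fin_perimeter iC.
have V_gt0 : 0 < V by rewrite fine_gt0 // V0.
have P_ge0 : 0 <= P by rewrite fine_ge0 ?perimeter_ge0.
have [G [N [[mG fG GU] [mN N0 KGN] [bv1 bv2] [c c0 var]]]] := variation_bounds cD cf cg fg mC fP fV Cphi cK KU.
exists G, N; split=> //; first by split=> // z /GU[].
set I := \int[mu2]_(z in G) phi z; set J := \int[mu2]_(z in G) _.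
have [M bM] := compact_support_bounded cK (C1_continuous Cphi) (@notin_tsupport _ _ phi).
have M0 : 0 <= M := le_trans (normr_ge0 _) (bM 0).
have bD (e : E2) : bm G ('D_e phi).
  split; last by have [Me] := C1_derive_bounded e Cphi cK; exists Me.
  apply: measurable_funTS; apply: continuous_measurable_fun2; first exact: openT.
  by move=> z _; have [_] := Cphi; apply.
have [_ [Mw bMw]] := bm_enorm (bD (1, 0)) (bD (0, 1)).
have bJ : bm G (fun z => dot (v z) (gradient phi z) / enorm (v z)).
  split; last first.
    exists Mw => z Gz; rewrite normrM normfV (ger0_norm (enorm_ge0 _)).
    have [v0|v0] := eqVneq (enorm (v z)) 0.
      by rewrite v0 invr0 mulr0; apply: le_trans (bMw z Gz).
    rewrite ler_pdivrMr ?lt_def ?v0 ?enorm_ge0 //; apply: (le_trans (norm_dot_le _ _)).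
    rewrite mulrC ler_wpM2r ?enorm_ge0 //; apply: le_trans (bMw z Gz); exact: ler_norm.
  apply: measurable_funM; last exact: (measurable_inv_enorm bv1.1 bv2.1).
  by have [] := bm_dot bv1 bv2 (bD (1, 0)) (bD (0, 1)).
(* The first bound keeps |eps phi| <= c; the second keeps the perturbed volume positive, so the
   competitor is admissible. *)
pose d := Num.min (c / (M + 1)) (V / (`|I| + 1)).
have d0 : 0 < d by rewrite lt_min !divr_gt0 // ltr_wpDl.
have dM : d * M <= c.
  apply: (@le_trans _ _ (c / (M + 1) * M)); first by rewrite ler_wpM2r // ge_min lexx.
  by rewrite mulrAC ler_pdivrMr ?ltr_wpDl // ler_pM2l // lerDl.
have dI : d * `|I| < V.
  apply: (@le_lt_trans _ _ (V / (`|I| + 1) * `|I|)).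
    by rewrite ler_wpM2r // ge_min lexx orbT.
  by rewrite mulrAC ltr_pdivrMr ?ltr_wpDl // ltr_pM2l // ltrDl.
(* The limit gives only an inequality for eps of one sign. The sign [s] covers both cases at once,
   and s = 1 with s = -1 forces equality. *)
have slope (s : R) : `|s| = 1 -> - (3 * P * (s * I)) <= 4 * V * (s * J).
  move=> s1; have ss : s * s = 1 by rewrite -expr2 -real_normK ?num_real // s1 expr1n.
  have s0 : s != 0 by rewrite -normr_eq0 s1 oner_neq0.
  pose u n : R := d * n.+1%:R^-1.
  have un0 n : 0 < u n by rewrite mulr_gt0 // invr_gt0.
  have ud n : u n <= d by rewrite ler_piMr ?(ltW d0) // invf_le1 // ler1n.
  have u0 : u @ \oo --> (0 : R).
    rewrite -(mulr0 d); apply: cvgM; [exact: cvg_cst|exact: cvg_harmonic].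
  clearbody u.
  have su0 : s * u n @[n --> \oo] --> (0 : R).
    rewrite -(mulr0 s); apply: cvgM; [exact: cvg_cst|exact: u0].
  have sun0 n : s * u n != 0 by rewrite mulf_neq0 // gt_eqF.
  have absu n : `|s * u n| = u n by rewrite normrM s1 mul1r gtr0_norm.
  pose F n (z : plane R) := (u n)^-1 * (enorm (v z + (s * u n) *: gradient phi z) - enorm (v z)).
  have FE n z : F n z = s * ((s * u n)^-1 * (enorm (v z + (s * u n) *: gradient phi z) - enorm (v z))).
    by rewrite /F mulrA; congr (_ * _); rewrite invfM mulrA divff // mul1r.
  have bdiff n : bm G (fun z => enorm (v z + (s * u n) *: gradient phi z) - enorm (v z)).
    apply: bm_sub; last exact: (bm_enorm bv1 bv2).
    exact: (bm_enorm (bm_add bv1 (bm_mul (bm_cst _ (s * u n)) (bD (1, 0))))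
                     (bm_add bv2 (bm_mul (bm_cst _ (s * u n)) (bD (0, 1))))).
  have vneq0 z : G z -> v z != 0.
    move=> Gz; have [[Dz nS] d1 d2] := GU _ Gz.
    exact: (not_Sigma_gradient cD cf fg Dz nS d1 d2).
  have Fcvg : \int[mu2]_(z in G) F n z @[n --> \oo] -->
      \int[mu2]_(z in G) (s * (dot (v z) (gradient phi z) / enorm (v z))).
    apply: (bounded_cvg_Rintegral (M := Mw)) => //.
    - by move=> n; have [] := bm_mul (bm_cst _ (u n)^-1) (bdiff n).
    - move=> n z Gz; rewrite FE normrM s1 mul1r.
      apply: (le_trans (enorm_quotient_le _ (vneq0 _ Gz) (sun0 n))).
      by apply: le_trans (bMw z Gz); exact: ler_norm.
    - move=> z Gz; under eq_fun do rewrite FE.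
      by apply: cvgM; [exact: cvg_cst|exact: enorm_quotient_cvg (vneq0 _ Gz) su0 sun0].
  have FintE n : P + u n * \int[mu2]_(z in G) F n z =
      P + \int[mu2]_(z in G) (enorm (v z + (s * u n) *: gradient phi z) - enorm (v z)).
    congr (_ + _); rewrite (RintegralZl _ mG (bm_integrable mG fG (bdiff n))).
    by rewrite mulrA divff ?mul1r // gt_eqF.
  have sJE : \int[mu2]_(z in G) (s * (dot (v z) (gradient phi z) / enorm (v z))) = s * J.
    exact: (RintegralZl _ mG (bm_integrable mG fG bJ)).
  rewrite sJE in Fcvg.
  have A n := var (s * u n).
  have small n z : `|(s * u n) * phi z| <= c.
    rewrite normrM absu; apply: le_trans dM; apply: ler_pM => //; exact: ltW.
  have VI n : 0 < V - u n * (s * I).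
    rewrite subr_gt0; apply: le_lt_trans dI; apply: (le_trans (ler_norm _)).
    by rewrite !normrM s1 mul1r gtr0_norm // ler_wpM2r.
  apply: (isoperimetric_slope P_ge0 V_gt0 u0 un0 Fcvg) => n; rewrite FintE.
    have [B [_ _ PB]] := A n (small n).
    by rewrite -lee_fin; apply: le_trans PB; exact: perimeter_ge0.
  have [B [mB VB PB]] := A n (small n).
  have VBE : s * u n * I = u n * (s * I) by ring.
  have aB : admissible B by split=> //; rewrite VB VBE lte_fin VI ltry.
  by have := isoperimetric_le iC aB PB; rewrite VB /= VBE.
apply/eqP; rewrite eq_le; apply/andP; split.
  by have := slope (-1); rewrite normrN1 !mulN1r !mulrN opprK lerNr; apply.
by have := slope 1; rewrite normr1 !mul1r; apply.
Qed.
End first_variation.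

Lemma bounded_locally_integrable2 (R : realType) (U : set (plane R)) (F : plane R -> R) (M : R) :
  open (U : set (R * R)) -> measurable_fun U F -> (forall z, U z -> `|F z| <= M) ->
  locally_integrable2 U F.
Proof.
move=> oU mF bF; have mU := open_measurable2 oU; split=> //.
  exact: (@measurable_fun_caratheodory _ (plane R) R (@borel_leb2 R) _ _ U F mU mF).
move=> K KU cK; have mK := compact_measurable2 cK.
have mFK : measurable_fun K (fun z => `|F z|%:E).
  by apply/measurable_EFinP; apply: measurableT_comp => //; exact: measurable_funS mF.
rewrite (_ : (\int[leb2]_(z in K) `|F z|%:E)%E = (\int[@borel_leb2 R]_(z in K) `|F z|%:E)%E); last first.
  exact: (@integral_completed _ (plane R) R (@borel_leb2 R)).
have [r Kr] := compact_bounded_norm cK; have fK := bounded_borel_leb2 mK Kr.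
have := le_bounded_integrable mK fK (measurable_funS mU KU mF) (fun z Kz => bF z (KU z Kz)).
by case/integrableP.
Qed.

Theorem proposition4p1 (R : realType) (D : set (R * R)) (f g : R * R -> R)
    (C : set (R * R * R))
    (hDconvex : convex_set D) (hDcompact : compact D)
    (hDint : interior D !=set0)
    (hf : convex_function D f) (hg : convex_function D (fun z => - g z))
    (hfg : forall z, D z -> f z <= g z)
    (hC : C = region D f g)
    (hCconvex : convex_set C) (hCiso : isoperimetric C) :
  distributional_div (interior D `\` Sigma C D f)
    (fun z => let v := gradient f z + 2 *: perp z in (enorm v)^-1 *: v)
    (fun=> 3 * fine (perimeter C) / (4 * fine (volume C))).
Proof.
subst C; set C := region D f g in hCiso *; set U := D^° `\` Sigma C D f.
set H := 3 * _ / _; cbv zeta; set F : R * R -> R * R := fun z => _.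
pose v z := gradient f z + 2 *: perp z.
have oU : open U by exact: open_not_Sigma.
have mU := open_measurable2 oU.
have mDf (e : R * R) : measurable_fun U ('D_e f).
  apply: (measurable_funS _ _ (measurable_fun_derive hDconvex hf e)); last by move=> z [].
  by apply: open_measurable2; exact: open_interior.
have m1 : measurable_fun U (fun z => (v z).1).
  have -> : (fun z => (v z).1) = (fun z => 'D_((1, 0) : R * R) f z - 2 * z.2).
    by apply/funext => z; rewrite /v /gradient /perp /= /GRing.scale /=; ring.
  apply: (measurable_funB (mDf _)); apply: (measurable_funM (measurable_cst _)).
  exact: (measurable_funTS measurable_snd).
have m2 : measurable_fun U (fun z => (v z).2).
  have -> : (fun z => (v z).2) = (fun z => 'D_((0, 1) : R * R) f z + 2 * z.1) by [].
  apply: (measurable_funD (mDf _)); apply: (measurable_funM (measurable_cst _)).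
  exact: (measurable_funTS measurable_fst).
have mi := measurable_inv_enorm m1 m2.
have mF1 : measurable_fun U (fun z => (F z).1) by exact: (measurable_funM mi m1).
have mF2 : measurable_fun U (fun z => (F z).2) by exact: (measurable_funM mi m2).
(* The bound holds at every point: where v vanishes, the inverse of 0 is 0 and F is 0. *)
have F_le1 z : `|(F z).1| <= 1 /\ `|(F z).2| <= 1.
  apply: unit_norm_le1.
  rewrite (_ : _ + _ = (enorm (v z))^-1 ^+ 2 * dot (v z) (v z)); last first.
    by rewrite /F /dot /= /GRing.scale /=; ring.
  rewrite -sqr_enorm -exprMn; have [->|n0] := eqVneq (enorm (v z)) 0.
    by rewrite mulr0 expr0n ler01.
  by rewrite mulVf // expr1n.
split.
- by apply: (bounded_locally_integrable2 oU mF1) => z _; exact: (F_le1 z).1.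
- by apply: (bounded_locally_integrable2 oU mF2) => z _; exact: (F_le1 z).2.
- by apply: (bounded_locally_integrable2 oU (M := `|H|)) => //; exact: measurable_cst.
move=> phi [Ck cK KU]; have C1 : class_C 1 phi by exact: Ck.
have mphi : measurable_fun setT (phi : plane R -> R).
  by apply: continuous_measurable_fun2; [exact: openT|move=> z _; exact: C1_continuous].
have mD (e : R * R) : measurable_fun setT ('D_e phi : plane R -> R).
  by apply: continuous_measurable_fun2; [exact: openT|move=> z _; have [_] := C1; apply].
have mdot : measurable_fun U (fun z => dot (F z) (gradient phi z)).
  exact: (measurable_funD (measurable_funM mF1 (measurable_funTS (mD (1, 0))))
                          (measurable_funM mF2 (measurable_funTS (mD (0, 1))))).
have mHphi : measurable_fun U (fun z => H * phi z).
  exact: (measurable_funM (measurable_cst H) (measurable_funTS mphi)).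
have [G [N [[mG fG GU] [mN N0 KGN] var]]] := first_variation hDconvex hf hg hfg hCiso C1 cK KU.
have bD (e : R * R) : bm G ('D_e phi).
  split; first exact: measurable_funTS.
  by have [M] := C1_derive_bounded e C1 cK; exists M.
have bF : bm G (fun z => dot (F z) (gradient phi z)).
  apply: (bm_dot (u1 := fun z => (F z).1) (u2 := fun z => (F z).2) _ _ (bD (1, 0)) (bD (0, 1))).
    by split; [exact: measurable_funS mF1|exists 1 => z _; exact: (F_le1 z).1].
  by split; [exact: measurable_funS mF2|exists 1 => z _; exact: (F_le1 z).2].
have bphi : bm G phi.
  split; first exact: measurable_funTS.
  by have [M bM] := compact_support_bounded cK (C1_continuous C1) (@notin_tsupport _ _ phi); exists M.
(* Both integrands vanish off the support of phi, which lies in [G] up to a null set. The completed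
   integral over [U] thus becomes a finite Borel integral over [G]. *)
have onG (k : plane R -> R) : measurable_fun U k -> bm G k -> (forall z, ~ tsupport phi z -> k z = 0) ->
    (\int[leb2]_(z in U) (k z)%:E)%E = (\int[@borel_leb2 R]_(z in G) k z)%:E.
  move=> mk bk k0; have mkE : measurable_fun U (fun z => (k z)%:E) by apply/measurable_EFinP.
  transitivity (\int[@borel_leb2 R]_(z in U) (k z)%:E)%E.
    exact: (@integral_completed _ (plane R) R (@borel_leb2 R)).
  rewrite /Rintegral fineK; last by apply: integrable_fin_num => //; exact: bm_integrable.
  apply: (integral_ae_domain mU mG mN N0) => //; first exact: measurable_funS mkE.
  move=> z nN kz; have Kz : tsupport phi z.
    by apply: contrapT => /k0 k0z; apply: kz; rewrite k0z.
  by split=> [_|/GU//]; have [] := KGN _ Kz.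
rewrite (onG _ mdot bF); last first.
  move=> z nz; rewrite /gradient !(derive_out_tsupport _ nz).
  by rewrite /dot /= !mulr0 addr0.
rewrite (onG _ mHphi (bm_mul (bm_cst _ H) bphi)); last by move=> z /notin_tsupport ->; rewrite mulr0.
rewrite -EFinN; congr _%:E; rewrite (RintegralZl _ mG (bm_integrable mG fG bphi)).
have [[_ /andP[V0 Voo]] _] := hCiso.
have V_gt0 : 0 < fine (volume C) by rewrite fine_gt0 // V0.
have E : \int[@borel_leb2 R]_(z in G) dot (F z) (gradient phi z) =
    \int[@borel_leb2 R]_(z in G) (dot (v z) (gradient phi z) / enorm (v z)).
  by apply: eq_Rintegral => z _; rewrite /F /dot /= /GRing.scale /=; ring.
rewrite E; move: var; set I := \int[_]_(z in G) phi z; set J := \int[_]_(z in G) _ => var.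
have V4 : 4 * fine (volume C) != 0 by rewrite mulf_neq0 ?pnatr_eq0 ?gt_eqF.
by apply: (mulfI V4); rewrite mulrN var opprK /H mulrA (mulrC _ (_ / _)) divfK.
Qed.
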